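(* Let $\nu$ be a probability measure on the simplex $\Delta_n$. For every $X_1,\dots,X_n\in\mathbb{P}_d$ and every Horn tuple $(I_1,\dots,I_n;K)$ of rank $r$ in dimension $d$, $$\Bigl(\prod_{k\in K}\lambda_k^\uparrow\bigl(\sigma_\nu(X_1,\dots,X_n)\bigr)\Bigr)^{1/r}\ge\gamma_\nu\Bigl(\bigl(\textstyle\prod_{i_1\in I_1}\lambda_{i_1}^\uparrow(X_1)\bigr)^{1/r},\dots,\bigl(\prod_{i_n\in I_n}\lambda_{i_n}^\uparrow(X_n)\bigr)^{1/r}\Bigr),$$ where $$\gamma_\nu(x_1,\dots,x_n)=\int_{\Delta_n}\Bigl(\prod_{i=1}^nx_i^{w_i}\Bigr)d\nu(w).$$
   Context: $\mathbb{P}_d$ is the set of $d\times d$ positive definite complex matrices; $\lambda_1^\uparrow(A)\le\lambda_2^\uparrow(A)\le\cdots$ are the eigenvalues of a Hermitian matrix $A$ in increasing order. $\Delta_n=\{w=(w_1,\dots,w_n):w_i\ge0,\ \sum_iw_i=1\}$. With $\delta(X,Y)=\|\log(X^{-1/2}YX^{-1/2})\|_2$ (Hilbert–Schmidt norm), $(\mathbb{P}_d,\delta)$ is a Hadamard space. For $w\in\Delta_n$, the weighted Karcher mean of $X_1,\dots,X_n\in\mathbb{P}_d$ is the unique minimizer $$G_n(w;X_1,\dots,X_n)=\operatorname*{arg\,min}_{M\in\mathbb{P}_d}\sum_{i=1}^nw_i\,\delta^2(M,X_i),$$ and the $n$-variable geodesic mean is $$\sigma_\nu(X_1,\dots,X_n)=\int_{\Delta_n}G_n(w;X_1,\dots,X_n)\,d\nu(w).$$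 $[d]=\{1,\dots,d\}$; $\mathrm{Gr}(r,d)$ is the set of $r$-dimensional subspaces of $\mathbb{C}^d$. For $I=\{i_1<\dots<i_r\}\subset[d]$, $I^\vee=\{d+1-i_r<\dots<d+1-i_1\}$. For a complete flag $E_\bullet=(E_1\subset\cdots\subset E_d=\mathbb{C}^d)$, $$\Omega_I(E_\bullet)=\{L\in\mathrm{Gr}(r,d):\dim(L\cap E_{i_q})\ge q\text{ for }q=1,\dots,r\}.$$ An $(n+1)$-tuple $(I_1,\dots,I_n;K)$ of $r$-subsets of $[d]$ is a Horn tuple of rank $r$ in dimension $d$ if $$\Omega_{I_1^\vee}(E_\bullet^{(1)})\cap\cdots\cap\Omega_{I_n^\vee}(E_\bullet^{(n)})\cap\Omega_K(G_\bullet)\ne\varnothing$$ for every choice of complete flags $E_\bullet^{(1)},\dots,E_\bullet^{(n)},G_\bullet$ in $\mathbb{C}^d$. *)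

(* Defs.v *)
From HB Require Import structures.
From mathcomp Require Import all_boot all_order all_algebra.
From mathcomp Require Import complex.
From mathcomp Require Import all_classical all_reals all_analysis.

Set Implicit Arguments.
Unset Strict Implicit.
Unset Printing Implicit Defensive.

Import Order.TTheory GRing.Theory Num.Theory.
Local Open Scope classical_set_scope.
Local Open Scope complex_scope.
Local Open Scope sesquilinear_scope.
Local Open Scope ring_scope.

Section PositiveDefinite.
Context {R : realType} {d : nat}.
Implicit Types A X Y M : 'M[R[i]]_d.

Definition posdef A : Prop :=
  A \is hermsymmx /\
  forall v : 'cV[R[i]]_d, v != 0 -> 0 < (v ^t* *m A *m v) 0 0.

(* closed_field_poly_normal lists the roots with their multiplicities; for
   Hermitian A they are real, so taking real parts loses nothing. *)
Definition eigenvalues_up A : seq R :=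
  sort <=%R [seq complex.Re z | z <- sval (closed_field_poly_normal (char_poly A))].

(* 'I_d counts from 0: the k-th eigenvalue in 1-based numbering has index k-1. *)
Definition lambda_up (k : 'I_d) A : R := (eigenvalues_up A)`_k.

(* Continuous functional calculus on Hermitian matrices:
   A = U^-1 diag(a) U with U unitary is sent to U^-1 diag(f a) U. *)
Definition mxfun (f : R -> R) A : 'M[R[i]]_d :=
  invmx (spectralmx A)
  *m diag_mx (\row_j (f (complex.Re (spectral_diag A 0 j)))%:C)
  *m spectralmx A.

Definition mxlog A := mxfun (@ln R) A.
Definition mx_invsqrt A := mxfun (fun x => (Num.sqrt x)^-1) A.

Definition hs_norm A : R := Num.sqrt (complex.Re (\tr (A ^t* *m A))).

Definition delta X Y : R :=
  hs_norm (mxlog (mx_invsqrt X *m Y *m mx_invsqrt X)).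

End PositiveDefinite.

Section GeodesicMean.
Context {R : realType} {n d : nat}.

(* Tuples carry the product of the Borel sigma-algebras of R. *)
Definition simplex : set (n.-tuple (measurableTypeR R)) :=
  [set w | (forall i, 0 <= tnth w i :> R) /\ \sum_(i < n) (tnth w i : R) = 1].

Definition karcher_cost (w : n.-tuple R) (X : 'I_n -> 'M[R[i]]_d)
    (M : 'M[R[i]]_d) : R :=
  \sum_(i < n) tnth w i * delta M (X i) ^+ 2.

(* For w in the simplex and positive definite X i there is exactly one
   minimizer, so the default value 0 of xget plays no role. *)
Definition karcher_mean (w : n.-tuple R) (X : 'I_n -> 'M[R[i]]_d) :
    'M[R[i]]_d :=
  xget 0 [set M | posdef M /\
    forall N, posdef N -> karcher_cost w X M <= karcher_cost w X N].

(* The matrix-valued integral is taken entrywise, on real and imaginary parts. *)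
Definition geodesic_mean
    (nu : probability (n.-tuple (measurableTypeR R)) R)
    (X : 'I_n -> 'M[R[i]]_d) : 'M[R[i]]_d :=
  \matrix_(i, j)
    ((\int[nu]_(w in simplex) complex.Re (karcher_mean w X i j)) +i*
     (\int[nu]_(w in simplex) complex.Im (karcher_mean w X i j))).

Definition gamma_mean
    (nu : probability (n.-tuple (measurableTypeR R)) R) (x : 'I_n -> R) : R :=
  \int[nu]_(w in simplex) \prod_(i < n) (x i `^ (tnth w i : R)).

End GeodesicMean.

Section Horn.
Context (R : realType) (d : nat).

(* E k is the (k+1)-dimensional member of the flag. *)
Definition complete_flag (E : 'I_d -> {vspace 'cV[R[i]]_d}) : Prop :=
  (forall k : 'I_d, \dim (E k) = k.+1) /\
  (forall k l : 'I_d, (k <= l)%N -> (E k <= E l)%VS).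

(* enum_val lists I increasingly; q is counted from 0. *)
Definition schubert (I : {set 'I_d}) (E : 'I_d -> {vspace 'cV[R[i]]_d}) :
    set {vspace 'cV[R[i]]_d} :=
  [set L | \dim L = #|I| /\
    forall q : 'I_#|I|, (q.+1 <= \dim (L :&: E (enum_val q)))%N].

(* rev_ord is i |-> d - 1 - i, i.e. i |-> d + 1 - i in 1-based numbering. *)
Definition dual_set (I : {set 'I_d}) : {set 'I_d} := [set rev_ord i | i in I].

Definition horn_tuple (n r : nat) (I : 'I_n -> {set 'I_d}) (K : {set 'I_d}) :
    Prop :=
  (forall j, #|I j| = r) /\ #|K| = r /\
  forall (E : 'I_n -> 'I_d -> {vspace 'cV[R[i]]_d})
         (G : 'I_d -> {vspace 'cV[R[i]]_d}),
    (forall j, complete_flag (E j)) -> complete_flag G ->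
    (\bigcap_(j in setT) schubert (dual_set (I j)) (E j)) `&` schubert K G !=set0.

End Horn.

(* Main.v *)
(*
The Karcher mean G of weights w satisfies sum_i w_i log(Y_i) = 0 for X_i = S Y_i S^*,
G = S S^*.  Let L lie in the Schubert cells of the eigenflags of the X_i
(decreasing eigenvalues) and of the integrated mean (increasing eigenvalues), and
let V have an orthonormal basis of L, adapted to the latter flag, as columns v_q.
Jensen's inequality for ln det of a compression, combined with the first-order
condition, gives
  prod_q v_q^* G v_q >= det(V^* G V) >= prod_i det(V^* X_i^-1 V)^(- w_i),
and Hadamard's inequality in a basis adapted to the eigenflag of X_i bounds
det(V^* X_i^-1 V) by prod_(k in I_i) lambda_k(X_i)^-1.  The geometric mean of the
numbers v_q^* G v_q is at most a linear functional of G that takes the value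
(prod_q v_q^* sigma v_q)^(1/r) at the integrated mean sigma, so integrating over w
concludes.

That barycenters exist, are unique and depend on w in a Hoelder-continuous way
(whence measurability) follows from the exponential metric increasing property
|A - B|_2 <= delta(e^A, e^B).  It comes from delta(e^A, e^B) <= delta(e^2A, e^2B) / 2,
a consequence of Weyl's majorization of eigenvalues by singular values.
*)
Require Import Defs.
From HB Require Import structures.
From mathcomp Require Import all_boot all_order all_algebra.
From mathcomp Require Import complex.
From mathcomp Require Import all_classical all_reals all_analysis.
From mathcomp Require Import measurable_realfun perm ring lra.

Set Implicit Arguments.
Unset Strict Implicit.
Unset Printing Implicit Defensive.

Import Order.TTheory GRing.Theory Num.Theory.
Import numFieldNormedType.Exports.
Local Open Scope complex_scope.
Local Open Scope sesquilinear_scope.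
Local Open Scope ring_scope.

(** The subspace L depends only on the X_i and on the integrated mean, so the Horn condition is used
    once and a single V serves every weight. This dictates the last step: the geometric mean of the
    v_q^* G v_q is concave in G, so its tangent functional at sigma dominates it for all w at once
    and commutes with the integral. Matrix functions are never differentiated. Two Hermitian
    matrices with eigenvectors u_i and v_j are compared through the doubly stochastic weights |<u_i,
    v_j>|^2, which reduce norms, traces and Taylor estimates to scalar inequalities between pairs of
    eigenvalues. Distances to a moving base point M are read in a frame S with M = S S^*: there X
    becomes S B S^*, and the distance depends on the eigenvalues of B alone. The exponential metric
    increasing property stands in for nonpositive curvature: it yields coercivity for existence and,
    through the variance inequality, uniqueness and stability in w. *)

(* Everything up to the last section sees the complex numbers only through this
   interface, so that R[i] is never unfolded to pairs. *)
Record complexification (R : realType) (C : numClosedFieldType) := Complexification {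
  rc : {rmorphism R -> C};
  re : {additive C -> R};
  im : {additive C -> R};
  rcK : cancel rc re;
  im_rc : forall x, im (rc x) = 0;
  reMM : forall x y, re (x * y) = re x * re y - im x * im y;
  re_conj : forall z, re (Num.conj z) = re z;
  im_conj : forall z, im (Num.conj z) = - im z;
  re_real : forall z, z \is Num.real -> rc (re z) = z;
  conjM_re_im : forall z, Num.conj z * z = rc (re z ^+ 2 + im z ^+ 2) }.

Section MatrixMeans.
Context {R : realType} {C : numClosedFieldType} (E : complexification R C).
Local Notation "x %:C" := (rc E x) : ring_scope.
Local Notation Re := (re E).
Local Notation Im := (im E).
Local Notation complexI := (can_inj (rcK E)).

Lemma reM (x : R) (z : C) : Re (x%:C * z) = x * Re z.
Proof. by rewrite reMM rcK im_rc mul0r subr0. Qed.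

Definition nrm2 (z : C) : R := Re z ^+ 2 + Im z ^+ 2.

Lemma conjM_nrm2 (z : C) : Num.conj z * z = (nrm2 z)%:C.
Proof. exact: conjM_re_im. Qed.

Lemma nrm2_ge0 (z : C) : 0 <= nrm2 z.
Proof. by rewrite addr_ge0 ?sqr_ge0. Qed.

Lemma nrm2_eq0 (z : C) : (nrm2 z == 0) = (z == 0).
Proof.
rewrite -(inj_eq complexI) -conjM_nrm2 rmorph0 mulf_eq0 conjC_eq0.
by rewrite orbb.
Qed.

Lemma nrm2M (x y : C) : nrm2 (x * y) = nrm2 x * nrm2 y.
Proof.
by apply: complexI; rewrite rmorphM -!conjM_nrm2 rmorphM; ring.
Qed.

(** The interface does not list this. A nonnegative x is conj z * z for z the image of its square
    root, and conj z * z is fixed by conjugation; negative x follow by a change of sign. *)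
Lemma conj_real (x : R) : Num.conj (x%:C : C) = x%:C.
Proof.
have h y : Num.conj (y%:C : C) = y%:C -> Num.conj ((- y)%:C) = (- y)%:C.
  by move=> h; rewrite !rmorphN /= h.
have [x0|/ltW x0] := leP 0 x; last first.
  rewrite -[x]opprK; apply: h; rewrite -(sqr_sqrtr (_ : 0 <= - x)) ?oppr_ge0//.
  by have := conjM_nrm2 (Num.sqrt (- x))%:C; rewrite /nrm2 rcK im_rc expr0n addr0 => <-; rewrite rmorphM /= conjCK mulrC.
rewrite -(sqr_sqrtr x0).
by have := conjM_nrm2 (Num.sqrt x)%:C; rewrite /nrm2 rcK im_rc expr0n addr0 => <-; rewrite rmorphM /= conjCK mulrC.
Qed.

Lemma nrm2_real (x : R) : nrm2 x%:C = x ^+ 2.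
Proof. by rewrite /nrm2 rcK im_rc expr0n addr0. Qed.

(** * Adjoints and the Hilbert-Schmidt norm *)

Lemma adjM m n p (A : 'M[C]_(m, n)) (B : 'M[C]_(n, p)) :
  (A *m B)^t* = B^t* *m A^t*.
Proof. by rewrite trmx_mul map_mxM. Qed.

Lemma adj1 n : (1%:M : 'M[C]_n)^t* = 1%:M.
Proof. by rewrite trmx1 map_mx1. Qed.

Lemma adjD m n (A B : 'M[C]_(m, n)) : (A + B)^t* = A^t* + B^t*.
Proof. by apply/matrixP => i j; rewrite !mxE rmorphD. Qed.

Lemma adjN m n (A : 'M[C]_(m, n)) : (- A)^t* = - A^t*.
Proof. by apply/matrixP => i j; rewrite !mxE rmorphN. Qed.

Lemma adjZ m n (c : R) (A : 'M[C]_(m, n)) : (c%:C *: A)^t* = c%:C *: A^t*.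
Proof. by apply/matrixP => i j; rewrite !mxE rmorphM /= conj_real. Qed.

Lemma adj_unit n (A : 'M[C]_n) : (A^t* \in unitmx) = (A \in unitmx).
Proof. by rewrite map_unitmx unitmx_tr. Qed.

Lemma adj_inv n (A : 'M[C]_n) : (invmx A)^t* = invmx (A^t*).
Proof. by rewrite trmx_inv map_invmx. Qed.

Lemma unitary_adjl n (U : 'M[C]_n) : U \is unitarymx -> U^t* *m U = 1%:M.
Proof. by move=> /unitarymxP/mulmx1C. Qed.

Lemma unitary_adjr n (U : 'M[C]_n) : U \is unitarymx -> U *m U^t* = 1%:M.
Proof. by move=> /unitarymxP. Qed.

Definition hsq m n (A : 'M[C]_(m, n)) : R := \sum_i \sum_j nrm2 (A i j).

Lemma hsq_ge0 m n (A : 'M[C]_(m, n)) : 0 <= hsq A.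
Proof. by apply: sumr_ge0 => i _; apply: sumr_ge0 => j _; exact: nrm2_ge0. Qed.

Lemma hsq_eq0 m n (A : 'M[C]_(m, n)) : hsq A = 0 -> A = 0.
Proof.
move=> h; apply/matrixP => i j; rewrite mxE; apply/eqP; rewrite -nrm2_eq0.
have h1 := psumr_eq0P (fun i _ => sumr_ge0 _ (fun j _ => nrm2_ge0 (A i j))) h.
apply/eqP; apply: (psumr_eq0P _ (h1 i _)) => // k _; exact: nrm2_ge0.
Qed.

Lemma tr_adj_mul m n (A : 'M[C]_(m, n)) : \tr (A^t* *m A) = (hsq A)%:C.
Proof.
rewrite /mxtrace /hsq exchange_big rmorph_sum /=; apply: eq_bigr => j _.
rewrite mxE rmorph_sum; apply: eq_bigr => i _.
by rewrite !mxE conjM_nrm2.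
Qed.

Lemma hsq_col n (v : 'cV[C]_n) : (v^t* *m v) 0 0 = (hsq v)%:C.
Proof. by rewrite -tr_adj_mul /mxtrace big_ord1. Qed.

Lemma hsq_unitary_l n m (U : 'M[C]_n) (A : 'M[C]_(n, m)) :
  U \is unitarymx -> hsq (U *m A) = hsq A.
Proof.
move=> hU; apply: complexI; rewrite -!tr_adj_mul adjM mulmxA.
by rewrite -(mulmxA _ (U^t*)) unitary_adjl// mulmx1.
Qed.

(** * Spectral calculus *)

Definition qf n (A : 'M[C]_n) (v : 'cV[C]_n) : R := Re ((v^t* *m A *m v) 0 0).

(** The form in which Hermitian matrices are handled throughout: the eigenvectors are the columns of
    [U^t*], and [U *m v] lists the coordinates of v in that eigenbasis. *)
Definition spec n (U : 'M[C]_n) (a : 'I_n -> R) : 'M[C]_n :=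
  U^t* *m diag_mx (\row_j (a j)%:C) *m U.

Lemma eq_spec n (U : 'M[C]_n) a b : a =1 b -> spec U a = spec U b.
Proof.
move=> ab; rewrite /spec; congr (_ *m diag_mx _ *m _).
by apply/rowP => j; rewrite !mxE ab.
Qed.

Lemma specM n (U : 'M[C]_n) a b : U \is unitarymx ->
  spec U a *m spec U b = spec U (fun j => a j * b j).
Proof.
move=> hU; rewrite /spec !mulmxA -(mulmxA _ U) unitary_adjr// mulmx1.
rewrite -(mulmxA _ (diag_mx _) (diag_mx _)) mulmx_diag; congr (_ *m diag_mx _ *m _).
by apply/rowP => j; rewrite !mxE rmorphM.
Qed.

Lemma spec1 n (U : 'M[C]_n) : U \is unitarymx -> spec U (fun=> 1) = 1%:M.
Proof.
move=> hU; rewrite /spec (_ : \row_j _ = const_mx 1); last first.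
  by apply/rowP => j; rewrite !mxE rmorph1.
by rewrite diag_const_mx mulmx1 unitary_adjl.
Qed.

Lemma specD n (U : 'M[C]_n) a b :
  spec U a + spec U b = spec U (fun j => a j + b j).
Proof.
rewrite /spec -mulmxDl -mulmxDr -raddfD; congr (_ *m diag_mx _ *m _).
by apply/rowP => j; rewrite !mxE rmorphD.
Qed.

Lemma specN n (U : 'M[C]_n) a : - spec U a = spec U (fun j => - a j).
Proof.
rewrite /spec -mulNmx -mulmxN -raddfN; congr (_ *m diag_mx _ *m _).
by apply/rowP => j; rewrite !mxE rmorphN.
Qed.

Lemma specZ n (U : 'M[C]_n) (c : R) a :
  c%:C *: spec U a = spec U (fun j => c * a j).
Proof.
rewrite /spec scalemxAl scalemxAr -linearZ; congr (_ *m diag_mx _ *m _).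
by apply/rowP => j; rewrite !mxE rmorphM.
Qed.

Lemma spec_adj n (U : 'M[C]_n) a : (spec U a)^t* = spec U a.
Proof.
rewrite /spec !adjM trmxCK mulmxA; congr (_ *m _ *m _).
apply/matrixP => i j; rewrite !mxE.
rewrite eq_sym; case: eqVneq => [->|_]; first by rewrite !mulr1n conj_real.
by rewrite !mulr0n conjC0.
Qed.

Lemma specV n (U : 'M[C]_n) a : U \is unitarymx -> (forall j, a j != 0) ->
  spec U a \in unitmx /\ invmx (spec U a) = spec U (fun j => (a j)^-1).
Proof.
move=> hU ha.
have e : spec U a *m spec U (fun j => (a j)^-1) = 1%:M.
  rewrite specM// (@eq_spec _ _ _ (fun=> 1)) ?spec1// => j.
  by rewrite divff.
have [u _] := mulmx1_unit e; split => //.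
by rewrite -[LHS]mulmx1 -e mulKmx.
Qed.

Lemma spec_qf n (U : 'M[C]_n) a (v : 'cV[C]_n) :
  (v^t* *m spec U a *m v) 0 0 = (\sum_j a j * nrm2 ((U *m v) j 0))%:C.
Proof.
rewrite /spec !mulmxA -(mulmxA _ U v) -adjM mul_mx_diag mxE rmorph_sum.
apply: eq_bigr => j _; rewrite rmorphM /= -conjM_nrm2 [X in X * _ = _]mxE.
by rewrite !mxE; ring.
Qed.

Lemma qf_spec n (U : 'M[C]_n) a (v : 'cV[C]_n) :
  qf (spec U a) v = \sum_j a j * nrm2 ((U *m v) j 0).
Proof. by rewrite /qf spec_qf rcK. Qed.

(** The functional calculus does not depend on the diagonalization: W = U V^* intertwines the two
    diagonal matrices, so W_ij vanishes unless a_i = b_j, and then W also intertwines their images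
    under f. *)
Lemma spec_fun_eq n (U V : 'M[C]_n) a b (f : R -> R) :
  U \is unitarymx -> V \is unitarymx -> spec U a = spec V b ->
  spec U (f \o a) = spec V (f \o b).
Proof.
move=> hU hV e.
pose W := U *m V^t*.
have comm f' : spec U (f' \o a) = spec V (f' \o b) <->
    diag_mx (\row_j (f' (a j))%:C) *m W = W *m diag_mx (\row_j (f' (b j))%:C).
  rewrite /spec /W; split => [h|h].
    rewrite -[in RHS](mulmx1 (_ *m diag_mx _)) -(unitary_adjr hV) !mulmxA.
    rewrite -!(mulmxA U) mulmxA in h *.
    rewrite -[in RHS](mulmxA (V^t*)) (mulmxA (V^t*)) -h.
    by rewrite !mulmxA unitary_adjr// mul1mx.
  have := congr1 (fun M => U^t* *m M *m V) h.
  rewrite !mulmxA -(mulmxA _ (V^t*)) unitary_adjl// mulmx1 => ->.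
  by rewrite unitary_adjl// mul1mx.
have /(comm id) h := e.
apply/comm; apply/matrixP => i j.
have := congr1 (fun M : 'M[C]_n => M i j) h.
rewrite !mul_diag_mx !mul_mx_diag !mxE /= -!/(fun_of_matrix _ _ _).
have -> : \sum_j0 U i j0 * (V^t*) j0 j = W i j by rewrite mxE.
have [->|Wn0] := eqVneq (W i j) 0; first by rewrite !mulr0 !mul0r.
by rewrite mulrC => /(mulfI Wn0)/complexI ->; rewrite mulrC.
Qed.

Lemma herm_spec n (A : 'M[C]_n) : A^t* = A ->
  exists U a, U \is unitarymx /\ A = spec U a.
Proof.
move=> hA; have hh : A \is hermsymmx.
  by apply/is_hermitianmxP; rewrite expr0 scale1r hA.
exists (spectralmx A), (fun j => Re (spectral_diag A 0 j)); split.
  exact: spectral_unitarymx.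
have /orthomx_spectralP e := hermitian_normalmx hh.
rewrite {1}e /spec invmx_unitary ?spectral_unitarymx//; congr (_ *m diag_mx _ *m _).
apply/rowP => j; rewrite mxE re_real//.
by have /mxOverP/(_ 0 j) := hermitian_spectral_diag_real hh.
Qed.

Definition mxf n (f : R -> R) (A : 'M[C]_n) : 'M[C]_n :=
  invmx (spectralmx A)
  *m diag_mx (\row_j (f (Re (spectral_diag A 0 j)))%:C)
  *m spectralmx A.

Lemma mxf_spec n (U : 'M[C]_n) a f : U \is unitarymx ->
  mxf f (spec U a) = spec U (f \o a).
Proof.
move=> hU; set A := spec U a.
have hh : A \is hermsymmx.
  by apply/is_hermitianmxP; rewrite expr0 scale1r spec_adj.
have /orthomx_spectralP e := hermitian_normalmx hh.
rewrite /mxf invmx_unitary ?spectral_unitarymx//.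
apply/esym; apply: (@spec_fun_eq _ U (spectralmx A) a (fun j => Re (spectral_diag A 0 j))) => //.
  exact: spectral_unitarymx.
rewrite -/A {1}e /spec invmx_unitary ?spectral_unitarymx//; congr (_ *m diag_mx _ *m _).
apply/rowP => j; rewrite mxE re_real//.
by have /mxOverP/(_ 0 j) := hermitian_spectral_diag_real hh.
Qed.

Lemma hermsymmxP n (A : 'M[C]_n) : A \is hermsymmx <-> A^t* = A.
Proof.
by split => [/is_hermitianmxP|] h; [|apply/is_hermitianmxP]; move: h;
  rewrite expr0 scale1r.
Qed.

Lemma tr_diag_conj n (W : 'M[C]_n) a b :
  Re (\tr (diag_mx (\row_j (a j)%:C) *m W *m diag_mx (\row_j (b j)%:C) *m W^t*)) =
  \sum_i \sum_j a i * b j * nrm2 (W i j).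
Proof.
rewrite /mxtrace raddf_sum; apply: eq_bigr => i _.
rewrite mxE raddf_sum; apply: eq_bigr => j _.
rewrite mul_mx_diag mul_diag_mx !mxE -[RHS](rcK E) !rmorphM /= -conjM_nrm2.
by congr (Re _); ring.
Qed.

Lemma tr_specM n (U V : 'M[C]_n) a b :
  Re (\tr (spec U a *m spec V b)) =
  \sum_i \sum_j a i * b j * nrm2 ((U *m V^t*) i j).
Proof.
rewrite -tr_diag_conj /spec adjM trmxCK -!mulmxA mxtrace_mulC !mulmxA.
by rewrite -!mulmxA.
Qed.

Lemma unitary_row_nrm n (U : 'M[C]_n) i : U \is unitarymx ->
  \sum_j nrm2 (U i j) = 1.
Proof.
move=> /unitarymxP/matrixP/(_ i i); rewrite !mxE eqxx => h; apply: complexI.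
rewrite rmorph1 -[RHS]h rmorph_sum; apply: eq_bigr => j _.
by rewrite !mxE mulrC conjM_nrm2.
Qed.

Lemma unitary_col_nrm n (U : 'M[C]_n) j : U \is unitarymx ->
  \sum_i nrm2 (U i j) = 1.
Proof.
move=> hU; have /matrixP/(_ j j) := unitary_adjl hU; rewrite !mxE eqxx => h.
apply: complexI; rewrite rmorph1 -[RHS]h rmorph_sum; apply: eq_bigr => i _.
by rewrite !mxE conjM_nrm2.
Qed.

Lemma unitary_mul_adj n (U V : 'M[C]_n) : U \is unitarymx -> V \is unitarymx ->
  U *m V^t* \is unitarymx.
Proof. by move=> hU hV; rewrite mul_unitarymx// trmxC_unitary. Qed.

Lemma sum_unitary_l n (W : 'M[C]_n) (f : 'I_n -> R) : W \is unitarymx ->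
  \sum_i \sum_j f i * nrm2 (W i j) = \sum_i f i.
Proof.
by move=> hW; apply: eq_bigr => i _; rewrite -mulr_sumr unitary_row_nrm// mulr1.
Qed.

Lemma sum_unitary_r n (W : 'M[C]_n) (f : 'I_n -> R) : W \is unitarymx ->
  \sum_i \sum_j f j * nrm2 (W i j) = \sum_j f j.
Proof.
move=> hW; rewrite exchange_big.
by apply: eq_bigr => i _; rewrite -mulr_sumr unitary_col_nrm// mulr1.
Qed.

Lemma tr_spec n (U : 'M[C]_n) a : U \is unitarymx ->
  Re (\tr (spec U a)) = \sum_i a i.
Proof.
move=> hU; rewrite /spec mxtrace_mulC mulmxA unitary_adjr// mul1mx.
by rewrite mxtrace_diag raddf_sum; apply: eq_bigr => i _; rewrite mxE rcK.
Qed.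

Lemma hsqE m n (A : 'M[C]_(m, n)) : hsq A = Re (\tr (A^t* *m A)).
Proof. by rewrite tr_adj_mul rcK. Qed.

Lemma hsq_spec n (U : 'M[C]_n) a : U \is unitarymx ->
  hsq (spec U a) = \sum_i a i ^+ 2.
Proof. by move=> hU; rewrite hsqE spec_adj specM// tr_spec. Qed.

(** The squared moduli of the entries of U V^* have row and column sums 1, so the separate sums over
    a_i^2 and b_j^2 can be spread over all pairs (i, j), where the cross term completes the
    square. *)
Lemma hsq_spec_sub n (U V : 'M[C]_n) a b : U \is unitarymx -> V \is unitarymx ->
  hsq (spec U a - spec V b) =
  \sum_i \sum_j (a i - b j) ^+ 2 * nrm2 ((U *m V^t*) i j).
Proof.
move=> hU hV; have hW := unitary_mul_adj hU hV.
rewrite hsqE adjD adjN !spec_adj.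
rewrite mulmxBl !mulmxBr !raddfB /= (mxtrace_mulC (spec V b) (spec U a)).
rewrite !specM// !tr_spec// tr_specM.
rewrite -(sum_unitary_l (fun i => a i * a i) hW).
rewrite -(sum_unitary_r (fun i => b i * b i) hW).
rewrite -!sumrN -!big_split /=; apply: eq_bigr => i _.
rewrite -!sumrN -!big_split /=; apply: eq_bigr => j _; ring.
Qed.

Lemma nrm2_0 : nrm2 0 = 0.
Proof. by apply/eqP; rewrite nrm2_eq0. Qed.

Lemma nrm2_1 : nrm2 1 = 1.
Proof. by rewrite -(rmorph1 (rc E)) nrm2_real expr1n. Qed.

Lemma hsq0 m n : hsq (0 : 'M[C]_(m, n)) = 0.
Proof. by rewrite /hsq big1 // => i _; rewrite big1 // => j _; rewrite mxE nrm2_0. Qed.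

Lemma det_adj n (A : 'M[C]_n) : \det (A^t*) = Num.conj (\det A).
Proof. by rewrite det_map_mx det_tr. Qed.

Lemma qf_congr m n (A : 'M[C]_m) (S : 'M[C]_(m, n)) v :
  qf (S^t* *m A *m S) v = qf A (S *m v).
Proof. by rewrite /qf adjM !mulmxA. Qed.

Lemma adj_congr m n (A : 'M[C]_m) (S : 'M[C]_(m, n)) : A^t* = A ->
  (S^t* *m A *m S)^t* = S^t* *m A *m S.
Proof. by move=> hA; rewrite !adjM trmxCK hA mulmxA. Qed.

(** * Positive definite matrices and determinants of compressions *)

Definition pd n (A : 'M[C]_n) : Prop :=
  A^t* = A /\ forall v : 'cV[C]_n, v != 0 -> 0 < qf A v.

Lemma hsq_gt0 m n (A : 'M[C]_(m, n)) : A != 0 -> 0 < hsq A.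
Proof.
move=> A0; rewrite lt_def hsq_ge0 andbT; apply: contraNneq A0.
by move=> /hsq_eq0 ->.
Qed.

Lemma qf_herm_real n (A : 'M[C]_n) (v : 'cV[C]_n) : A^t* = A ->
  (v^t* *m A *m v) 0 0 = (qf A v)%:C.
Proof. by move=> /herm_spec[U [a [hU ->]]]; rewrite qf_spec spec_qf. Qed.

Lemma pd_spec n (U : 'M[C]_n) (a : 'I_n -> R) : U \is unitarymx -> (forall j, 0 < a j) ->
  pd (spec U a).
Proof.
move=> hU ha; split=> [|v v0]; first exact: spec_adj.
rewrite qf_spec lt_def; apply/andP; split; last first.
  by apply: sumr_ge0 => j _; rewrite mulr_ge0 ?nrm2_ge0// ltW.
apply: contraNneq v0 => h.
suff : U *m v = 0.
  move=> /(congr1 (mulmx (U^t*))).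
  by rewrite mulmxA unitary_adjl// mul1mx mulmx0 => ->.
apply/colP => j; rewrite [RHS]mxE; apply/eqP; rewrite -nrm2_eq0.
have := psumr_eq0P (fun j _ => mulr_ge0 (ltW (ha j)) (nrm2_ge0 ((U *m v) j 0))) h.
by move=> /(_ j isT)/eqP; rewrite mulf_eq0 gt_eqF.
Qed.

Lemma unitary_col_adj n (U : 'M[C]_n) j : U \is unitarymx ->
  U *m col j (U^t*) = delta_mx j 0.
Proof. by move=> hU; rewrite colE mulmxA unitary_adjr// mul1mx. Qed.

Lemma qf_adj_col n (U : 'M[C]_n) (a : 'I_n -> R) j : U \is unitarymx ->
  qf (spec U a) (col j (U^t*)) = a j.
Proof.
move=> hU; rewrite qf_spec unitary_col_adj// (bigD1 j)//= big1 => [|i ij].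
  by rewrite mxE !eqxx addr0 nrm2_1 mulr1.
by rewrite mxE (negbTE ij) nrm2_0 mulr0.
Qed.

Lemma hsq_adj_col n (U : 'M[C]_n) j : U \is unitarymx -> hsq (col j (U^t*)) = 1.
Proof.
move=> hU; rewrite -(qf_adj_col (fun=> 1) j hU) spec1// /qf mulmx1 hsq_col.
by rewrite rcK.
Qed.

Lemma pdP n (A : 'M[C]_n) : pd A ->
  exists U (a : 'I_n -> R), [/\ U \is unitarymx, forall j, 0 < a j & A = spec U a].
Proof.
move=> [hA pA]; have [U [a [hU eA]]] := herm_spec hA.
exists U, a; split => // j; rewrite -(qf_adj_col a j hU) -eA; apply: pA.
apply/negP => /eqP h; have := hsq_adj_col j hU.
by rewrite h hsq0 => /eqP; rewrite eq_sym oner_eq0.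
Qed.

Lemma pd_congr m n (A : 'M[C]_m) (S : 'M[C]_(m, n)) : pd A ->
  (forall v : 'cV[C]_n, S *m v = 0 -> v = 0) -> pd (S^t* *m A *m S).
Proof.
move=> [hA pA] hS; split=> [|v v0]; first exact: adj_congr.
by rewrite qf_congr; apply: pA; apply: contraNneq v0 => /hS ->.
Qed.

Lemma pd_congr_unit n (A S : 'M[C]_n) : pd A -> S \in unitmx ->
  pd (S^t* *m A *m S).
Proof.
move=> pA hS; apply: pd_congr => // v /(congr1 (mulmx (invmx S))).
by rewrite mulmxA mulVmx// mul1mx mulmx0.
Qed.

Lemma iso_inj m n (F : 'M[C]_(m, n)) (v : 'cV[C]_n) :
  F^t* *m F = 1%:M -> F *m v = 0 -> v = 0.
Proof.
by move=> hF /(congr1 (mulmx (F^t*))); rewrite mulmxA hF mul1mx mulmx0.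
Qed.

Lemma det_spec n (U : 'M[C]_n) (a : 'I_n -> R) : U \is unitarymx ->
  \det (spec U a) = (\prod_j a j)%:C.
Proof.
move=> hU; rewrite /spec !det_mulmx mulrAC -det_mulmx unitary_adjl// det1 mul1r.
by rewrite det_diag rmorph_prod; apply: eq_bigr => j _; rewrite mxE.
Qed.

(** The tangent bound ln u <= u - 1 is applied at u = p_j / m with m the weighted mean, so that the
    right-hand sides average to zero. *)
Lemma jensen_ln n (w p : 'I_n -> R) : (forall j, 0 <= w j) ->
  \sum_j w j = 1 -> (forall j, 0 < p j) ->
  \sum_j w j * ln (p j) <= ln (\sum_j w j * p j).
Proof.
move=> w0 w1 p0; set m := \sum_j w j * p j.
have m0 : 0 < m.
  rewrite lt_def sumr_ge0 ?andbT => [|j _]; last by rewrite mulr_ge0// ltW.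
  apply/negP => /eqP h.
  have := psumr_eq0P (fun j _ => mulr_ge0 (w0 j) (ltW (p0 j))) h.
  move=> h'; move: w1; rewrite big1 => [/eqP|j _]; first by rewrite eq_sym oner_eq0.
  by have /eqP := h' j isT; rewrite mulf_eq0 (gt_eqF (p0 j)) orbF => /eqP.
rewrite -subr_le0 -[ln m]mul1r -w1 mulr_suml -sumrB.
apply: le_trans (_ : \sum_j w j * (p j / m - 1) <= 0); last first.
  under eq_bigr do rewrite mulrBr mulr1 mulrA.
  by rewrite sumrB -mulr_suml w1 divff ?subrr ?gt_eqF.
apply: ler_sum => j _; rewrite -mulrBr ler_wpM2l//.
rewrite -ln_div ?posrE// -{1}(subrKC 1 (p j / m)); apply: le_ln1Dx.
by rewrite ltrBrDl subrr divr_gt0.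
Qed.

Lemma qf_ln_le n (U : 'M[C]_n) (p : 'I_n -> R) (v : 'cV[C]_n) : U \is unitarymx ->
  (forall j, 0 < p j) -> hsq v = 1 ->
  qf (spec U (@ln R \o p)) v <= ln (qf (spec U p) v).
Proof.
move=> hU hp hv; rewrite !qf_spec.
have h : \sum_j nrm2 ((U *m v) j 0) = 1.
  rewrite -hv -(hsq_unitary_l v hU) /hsq; apply: eq_bigr => i _.
  by rewrite big_ord1.
have := jensen_ln (fun j => nrm2_ge0 ((U *m v) j 0)) h hp.
by under eq_bigr do rewrite mulrC; under [in X in ln X]eq_bigr do rewrite mulrC.
Qed.

Lemma ln_prod (I : finType) (f : I -> R) : (forall i, 0 < f i) ->
  ln (\prod_i f i) = \sum_i ln (f i).
Proof.
move=> f0; suff [_ //] : 0 < \prod_i f i /\ ln (\prod_i f i) = \sum_i ln (f i).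
elim/big_rec2: _ => [|i x y _ [y0 <-]]; first by rewrite ln1.
by rewrite mulr_gt0// lnM ?posrE.
Qed.

Lemma tr_qf_col m n (A : 'M[C]_m) (F : 'M[C]_(m, n)) :
  Re (\tr (F^t* *m A *m F)) = \sum_j qf A (col j F).
Proof.
rewrite /mxtrace raddf_sum; apply: eq_bigr => j _; congr (Re _).
rewrite !mxE; apply: eq_bigr => k _; rewrite !mxE; congr (_ * _).
by apply: eq_bigr => l _; rewrite !mxE.
Qed.

Lemma hsq_col_iso m n (F : 'M[C]_(m, n)) j :
  F^t* *m F = 1%:M -> hsq (col j F) = 1.
Proof.
move=> /matrixP/(_ j j); rewrite !mxE eqxx => h; apply: complexI.
rewrite rmorph1 -[RHS]h rmorph_sum; apply: eq_bigr => i _.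
by rewrite big_ord1 !mxE conjM_nrm2.
Qed.

(** In an eigenbasis Q of the compression the trace is unchanged and ln det becomes a sum of ln of
    the values of the form on the columns of Q; scalar Jensen then applies column by column. *)
Lemma ln_det_compress d r (F : 'M[C]_(d, r)) (U : 'M[C]_d) (p : 'I_d -> R) :
  F^t* *m F = 1%:M -> U \is unitarymx -> (forall j, 0 < p j) ->
  Re (\tr (F^t* *m spec U (@ln R \o p) *m F)) <=
    ln (Re (\det (F^t* *m spec U p *m F))).
Proof.
move=> hF hU hp.
have [W [mu [hW mu0 eN]]] := pdP (pd_congr (pd_spec hU hp) (fun v => iso_inj hF)).
pose Q := F *m W^t*.
have hQ : Q^t* *m Q = 1%:M.
  by rewrite /Q adjM trmxCK mulmxA -(mulmxA W) hF mulmx1 unitary_adjr.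
have -> : \tr (F^t* *m spec U (@ln R \o p) *m F) =
          \tr (Q^t* *m spec U (@ln R \o p) *m Q).
  rewrite /Q adjM trmxCK -!mulmxA [RHS]mxtrace_mulC !mulmxA.
  by rewrite -(mulmxA _ (W^t*)) unitary_adjl// mulmx1.
rewrite tr_qf_col eN det_spec// rcK ln_prod//; apply: ler_sum => j _.
apply: le_trans (qf_ln_le hU hp (hsq_col_iso j hQ)) _.
suff -> : qf (spec U p) (col j Q) = mu j by [].
have -> : col j Q = F *m col j (W^t*) by rewrite !colE mulmxA.
have := qf_adj_col mu j hW.
by rewrite -eN qf_congr.
Qed.

Lemma det_pd_gt0 n (A : 'M[C]_n) : pd A -> 0 < Re (\det A).
Proof.
move=> /pdP[U [a [hU a0 ->]]]; rewrite det_spec// rcK.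
by apply: prodr_gt0 => j _.
Qed.

Lemma pd_det_real n (A : 'M[C]_n) : pd A -> \det A = (Re (\det A))%:C.
Proof. by move=> /pdP[U [a [hU a0 ->]]]; rewrite det_spec// rcK. Qed.

(** Adding [ln_det_compress] for A and for A^-1 cancels the traces, as ln A^-1 = - ln A. *)
Lemma det_compress_mul_ge1 d r (F : 'M[C]_(d, r)) (A : 'M[C]_d) :
  F^t* *m F = 1%:M -> pd A ->
  1 <= Re (\det (F^t* *m A *m F)) * Re (\det (F^t* *m invmx A *m F)).
Proof.
move=> hF pA; have [U [p [hU p0 eA]]] := pdP pA.
have [_ eV] := specV hU (fun j => lt0r_neq0 (p0 j)).
have pV0 j : 0 < (p j)^-1 by rewrite invr_gt0.
have pB : pd (invmx A) by rewrite eA eV; apply: pd_spec.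
have inj := fun v : 'cV[C]_r => @iso_inj _ _ F v hF.
have d1 := det_pd_gt0 (pd_congr pA inj).
have d2 := det_pd_gt0 (pd_congr pB inj).
rewrite -ler_ln ?posrE ?mulr_gt0// ln1 lnM ?posrE//.
rewrite eA eV.
apply: le_trans (lerD (ln_det_compress hF hU p0) (ln_det_compress hF hU pV0)).
have -> : spec U (@ln R \o (fun j => (p j)^-1)) = - spec U (@ln R \o p).
  by rewrite specN; apply: eq_spec => j /=; rewrite lnV// posrE.
by rewrite mulmxN mulNmx !raddfN /= subrr.
Qed.

Lemma qf_delta n (A : 'M[C]_n) i : qf A (delta_mx i 0) = Re (A i i).
Proof.
rewrite /qf trmx_delta map_delta_mx -mulmxA -colE mxE (bigD1 i)//= big1 => [|k ki].
  by rewrite !mxE !eqxx mul1r addr0.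
by rewrite !mxE (negbTE ki) andbF mul0r.
Qed.

(** ln det A is the trace of ln A, and Jensen at each standard basis vector bounds its diagonal
    entries by the ln of those of A. *)
Lemma hadamard n (A : 'M[C]_n) : pd A -> Re (\det A) <= \prod_i Re (A i i).
Proof.
move=> pA; have [_ qA] := pA.
have Aii i : 0 < Re (A i i).
  rewrite -qf_delta qA//; apply/negP => /eqP/colP/(_ i)/eqP.
  by rewrite !mxE !eqxx oner_eq0.
rewrite -ler_ln ?posrE ?det_pd_gt0 ?prodr_gt0// ln_prod//.
have [U [p [hU p0 eA]]] := pdP pA.
rewrite eA det_spec// rcK ln_prod// -(tr_spec (@ln R \o p) hU).
rewrite /mxtrace raddf_sum; apply: ler_sum => i _; rewrite -!qf_delta.
apply: qf_ln_le => //; rewrite /hsq (bigD1 i)//= big_ord1 mxE !eqxx nrm2_1.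
by rewrite big1 ?addr0// => k ki; rewrite big_ord1 mxE (negbTE ki) nrm2_0.
Qed.

(** * Eigenvalue-singular value majorization *)

(** Right minus left is minus the sum of the increments of [c] times the partial sums of [x] with at
    most m terms. *)
Lemma abel_sum_ge (c x : nat -> R) m :
  (forall i, (i < m)%N -> c i <= c i.+1) ->
  (forall k, (k <= m)%N -> \sum_(i < k) x i <= 0) ->
  c m * \sum_(i < m.+1) x i <= \sum_(i < m.+1) c i * x i.
Proof.
elim: m => [|m IH] hc hx; first by rewrite !big_ord1.
rewrite big_ord_recr [leRHS]big_ord_recr /= mulrDr lerD2r.
apply: le_trans (IH _ _) => [|i im|k km]; last 2 first.
- by apply: hc; rewrite ltnS ltnW.
- by apply: hx; rewrite leqW.
by rewrite ler_wnM2r ?hc// hx.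
Qed.

Lemma colsub_iso d k (kd : (k <= d)%N) :
  let F := colsub (widen_ord kd) (1%:M : 'M[C]_d) in F^t* *m F = 1%:M.
Proof.
move=> F; apply/matrixP => i j; rewrite !mxE (bigD1 (widen_ord kd i))//= big1.
  by rewrite !mxE eqxx conjC1 mul1r addr0 -val_eqE.
by move=> l li; rewrite !mxE (negbTE li) conjC0 mul0r.
Qed.

(** As T is upper triangular, it preserves the span of the first k basis vectors. Hence the
    compression of T^* T there is Tk^* Tk for the leading block Tk, whose determinant is the product
    of its diagonal, and [ln_det_compress] applies. *)
Lemma triangular_log_partial d (T U : 'M[C]_d) (c p : 'I_d -> R) k (kd : (k <= d)%N) :
  (forall i j : 'I_d, (j < i)%N -> T i j = 0) ->
  (forall i, T i i = (expR (c i))%:C) ->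
  U \is unitarymx -> (forall j, 0 < p j) -> T^t* *m T = spec U p ->
  \sum_(i < k) Re (spec U (@ln R \o p) (widen_ord kd i) (widen_ord kd i)) <=
    \sum_(i < k) 2 * c (widen_ord kd i).
Proof.
move=> hT hd hU hp e.
set F := colsub (widen_ord kd) (1%:M : 'M[C]_d).
have hF : F^t* *m F = 1%:M := colsub_iso kd.
have := ln_det_compress hF hU hp.
have colF j : col j F = delta_mx (widen_ord kd j) 0.
  by apply/matrixP => i l; rewrite !mxE ord1 eqxx andbT.
rewrite tr_qf_col; under eq_bigr do rewrite colF qf_delta.
move=> /le_trans; apply.
pose Tk := F^t* *m T *m F.
have TkE i j : Tk i j = T (widen_ord kd i) (widen_ord kd j).
  rewrite /Tk -mulmxA mxE (bigD1 (widen_ord kd i))//= big1 => [|l li]; last first.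
    by rewrite !mxE (negbTE li) conjC0 mul0r.
  rewrite !mxE eqxx conjC1 mul1r addr0 (bigD1 (widen_ord kd j))//= big1 => [|l li].
    by rewrite !mxE eqxx mulr1 addr0.
  by rewrite !mxE (negbTE li) mulr0.
have TF : T *m F = F *m Tk.
  apply/matrixP => i j; rewrite !mxE.
  transitivity (T i (widen_ord kd j)).
    rewrite (bigD1 (widen_ord kd j))//= big1 => [|l li].
      by rewrite !mxE eqxx mulr1 addr0.
    by rewrite !mxE (negbTE li) mulr0.
  have [ik|ki] := ltnP i k.
    have wi : widen_ord kd (Ordinal ik) = i by apply: val_inj.
    rewrite (bigD1 (Ordinal ik))//= big1 => [|l li].
      by rewrite TkE wi !mxE wi eqxx mul1r addr0.
    have il : i != widen_ord kd l by apply: contraNneq li => il; apply/eqP/val_inj; rewrite /= il.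
    by rewrite [F i l]mxE [1%:M _ _]mxE (negbTE il) mul0r.
  rewrite hT /=; last by rewrite (leq_trans (ltn_ord j)).
  rewrite big1// => l _; rewrite !mxE -val_eqE /= gtn_eqF ?mul0r//.
  exact: leq_trans (ltn_ord l) ki.
have -> : F^t* *m spec U p *m F = Tk^t* *m Tk.
  by rewrite -e mulmxA -adjM -mulmxA TF adjM -mulmxA (mulmxA _ F) hF mul1mx.
have detTk : \det Tk = (expR (\sum_(i < k) c (widen_ord kd i)))%:C.
  rewrite -det_tr det_trig.
    rewrite expR_sum rmorph_prod; apply: eq_bigr => i _.
    by rewrite mxE TkE hd.
  by apply/is_trig_mxP => i j ij; rewrite mxE TkE hT.
rewrite det_mulmx detTk det_adj detTk conj_real -rmorphM rcK.
by rewrite -expRD expRK -mulr_sumr mulrC mulr2n mulrDr mulr1.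
Qed.

(* With h the diagonal of ln (T^* T), whose partial sums are at most those of 2 c with
   equality in total, Abel summation makes the cross term of |h|^2 around 2 c nonnegative. *)
Lemma weyl_log_triangular d (T U : 'M[C]_d) (c p : 'I_d -> R) :
  (forall i j : 'I_d, (j < i)%N -> T i j = 0) ->
  (forall i, T i i = (expR (c i))%:C) ->
  (forall i j : 'I_d, (i <= j)%N -> c i <= c j) ->
  U \is unitarymx -> (forall j, 0 < p j) -> T^t* *m T = spec U p ->
  \sum_j (2 * c j) ^+ 2 <= \sum_j ln (p j) ^+ 2.
Proof.
move=> hT hd hc hU hp e.
pose h i := Re (spec U (@ln R \o p) i i).
have partial k (kd : (k <= d)%N) := triangular_log_partial kd hT hd hU hp e.
have total : \sum_i (h i - 2 * c i) = 0.
  rewrite sumrB; apply/eqP; rewrite subr_eq0; apply/eqP.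
  rewrite /h -raddf_sum tr_spec// -ln_prod// -mulr_sumr.
  have := congr1 (fun M => Re (\det M)) e.
  rewrite det_spec// rcK => <-; rewrite det_mulmx det_adj.
  have -> : \det T = (expR (\sum_i c i))%:C.
    rewrite -det_tr det_trig.
      by rewrite expR_sum rmorph_prod; apply: eq_bigr => i _; rewrite mxE hd.
    by apply/is_trig_mxP => i j ij; rewrite mxE hT.
  by rewrite conj_real -rmorphM rcK -expRD expRK mulrC mulr2n mulrDr mulr1.
have abel : 0 <= \sum_i c i * (h i - 2 * c i).
  case: d T U c p hT hd hc hU hp e @h partial total => [|d] T U c p hT hd hc hU hp e h partial total.
    by rewrite big_ord0.
  have := @abel_sum_ge (fun i => c (inord i)) (fun i => h (inord i) - 2 * c (inord i)) d.
  under eq_bigr do rewrite inord_val.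
  rewrite total mulr0 => /(_ _ _)/le_trans; apply => [i id|k kd|].
  - by apply: hc; rewrite !inordK// ltnW.
  - rewrite sumrB subr_le0; have := partial k (leqW kd).
    congr (_ <= _); apply: eq_bigr => i _.
      by congr (Re (spec _ _ _ _)); apply/val_inj; rewrite /= inordK// (leq_trans (ltn_ord i))// leqW.
    by congr (_ * c _); apply/val_inj; rewrite /= inordK// (leq_trans (ltn_ord i))// leqW.
  - by apply: ler_sum => i _; rewrite inord_val.
(* The squared diagonal is only part of the squared Hilbert-Schmidt norm of ln (T^* T). *)
have hh : \sum_i h i ^+ 2 <= \sum_j ln (p j) ^+ 2.
  rewrite -(hsq_spec (@ln R \o p) hU); apply: ler_sum => i _.
  rewrite (bigD1 i)//= ler_wpDr ?sumr_ge0// => [j _|]; first exact: nrm2_ge0.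
  by rewrite lerDl sqr_ge0.
apply: le_trans hh; rewrite -subr_ge0 -sumrB.
have sq : 0 <= \sum_i (h i - 2 * c i) ^+ 2 by apply: sumr_ge0 => i _; exact: sqr_ge0.
have -> : \sum_i (h i ^+ 2 - (2 * c i) ^+ 2) =
    \sum_i (h i - 2 * c i) ^+ 2 + 4 * \sum_i c i * (h i - 2 * c i).
  by rewrite mulr_sumr -big_split /=; apply: eq_bigr => i _; ring.
by rewrite addr_ge0// mulr_ge0.
Qed.

Lemma sorting_perm d (c : 'I_d -> R) :
  exists s : {perm 'I_d}, forall i j : 'I_d, (i <= j)%N -> c (s i) <= c (s j).
Proof.
pose t := sort (relpre c <=%R) (enum 'I_d).
have st : size t = d by rewrite size_sort size_enum_ord.
have ut : uniq t by rewrite sort_uniq enum_uniq.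
pose f (i : 'I_d) := nth i t i.
have f_inj : injective f.
  move=> i j; rewrite /f (set_nth_default i) ?st// => /eqP.
  by rewrite nth_uniq ?st// => /eqP/val_inj.
exists (perm f_inj) => i j ij; rewrite !permE /f (set_nth_default i j) ?st//.
have tr : transitive (relpre c <=%R) by move=> x y z; exact: le_trans.
apply: (sorted_leq_nth tr _ i) => //; rewrite ?inE ?st//.
  by move=> x; exact: lexx.
by apply: sort_sorted => x y; exact: le_total.
Qed.

(* Gram-Schmidt on the eigenvectors, so that the diagonal comes in the prescribed order. *)
Lemma schur_ordered d (M G : 'M[C]_d) (l : 'I_d -> C) : G \in unitmx ->
  G *m M = diag_mx (\row_j l j) *m G ->
  exists B, [/\ B \is unitarymx,
    forall i j : 'I_d, (i < j)%N -> (B *m M *m B^t*) i j = 0 &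
    forall i, (B *m M *m B^t*) i i = l i].
Proof.
move=> uG e; pose B := schmidt G.
have hB : B \is unitarymx := schmidt_unitarymx _ (leqnn _).
exists B.
(* [L] expresses the rows of G, which are left eigenvectors, in the orthonormal rows of B.
   Gram-Schmidt makes it lower triangular, and invertibility makes its diagonal nonzero. *)
pose L := G *m B^t*.
have uL : L \in unitmx by rewrite unitmx_mul uG adj_unit unitarymx_unit.
have L0 (i j : 'I_d) : (i < j)%N -> L i j = 0.
  move=> ij; have /(submxMr (B^t*)) := row_schmidt_sub G i.
  rewrite -row_mul sumsmxMr => h.
  have /(submxMr (delta_mx j 0 : 'cV_d)) : (row i L <= \sum_(k < d | (k <= i)%N) <<row k (1%:M : 'M[C]_d)>>)%MS.
    apply: submx_trans h _; apply/sumsmx_subP => k ki.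
    apply: submx_trans (sumsmx_sup k ki (submx_refl _)).
    by rewrite (eqmxMr _ (genmxE _)) -row_mul unitary_adjr// genmxE.
  rewrite sumsmxMr_gen big1 => [|k ki].
    rewrite submx0 => /eqP/matrixP/(_ 0 0).
    by rewrite -colE !mxE.
  apply/eqP; rewrite -submx0 genmxE (eqmxMr _ (genmxE _)) -colE submx0; apply/eqP/matrixP => a b.
  by rewrite !mxE -val_eqE /= ltn_eqF// (leq_ltn_trans ki).
have LR : L *m (B *m M *m B^t*) = diag_mx (\row_j l j) *m L.
  by rewrite /L !mulmxA -(mulmxA G) unitary_adjl// mulmx1 e.
have Lii i : L i i != 0.
  have : \det L != 0 by rewrite -unitfE -unitmxE.
  rewrite det_trig; last exact/is_trig_mxP.
  by move=> /prodf_neq0; apply.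
set T := B *m M *m B^t* in LR *.
clearbody L T.
(* Row i of L T = diag(l) L, read at a column j >= i: the terms k > i vanish by the shape of L, and
   the terms k < i by induction, leaving L_ii T_ij = l_i L_ij. *)
have main (n : nat) : forall i : 'I_d, (i < n)%N ->
    (forall j : 'I_d, (i < j)%N -> T i j = 0) /\ T i i = l i.
  elim: n => [//|n IH] i; rewrite ltnS => ile.
  have row (j : 'I_d) : (i <= j)%N -> L i i * T i j = l i * L i j.
    move=> ij; have := congr1 (fun A : 'M[C]_d => A i j) LR.
    rewrite mul_diag_mx !mxE (bigD1 i)//= big1 ?addr0// => k ki.
    have [ik|ki'] := ltnP i k; first by rewrite L0// mul0r.
    have kli : (k < i)%N by rewrite ltn_neqAle ki' andbT.
    have [Tk _] := IH k (leq_trans kli ile).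
    by rewrite Tk ?mulr0// (leq_trans kli).
  split=> [j ij|]; last by apply: (mulfI (Lii i)); rewrite row// mulrC.
  have /eqP := row j (ltnW ij); rewrite (L0 _ _ ij) mulr0 mulf_eq0.
  by rewrite (negbTE (Lii i)) => /eqP.
split=> // [i j|i]; last by have [] := main i.+1 i (leqnn _).
by move=> ij; have [h _] := main i.+1 i (leqnn _); exact: h.
Qed.

(** [schur_ordered] yields a lower triangular form, so it is applied to [T^T]; transposing back
    gives an upper triangular matrix unitarily similar to T, with the same singular values and with
    its eigenvalues increasing along the diagonal. *)
Lemma weyl_log d (T G U : 'M[C]_d) (c p : 'I_d -> R) : G \in unitmx ->
  T *m G = G *m diag_mx (\row_j (expR (c j))%:C) ->
  U \is unitarymx -> (forall j, 0 < p j) -> T^t* *m T = spec U p ->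
  \sum_j (2 * c j) ^+ 2 <= \sum_j ln (p j) ^+ 2.
Proof.
move=> uG e hU hp eT; have [s hs] := sorting_perm c.
pose G' := row_perm s G^T.
have uG' : G' \in unitmx by rewrite /G' row_permE unitmx_mul unitmx_perm unitmx_tr.
have e' : G' *m T^T = diag_mx (\row_j (expR (c (s j)))%:C) *m G'.
  apply/matrixP => i j; rewrite mul_diag_mx.
  have := congr1 (fun A : 'M[C]_d => A j (s i)) e.
  rewrite mul_mx_diag !mxE [_ * G _ _]mulrC => <-.
  by apply: eq_bigr => k _; rewrite !mxE mulrC.
have [B [hB B0 Bd]] := schur_ordered uG' e'.
pose Q := map_mx (@Num.conj C) B.
have hQ : Q \is unitarymx by rewrite conjC_unitary.
have eQ : Q *m T *m Q^t* = (B *m T^T *m B^t*)^T.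
  rewrite !trmx_mul trmxK mulmxA; congr (_ *m _ *m _).
    by rewrite -map_trmx trmxK.
  by rewrite /Q; apply/matrixP => i j; rewrite !mxE conjCK.
rewrite (reindex_inj (@perm_inj _ s)).
apply: (@weyl_log_triangular d (Q *m T *m Q^t*) (U *m Q^t*) (c \o s) p).
- by move=> i j ij; rewrite eQ mxE B0.
- by move=> i; rewrite eQ mxE Bd.
- exact: hs.
- by rewrite unitary_mul_adj.
- exact: hp.
- rewrite !adjM trmxCK /spec adjM trmxCK !mulmxA -(mulmxA _ (Q^t*) Q) unitary_adjl// mulmx1.
  by rewrite -!mulmxA (mulmxA (T^t*)) eT /spec !mulmxA.
Qed.

(** * The exponential metric increasing property *)

(** The square of [delta]; working with squares keeps the cost polynomial in the logarithms of the
    relative eigenvalues. *)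
Definition dist2 n (X Y : 'M[C]_n) : R :=
  let K := mxf (fun x => (Num.sqrt x)^-1) X in hsq (mxf (@ln R) (K *m Y *m K)).

Lemma spec_conj n (W U : 'M[C]_n) (p : 'I_n -> R) :
  W *m spec U p *m W^t* = spec (U *m W^t*) p.
Proof. by rewrite /spec adjM trmxCK !mulmxA. Qed.

(** Any frame S with X = S S^* can replace the square root of X, because X^(-1/2) S is unitary and
    merely rotates the eigenvectors of the relative matrix. *)
Lemma dist2E d (X Y S U : 'M[C]_d) (p : 'I_d -> R) :
  pd X -> X = S *m S^t* -> U \is unitarymx ->
  Y = S *m spec U p *m S^t* -> dist2 X Y = \sum_j ln (p j) ^+ 2.
Proof.
move=> /pdP[V [x [hV x0 eX]]] eS hU eY.
rewrite /dist2 {1 2}eX !mxf_spec//.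
set K := spec V _.
have K1 : K *m X *m K = 1%:M.
  rewrite eX !specM// -(spec1 hV); apply: eq_spec => j /=.
  rewrite -mulrA mulrCA -expr2 exprVn sqr_sqrtr ?ltW// divff//.
  by rewrite gt_eqF.
have KK : K^t* = K := spec_adj _ _.
have hKS : K *m S \is unitarymx.
  by apply/unitarymxP; rewrite adjM KK mulmxA -(mulmxA K) -eS K1.
have -> : K *m Y *m K = spec (U *m (K *m S)^t*) p.
  by rewrite -spec_conj adjM KK eY !mulmxA.
by rewrite mxf_spec ?unitary_mul_adj// hsq_spec// unitary_mul_adj.
Qed.

Lemma pd_factor d (X : 'M[C]_d) : pd X ->
  exists S, S \in unitmx /\ X = S *m S^t*.
Proof.
move=> /pdP[V [x [hV x0 ->]]].
have s0 j : Num.sqrt (x j) != 0 by rewrite gt_eqF// sqrtr_gt0.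
exists (spec V (fun j => Num.sqrt (x j))); split.
  by have [] := specV hV s0.
by rewrite spec_adj specM//; apply: eq_spec => j; rewrite -expr2 sqr_sqrtr// ltW.
Qed.

Lemma pd_relative d (X Y : 'M[C]_d) S : pd Y -> S \in unitmx ->
  exists U (p : 'I_d -> R), [/\ U \is unitarymx, forall j, 0 < p j &
    Y = S *m spec U p *m S^t*].
Proof.
move=> pY uS.
have uS' : (invmx S)^t* \in unitmx by rewrite adj_unit unitmx_inv.
have [U [p [hU p0 e]]] := pdP (pd_congr_unit pY uS').
exists U, p; split => //; rewrite -e trmxCK !mulmxA mulmxV// mul1mx.
by rewrite -mulmxA -adjM mulmxV// adj1 mulmx1.
Qed.

Lemma dist2_congr d (X Y G : 'M[C]_d) : pd X -> pd Y -> G \in unitmx ->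
  dist2 (G *m X *m G^t*) (G *m Y *m G^t*) = dist2 X Y.
Proof.
move=> pX pY uG; have [S [uS eX]] := pd_factor pX.
have [U [p [hU p0 eY]]] := pd_relative X pY uS.
rewrite (dist2E pX eX hU eY).
apply: (@dist2E _ _ _ (G *m S) U) => //.
- by have := pd_congr_unit (S := G^t*) pX; rewrite trmxCK adj_unit; apply.
- by rewrite eX adjM !mulmxA.
- by rewrite eY adjM !mulmxA.
Qed.

Lemma dist2_ge0 d (X Y : 'M[C]_d) : 0 <= dist2 X Y.
Proof. exact: hsq_ge0. Qed.

Definition expm n (H : 'M[C]_n) : 'M[C]_n := mxf (@expR R) H.

Lemma expm_spec n (U : 'M[C]_n) (a : 'I_n -> R) : U \is unitarymx ->
  expm (spec U a) = spec U (fun j => expR (a j)).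
Proof. by move=> hU; rewrite /expm mxf_spec. Qed.

Lemma pd_expm n (H : 'M[C]_n) : H^t* = H -> pd (expm H).
Proof.
move=> /herm_spec[U [a [hU ->]]]; rewrite expm_spec//.
by apply: pd_spec => // j; exact: expR_gt0.
Qed.

(* T = e^B e^-A is similar to the positive e^(-A/2) e^B e^(-A/2), whose eigenvalues
   compute the left distance, and the singular values of T compute the right one. *)
Lemma dist2_exp_double d (A B : 'M[C]_d) : A^t* = A -> B^t* = B ->
  4 * dist2 (expm A) (expm B) <= dist2 (expm (2%:C *: A)) (expm (2%:C *: B)).
Proof.
move=> /herm_spec[U [a [hU ->]]] /herm_spec[V [b [hV ->]]].
rewrite !specZ !expm_spec//.
pose EA t := spec U (fun j => expR (t * a j)).
pose EB t := spec V (fun j => expR (t * b j)).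
have EAD s t : EA s *m EA t = EA (s + t).
  by rewrite specM//; apply: eq_spec => j; rewrite mulrDl expRD.
have EBD s t : EB s *m EB t = EB (s + t).
  by rewrite specM//; apply: eq_spec => j; rewrite mulrDl expRD.
have EA0 : EA 0 = 1%:M.
  by rewrite -(spec1 hU); apply: eq_spec => j; rewrite mul0r expR0.
have EAN t : EA (- t) *m EA t = 1%:M by rewrite EAD addNr EA0.
have EAN' t : EA t *m EA (- t) = 1%:M by rewrite EAD subrr EA0.
have uEA t : EA t \in unitmx by have [_ ->] := mulmx1_unit (EAN t).
have pEA t : pd (EA t) by apply: pd_spec => // j; exact: expR_gt0.
have pEB t : pd (EB t) by apply: pd_spec => // j; exact: expR_gt0.
have hEA t : (EA t)^t* = EA t := spec_adj _ _.
have hEB t : (EB t)^t* = EB t := spec_adj _ _.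
rewrite -[spec U (fun j => expR (2 * a j))]/(EA 2) -[spec V (fun j => expR (2 * b j))]/(EB 2).
have -> : spec U (fun j => expR (a j)) = EA 1 by apply: eq_spec => j; rewrite mul1r.
have -> : spec V (fun j => expR (b j)) = EB 1 by apply: eq_spec => j; rewrite mul1r.
clearbody EA EB.
have sq t : EA t = EA (t / 2) *m (EA (t / 2))^t* by rewrite hEA EAD -splitr.
have [W [q [hW q0 eB]]] := pd_relative (EA 1) (pEB 1) (uEA (1 / 2)).
rewrite (dist2E (pEA 1) (sq 1) hW eB).
have [Z [p [hZ p0 eB2]]] := pd_relative (EA 2) (pEB 2) (uEA 1).
rewrite (@dist2E _ _ _ (EA 1) Z p)//; last by rewrite hEA EAD.
pose T := EB 1 *m EA (- 1).
have eT : T^t* *m T = spec Z p.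
  rewrite /T adjM hEA hEB mulmxA -(mulmxA _ (EB 1) (EB 1)) EBD -[1 + 1]/(2) eB2 hEA.
  by rewrite !mulmxA EAN mul1mx -mulmxA EAN' mulmx1.
pose G := EA (1 / 2) *m W^t*.
have uG : G \in unitmx by rewrite unitmx_mul uEA adj_unit unitarymx_unit.
have eG : T *m G = G *m diag_mx (\row_j (expR (ln (q j)))%:C).
  rewrite /T /G eB hEA !mulmxA -(mulmxA _ (EA (1/2)) (EA (- 1))) EAD.
  rewrite -(mulmxA _ (EA _) (EA (1 / 2))) EAD.
  have -> : 1 / 2 - 1 + 1 / 2 = 0 :> R by field.
  rewrite EA0 mulmx1 -(mulmxA _ W) unitary_adjr// mulmx1.
  congr (_ *m diag_mx _); apply/rowP => j; rewrite !mxE lnK//.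
  by rewrite posrE.
have := weyl_log uG eG hZ p0 eT.
apply: le_trans; rewrite mulr_sumr; apply: ler_sum => j _.
by rewrite exprMn -natrX.
Qed.

Lemma norm_le_sqrt (x y : R) : x ^+ 2 <= y -> `|x| <= Num.sqrt y.
Proof. by move=> h; rewrite -sqrtr_sqr ler_wsqrtr. Qed.

Lemma expR_sub_sqr_ge (m x y : R) : `|x| <= m -> `|y| <= m ->
  (x - y) ^+ 2 * expR (- (2 * m)) <= (expR x - expR y) ^+ 2.
Proof.
wlog xy : x y / y <= x => [hw|hx hy].
  have [|/ltW yx] := leP y x; first exact: hw.
  by move=> hx hy; rewrite -(sqrrN (x - y)) -(sqrrN (expR x - _)) !opprB; exact: hw.
have -> : expR (- (2 * m)) = expR (- m) ^+ 2 by rewrite expr2 -expRD; congr expR; ring.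
rewrite -exprMn ler_sqr ?nnegrE ?mulr_ge0 ?subr_ge0 ?expR_ge0 ?ler_expR//.
apply: le_trans (_ : (x - y) * expR y <= _).
  rewrite ler_wpM2l ?subr_ge0// ler_expR.
  by move: hy; rewrite ler_norml => /andP[].
rewrite -{2}(subrK y x) expRD -{3}[expR y]mul1r -mulrBl ler_wpM2r ?expR_ge0//.
by rewrite lerBrDl expR_ge1Dx.
Qed.

Lemma expR_sub_sqr_le (m x y : R) : `|x| <= m -> `|y| <= m ->
  (expR x - expR y) ^+ 2 <= (x - y) ^+ 2 * expR (2 * m).
Proof.
wlog xy : x y / y <= x => [hw|hx hy].
  have [|/ltW yx] := leP y x; first exact: hw.
  by move=> hx hy; rewrite -(sqrrN (x - y)) -(sqrrN (expR x - _)) !opprB; exact: hw.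
have -> : expR (2 * m) = expR m ^+ 2 by rewrite expr2 -expRD; congr expR; ring.
rewrite -exprMn ler_sqr ?nnegrE ?mulr_ge0 ?subr_ge0 ?expR_ge0 ?ler_expR//.
apply: (@le_trans _ _ ((x - y) * expR x)); last first.
  rewrite ler_wpM2l ?subr_ge0// ler_expR.
  by move: hx; rewrite ler_norml => /andP[].
have h : (1 + (y - x)) * expR x <= expR y.
  by rewrite -[X in _ <= expR X](subrK x y) expRD ler_wpM2r ?expR_ge0 ?expR_ge1Dx.
by rewrite lerBlDr -lerBlDl; apply: le_trans h; rewrite le_eqVlt; apply/orP; left; apply/eqP; ring.
Qed.

Lemma hsq_spec_mul_le n m (U : 'M[C]_n) (s : 'I_n -> R) (b : R) (M : 'M[C]_(n, m)) :
  U \is unitarymx -> (forall j, (s j) ^+ 2 <= b) -> hsq (spec U s *m M) <= b * hsq M.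
Proof.
move=> hU hs; rewrite /spec -!mulmxA hsq_unitary_l ?trmxC_unitary//.
rewrite -(hsq_unitary_l M hU) mulr_sumr; apply: ler_sum => i _.
rewrite mulr_sumr; apply: ler_sum => j _.
rewrite mul_diag_mx !mxE nrm2M nrm2_real ler_wpM2r ?nrm2_ge0//.
Qed.

Lemma hsq_adj m n (A : 'M[C]_(m, n)) : hsq (A^t*) = hsq A.
Proof.
rewrite /hsq exchange_big; apply: eq_bigr => i _; apply: eq_bigr => j _.
rewrite !mxE; apply: complexI; rewrite -!conjM_nrm2 conjCK; ring.
Qed.

Lemma sum_max_bound n (a : 'I_n -> R) : exists2 m : R, 0 <= m & forall j, `|a j| <= m.
Proof.
exists (\sum_j `|a j|) => [|j]; first exact: sumr_ge0.
by rewrite (bigD1 j)//= lerDl sumr_ge0.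
Qed.

Lemma dist2_exp_scale d (A B : 'M[C]_d) k : A^t* = A -> B^t* = B ->
  4 ^+ k * dist2 (expm ((2 ^- k)%:C *: A)) (expm ((2 ^- k)%:C *: B)) <=
  dist2 (expm A) (expm B).
Proof.
move=> hA hB; elim: k => [|k IH].
  by rewrite expr0 mul1r invr1 rmorph1 !scale1r.
apply: le_trans IH; rewrite exprSr -mulrA ler_wpM2l ?exprn_ge0//.
have := @dist2_exp_double d ((2 ^- k.+1)%:C *: A) ((2 ^- k.+1)%:C *: B).
rewrite !adjZ hA hB => /(_ erefl erefl).
rewrite !scalerA -rmorphM /=.
have -> : 2 * 2 ^- k.+1 = 2 ^- k :> R.
  by rewrite exprS invfM mulrA divff ?mul1r.
by [].
Qed.

(* Iterated halving reduces the claim to infinitesimal A and B, where both sides agree. *)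
Lemma exp_metric_increasing d (A B : 'M[C]_d) : A^t* = A -> B^t* = B ->
  hsq (A - B) <= dist2 (expm A) (expm B).
Proof.
move=> hA hB; set D := dist2 _ _.
have [U [a [hU eA]]] := herm_spec hA; have [V [b [hV eB]]] := herm_spec hB.
have [al al0 ha] := sum_max_bound a; have [be be0 hb] := sum_max_bound b.
pose m := al + be.
have m0 : 0 <= m by rewrite addr_ge0.
have D0 : 0 <= D := dist2_ge0 _ _.
(* Collects the exponents lost in [key], per unit of t = 2^-k: 2 m in the lower bound [low], and 2 m
   + 2 sqrt D in the upper bound [up]. *)
pose c := 2 * (m + m + Num.sqrt D).
have key k : hsq (A - B) * expR (- (c * 2 ^- k)) <= D.
  set t : R := 2 ^- k.
  have t0 : 0 < t by rewrite invr_gt0 exprn_gt0.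
  have tt : 4 ^+ k * t ^+ 2 = 1.
    rewrite /t exprVn -exprM mulnC exprM (_ : 2 ^+ 2 = 4 :> R) ?divff ?expf_neq0//.
    by rewrite -natrX.
  have h1 := dist2_exp_scale k hA hB.
  have h2 : dist2 (expm (t%:C *: A)) (expm (t%:C *: B)) <= t ^+ 2 * D.
    by rewrite -(ler_pM2l (_ : 0 < 4 ^+ k)) ?exprn_gt0// mulrA tt mul1r.
  have htA : (t%:C *: A)^t* = t%:C *: A by rewrite adjZ hA.
  have pA := pd_expm htA.
  have htB : (t%:C *: B)^t* = t%:C *: B by rewrite adjZ hB.
  have pB := pd_expm htB.
  have bound (x y z : R) : `|x| <= z -> 0 <= y -> `|y * x| <= y * z.
    by move=> hx hy; rewrite normrM (ger0_norm hy) ler_wpM2l.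
  pose S := spec U (fun j => expR (t * a j / 2)).
  have hS : S^t* = S := spec_adj _ _.
  have eEA : expm (t%:C *: A) = S *m S^t*.
    rewrite eA specZ expm_spec// hS specM//; apply: eq_spec => j.
    by rewrite -expRD -splitr.
  have uS : S \in unitmx.
    by have [] := @specV _ U (fun j => expR (t * a j / 2)) hU (fun j => lt0r_neq0 (expR_gt0 _)).
  have [W [q [hW q0 eEB]]] := pd_relative (expm (t%:C *: A)) pB uS.
  have h3 := h2; rewrite (dist2E pA eEA hW eEB) in h3.
  have lnq j : `|ln (q j)| <= t * Num.sqrt D.
    have -> : t * Num.sqrt D = Num.sqrt (t ^+ 2 * D).
      by rewrite sqrtrM ?sqr_ge0// sqrtr_sqr ger0_norm// ltW.
    apply: norm_le_sqrt; apply: le_trans h3.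
    by rewrite (bigD1 j)//= lerDl sumr_ge0// => i _; exact: sqr_ge0.
  have up : hsq (expm (t%:C *: B) - expm (t%:C *: A)) <=
      expR (t * m) * (expR (t * m) * (t ^+ 2 * D * expR (2 * (t * Num.sqrt D)))).
    have -> : expm (t%:C *: B) - expm (t%:C *: A) =
        S *m (S *m spec W (fun j => q j - 1))^t*.
      have gen (P : 'M[C]_d) : P^t* = P ->
          S *m P *m S^t* - S *m S^t* = S *m (S *m (P - 1%:M))^t*.
        by move=> hP; rewrite adjM adjD adjN adj1 hP mulmxBl mul1mx mulmxBr !mulmxA.
      rewrite eEB eEA gen ?spec_adj//; congr (_ *m (_ *m _)^t*).
      by rewrite -(spec1 hW) specN specD.
    have bS j : expR (t * a j / 2) ^+ 2 <= expR (t * m).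
      rewrite expr2 -expRD -splitr ler_expR ler_wpM2l ?(ltW t0)//.
      by apply: le_trans (ler_norm _) _; apply: le_trans (ha j) _; rewrite lerDl.
    apply: le_trans (hsq_spec_mul_le _ hU bS) _.
    rewrite ler_wpM2l ?expR_ge0// hsq_adj.
    apply: le_trans (hsq_spec_mul_le _ hU bS) _.
    rewrite ler_wpM2l ?expR_ge0// hsq_spec//.
    apply: le_trans (_ : (\sum_j ln (q j) ^+ 2) * expR (2 * (t * Num.sqrt D)) <= _); last first.
      by rewrite ler_wpM2r ?expR_ge0.
    rewrite mulr_suml; apply: ler_sum => j _.
    have := @expR_sub_sqr_le (t * Num.sqrt D) (ln (q j)) 0 (lnq j).
    rewrite normr0 mulr_ge0 ?sqrtr_ge0 ?(ltW t0)// => /(_ isT).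
    by rewrite expR0 subr0 lnK ?posrE.
  have low : t ^+ 2 * hsq (A - B) * expR (- (2 * (t * m))) <=
      hsq (expm (t%:C *: A) - expm (t%:C *: B)).
    rewrite eA eB !specZ !expm_spec// !hsq_spec_sub// mulr_sumr mulr_suml.
    apply: ler_sum => i _; rewrite mulr_sumr mulr_suml; apply: ler_sum => j _.
    rewrite mulrA mulrAC ler_wpM2r ?nrm2_ge0// -exprMn mulrBr.
    apply: expR_sub_sqr_ge; apply: bound; rewrite ?(ltW t0)//.
      by apply: le_trans (ha i) _; rewrite lerDl.
    by apply: le_trans (hb j) _; rewrite lerDr.
  have hh : hsq (expm (t%:C *: A) - expm (t%:C *: B)) =
            hsq (expm (t%:C *: B) - expm (t%:C *: A)).
    rewrite -opprB /hsq; apply: eq_bigr => i _; apply: eq_bigr => j _.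
    rewrite [in LHS]mxE; apply: complexI; rewrite -!conjM_nrm2 rmorphN; ring.
  have := le_trans low _; rewrite hh => /(_ _ up).
  have -> : expR (t * m) * (expR (t * m) * (t ^+ 2 * D * expR (2 * (t * Num.sqrt D)))) =
      t ^+ 2 * (D * expR (t * m + (t * m + 2 * (t * Num.sqrt D)))).
    by rewrite !expRD; ring.
  rewrite -mulrA ler_pM2l ?exprn_gt0// => h4.
  rewrite -(ler_pM2r (expR_gt0 (c * t - 2 * (t * m)))) -mulrA -expRD.
  have -> : - (c * t) + (c * t - 2 * (t * m)) = - (2 * (t * m)) by ring.
  apply: le_trans h4 _; rewrite ler_wpM2l// ler_expR.
  by rewrite /c le_eqVlt; apply/orP; left; apply/eqP; ring.
(* The bound exp(-x) >= 1 - x makes the error linear in 2^-k, so the Archimedean property can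
   replace a limit. *)
have key2 k : hsq (A - B) - D <= hsq (A - B) * c * 2 ^- k.
  rewrite lerBlDr -lerBlDl; apply: le_trans (key k).
  rewrite -mulrA -{1}[hsq _]mulr1 -mulrBr ler_wpM2l ?hsq_ge0//.
  exact: expR_ge1Dx.
rewrite leNgt; apply/negP; rewrite -subr_gt0 => h0.
set h := hsq (A - B) in key2 h0 *.
have := archi_boundP (_ : 0 <= h * c / (h - D)).
have c0 : 0 <= c by rewrite mulr_ge0// addr_ge0 ?sqrtr_ge0// addr_ge0.
rewrite (divr_ge0 (mulr_ge0 (hsq_ge0 (A - B)) c0) (ltW h0)) => /(_ isT).
set N := Num.bound _ => hN; have := key2 N.
rewrite leNgt => /negP; apply.
rewrite ltr_pdivrMr ?exprn_gt0//; rewrite ltr_pdivrMr// in hN.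
apply: lt_le_trans hN _; rewrite mulrC ler_wpM2l ?(ltW h0)//.
by rewrite -natrX ler_nat ltnW// ltn_expl.
Qed.

Lemma hsqD_le m n (A B : 'M[C]_(m, n)) : hsq (A + B) <= 2 * hsq A + 2 * hsq B.
Proof.
rewrite !mulr_sumr -big_split /=; apply: ler_sum => i _.
rewrite !mulr_sumr -big_split /=; apply: ler_sum => j _.
rewrite mxE /nrm2 !raddfD /= -subr_ge0.
rewrite (_ : _ - _ = (Re (A i j) - Re (B i j)) ^+ 2 + (Im (A i j) - Im (B i j)) ^+ 2).
  by rewrite addr_ge0 ?sqr_ge0.
by ring.
Qed.

Lemma hsqZ m n (c : R) (A : 'M[C]_(m, n)) : hsq (c%:C *: A) = c ^+ 2 * hsq A.
Proof.
rewrite mulr_sumr; apply: eq_bigr => i _; rewrite mulr_sumr; apply: eq_bigr => j _.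
by rewrite mxE nrm2M nrm2_real.
Qed.

Lemma hsq_subE n (A B : 'M[C]_n) : A^t* = A -> B^t* = B ->
  hsq (A - B) = hsq A + hsq B - 2 * Re (\tr (A *m B)).
Proof.
move=> hA hB; rewrite !hsqE adjD adjN hA hB mulmxBl !mulmxBr !raddfB /=.
by rewrite (mxtrace_mulC B A); ring.
Qed.

(** * Barycenters *)

(* The traces are sums over pairs of eigenvalues with doubly stochastic weights, so a
   scalar Taylor bound yields the trace inequality without differentiating f on matrices. *)
Lemma klein n (U V : 'M[C]_n) (a p : 'I_n -> R) (f g : R -> R) (K : R) :
  U \is unitarymx -> V \is unitarymx ->
  (forall i j, f (a i) - f (p j) - (a i - p j) * g (p j) <= K * (a i - p j) ^+ 2) ->
  \sum_i f (a i) - \sum_i f (p i)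
    - Re (\tr ((spec U a - spec V p) *m spec V (g \o p)))
  <= K * hsq (spec U a - spec V p).
Proof.
move=> hU hV h; have hW := unitary_mul_adj hU hV.
rewrite hsq_spec_sub// mulmxBl !raddfB /= tr_specM specM// tr_spec//.
rewrite -(sum_unitary_l (fun i => f (a i)) hW) -(sum_unitary_r (fun i => f (p i)) hW).
rewrite -(sum_unitary_r (fun i => p i * g (p i)) hW).
rewrite mulr_sumr -!sumrN -!big_split /=.
apply: ler_sum => i _; rewrite mulr_sumr -!sumrN -!big_split /=.
apply: ler_sum => j _; have := ler_wpM2r (nrm2_ge0 ((U *m V^t*) i j)) (h i j).
by rewrite mulrA; apply: le_trans; rewrite le_eqVlt; apply/orP; left; apply/eqP; ring.
Qed.

Lemma abs_ln_le (lo hi x : R) : 0 < lo -> lo <= x -> x <= hi ->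
  `|ln x| <= `|ln lo| + `|ln hi|.
Proof.
move=> lo0 lx xh; have x0 := lt_le_trans lo0 lx; have h0 := lt_le_trans x0 xh.
rewrite ler_norml; apply/andP; split.
  apply: (@le_trans _ _ (ln lo)); last by rewrite ler_ln.
  by rewrite lerNl; apply: le_trans (ler_norm _) _; rewrite normrN lerDl.
apply: (@le_trans _ _ (ln hi)); first by rewrite ler_ln.
by apply: le_trans (ler_norm _) _; rewrite lerDr.
Qed.

Lemma ln_le_subr1 (u : R) : 0 < u -> ln u <= u - 1.
Proof.
by move=> u0; rewrite -{1}(subrKC 1 u); apply: le_ln1Dx; rewrite ltrBrDl subrr.
Qed.

Lemma ln_ge_div (u : R) : 0 < u -> (u - 1) / u <= ln u.
Proof.
move=> u0; have := @ln_le_subr1 u^-1; rewrite invr_gt0 => /(_ u0).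
rewrite lnV ?posrE// lerNl; apply: le_trans.
by rewrite mulrBl divff ?gt_eqF// opprB div1r.
Qed.

Lemma ln_sqr_lipschitz (lo hi a b : R) : 0 < lo -> lo <= a -> a <= hi ->
  lo <= b -> b <= hi ->
  `|ln a ^+ 2 - ln b ^+ 2| <= 2 * (`|ln lo| + `|ln hi|) / lo * `|a - b|.
Proof.
move=> lo0 la ah lb bh; set L := `|ln lo| + `|ln hi|.
have L0 : 0 <= L by rewrite addr_ge0.
have a0 := lt_le_trans lo0 la; have b0 := lt_le_trans lo0 lb.
have lip x y : lo <= x -> lo <= y -> ln x - ln y <= `|x - y| / lo.
  move=> lx ly; have x0 := lt_le_trans lo0 lx; have y0 := lt_le_trans lo0 ly.
  rewrite -ln_div ?posrE//; apply: le_trans (ln_le_subr1 _) _; first by rewrite divr_gt0.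
  rewrite -{1}(divff (lt0r_neq0 y0)) -mulrBl.
  apply: le_trans (ler_norm _) _; rewrite normrM ler_wpM2l//.
  by rewrite normfV (gtr0_norm y0) lef_pV2 ?posrE.
rewrite subr_sqr normrM mulrC.
have h1 : `|ln a + ln b| <= 2 * L.
  by apply: le_trans (ler_normD _ _) _; rewrite mulr2n mulrDl mul1r lerD//; apply: abs_ln_le.
have h2 : `|ln a - ln b| <= `|a - b| / lo.
  by rewrite ler_norml lip// andbT lerNl opprB distrC lip.
apply: le_trans (ler_pM _ _ h1 h2) _ => //.
by rewrite le_eqVlt; apply/orP; left; apply/eqP; ring.
Qed.

(** Taylor expansion of ln^2 at b, whose derivative there is 2 ln b / b. With u = a / b the
    remainder equals 2 ln b (ln u - (u - 1)) + (ln u)^2, and (u - 1) / u <= ln u <= u - 1 makes both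
    terms quadratic in u - 1. *)
Lemma ln_sqr_quad (lo hi : R) : 0 < lo -> exists2 K : R, 0 <= K &
  forall a b, lo <= a -> a <= hi -> lo <= b -> b <= hi ->
    ln a ^+ 2 - ln b ^+ 2 - (a - b) * (2 * ln b / b) <= K * (a - b) ^+ 2.
Proof.
move=> lo0; set L := `|ln lo| + `|ln hi|.
have L0 : 0 <= L by rewrite addr_ge0.
exists (2 * L / (lo * lo) + (lo ^- 2 + lo ^- 2)).
  by rewrite !addr_ge0 ?mulr_ge0 ?invr_ge0 ?exprn_ge0 ?mulr_ge0 ?(ltW lo0).
move=> a b la ah lb bh; have a0 := lt_le_trans lo0 la; have b0 := lt_le_trans lo0 lb.
have [an0 bn0] : a != 0 /\ b != 0 by rewrite !gt_eqF.
set u := a / b; have u0 : 0 < u by rewrite divr_gt0.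
have lnu : ln a = ln b + ln u by rewrite ln_div ?posrE// subrKC.
have h1 := ln_le_subr1 u0; have h2 := ln_ge_div u0.
have -> : ln a ^+ 2 - ln b ^+ 2 - (a - b) * (2 * ln b / b) =
    2 * (ln b * (ln u - (u - 1))) + ln u ^+ 2.
  by rewrite lnu /u; field.
rewrite [leRHS]mulrDl; apply: lerD.
  rewrite -!mulrA ler_pM2l//; apply: le_trans (ler_norm _) _; rewrite normrM.
  apply: ler_pM => //; first exact: abs_ln_le.
  rewrite ler0_norm ?subr_le0// opprB.
  have -> : (lo * lo)^-1 * (a - b) ^+ 2 = (a - b) ^+ 2 / (lo * lo) by rewrite mulrC.
  apply: (@le_trans _ _ ((u - 1) - (u - 1) / u)); first by rewrite lerD2l lerN2.
  have -> : u - 1 - (u - 1) / u = (a - b) ^+ 2 / (a * b).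
    by rewrite /u; field; rewrite an0 bn0.
  rewrite ler_wpM2l ?sqr_ge0// lef_pV2 ?posrE ?mulr_gt0//.
  by apply: ler_pM => //; exact: ltW.
have : ln u ^+ 2 <= (u - 1) ^+ 2 + ((u - 1) / u) ^+ 2.
  have [lu|/ltW lu] := leP 0 (ln u).
    by apply: ler_wpDr; rewrite ?sqr_ge0// ler_sqr ?nnegrE// (le_trans lu).
  apply: ler_wpDl; rewrite ?sqr_ge0// -(sqrrN (ln u)) -(sqrrN (_ / u)).
  by rewrite ler_sqr ?nnegrE ?oppr_ge0// ?lerN2// (le_trans h2).
move=> /le_trans; apply; rewrite [leRHS]mulrDl; apply: lerD.
  have -> : (u - 1) ^+ 2 = b ^- 2 * (a - b) ^+ 2 by rewrite /u; field.
  by rewrite ler_wpM2r ?sqr_ge0// lef_pV2 ?posrE ?exprn_gt0// ler_sqr ?nnegrE ?(ltW lo0) ?(ltW b0).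
have -> : ((u - 1) / u) ^+ 2 = a ^- 2 * (a - b) ^+ 2.
  by rewrite /u; field; rewrite an0 bn0.
by rewrite ler_wpM2r ?sqr_ge0// lef_pV2 ?posrE ?exprn_gt0// ler_sqr ?nnegrE ?(ltW lo0) ?(ltW a0).
Qed.

Lemma qf_spec_ge d (U : 'M[C]_d) (p : 'I_d -> R) lo v : U \is unitarymx ->
  (forall j, lo <= p j) -> lo * hsq v <= qf (spec U p) v.
Proof.
move=> hU hp; rewrite qf_spec -(hsq_unitary_l v hU) /hsq mulr_sumr.
by apply: ler_sum => j _; rewrite big_ord1 ler_wpM2r ?nrm2_ge0.
Qed.

Lemma qf_spec_le d (U : 'M[C]_d) (p : 'I_d -> R) hi v : U \is unitarymx ->
  (forall j, p j <= hi) -> qf (spec U p) v <= hi * hsq v.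
Proof.
move=> hU hp; rewrite qf_spec -(hsq_unitary_l v hU) /hsq mulr_sumr.
by apply: ler_sum => j _; rewrite big_ord1 ler_wpM2r ?nrm2_ge0.
Qed.

Lemma hsq_spec_vec d m (U : 'M[C]_d) (p : 'I_d -> R) lo hi (v : 'M[C]_(d, m)) :
  U \is unitarymx -> (forall j, lo <= p j ^+ 2) -> (forall j, p j ^+ 2 <= hi) ->
  lo * hsq v <= hsq (spec U p *m v) /\ hsq (spec U p *m v) <= hi * hsq v.
Proof.
move=> hU hlo hhi; split; last exact: hsq_spec_mul_le.
rewrite /spec -!mulmxA hsq_unitary_l ?trmxC_unitary//.
rewrite -(hsq_unitary_l v hU) mulr_sumr; apply: ler_sum => i _.
rewrite mulr_sumr; apply: ler_sum => j _.
by rewrite mul_diag_mx !mxE nrm2M nrm2_real ler_wpM2r ?nrm2_ge0.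
Qed.

Lemma pos_bounds n (p : 'I_n -> R) : (forall j, 0 < p j) ->
  exists lo hi : R, 0 < lo /\ forall j, lo <= p j /\ p j <= hi.
Proof.
move=> p0; have [m m0 hm] := sum_max_bound p; have [k k0 hk] := sum_max_bound (fun j => (p j)^-1).
exists ((k + 1)^-1), m; split => [|j]; first by rewrite invr_gt0 ltr_wpDl.
split; last by apply: le_trans (ler_norm _) (hm j).
rewrite -(invrK (p j)) lef_pV2 ?posrE ?invr_gt0 ?ltr_wpDl//.
by apply: le_trans (ler_norm _) (le_trans (hk j) _); rewrite lerDl.
Qed.

(** The inverse is what makes X = S B S^* polynomial in t when read in the new frame Z: there it is
    (1 + t H) B (1 + t H). *)
Definition perturb d (S H : 'M[C]_d) (t : R) : 'M[C]_d :=
  let Z := S *m invmx (1%:M + t%:C *: H) in Z *m Z^t*.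

(** The slope comes from [klein] with g(x) = 2 ln x / x, the derivative of ln^2: the first-order
    change of the relative matrix is t (H B + B H), and multiplying by F = g(B) on either side of B
    gives B F = F B = 2 ln B. *)
Lemma first_variation d (S W X U : 'M[C]_d) (h p : 'I_d -> R) :
  let H := spec W h in
  S \in unitmx -> W \is unitarymx -> U \is unitarymx -> (forall j, 0 < p j) ->
  X = S *m spec U p *m S^t* ->
  exists2 K : R, 0 <= K & forall t : R, 0 < t -> t <= 1 -> (forall j, `|t * h j| <= 2^-1) ->
    pd (perturb S H t) /\
    dist2 (perturb S H t) X <=
      \sum_j ln (p j) ^+ 2 + 4 * t * Re (\tr (H *m spec U (@ln R \o p))) + t ^+ 2 * K.
Proof.
move=> H uS hW hU p0 eX.
have hH : H^t* = H := spec_adj _ _.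
have [lo [hi [lo0 hlohi]]] := pos_bounds p0.
(* For |t h_j| <= 1/2 the eigenvalues of 1 + t H lie in [1/2, 2], so those of (1 + t H) B (1 + t H)
   lie in [lo / 4, 4 hi]. *)
have l4 : 0 < lo / 4 by rewrite divr_gt0.
have [K0 K00 hK] := ln_sqr_quad (4 * hi) l4.
pose B := spec U p; pose F := spec U (fun j => 2 * ln (p j) / p j).
pose L := spec U (@ln R \o p).
(* [K1] bounds the quadratic remainder of [klein], with t <= 1 absorbing higher powers of t; [K2]
   bounds the t^2 part of the trace. *)
pose K1 := K0 * (2 * hsq (H *m B + B *m H) + 2 * hsq (H *m B *m H)).
pose K2 := `|Re (\tr (H *m B *m H *m F))|.
exists (K1 + K2) => [|t t0 t1 th].
  have K10 : 0 <= K1 by rewrite mulr_ge0// addr_ge0// mulr_ge0// hsq_ge0.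
  by rewrite (addr_ge0 K10)// normr_ge0.
pose P := spec W (fun j => 1 + t * h j).
have eP : 1%:M + t%:C *: H = P by rewrite -(spec1 hW) specZ specD.
have ph j : 2^-1 <= 1 + t * h j /\ 1 + t * h j <= 2.
  have := th j; rewrite ler_norml => /andP[]; set y := t * h j; move=> y1 y2.
  by split; lra.
have Pn0 j : 1 + t * h j != 0 by rewrite gt_eqF// (lt_le_trans _ (ph j).1)// invr_gt0.
have [uP _] := specV hW Pn0.
have hP : P^t* = P := spec_adj _ _.
have pB : pd B by exact: pd_spec.
have pA : pd (P *m B *m P) by rewrite -{1}hP; exact: pd_congr_unit.
have [V [a [hV a0 eA]]] := pdP pA.
pose Z := S *m invmx P.
have uZ : Z \in unitmx by rewrite unitmx_mul uS unitmx_inv.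
have pM : pd (Z *m Z^t*).
  have := @pd_congr_unit _ (1%:M) (Z^t*) _ _; rewrite trmxCK mulmx1; apply.
    by rewrite -(spec1 hW); exact: pd_spec.
  by rewrite adj_unit.
rewrite /perturb eP -/Z; split => //.
have eX' : X = Z *m spec V a *m Z^t*.
  have gen (Q N : 'M[C]_d) : N \in unitmx -> N^t* = N ->
      S *m Q *m S^t* = S *m invmx N *m (N *m Q *m N) *m (S *m invmx N)^t*.
    move=> uN hN; rewrite adjM adj_inv hN !mulmxA mulmxKV//.
    by rewrite -(mulmxA _ N (invmx N)) mulmxV// mulmx1.
  by rewrite -eA /Z eX -/B; exact: gen.
rewrite (dist2E pM erefl hV eX').
have ha j : lo / 4 <= a j /\ a j <= 4 * hi.
  have := qf_adj_col a j hV; rewrite -eA -{1}hP qf_congr => <-.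
  have hs1 i : 4^-1 <= (1 + t * h i) ^+ 2.
    have -> : 4^-1 = 2^-1 ^+ 2 :> R by rewrite exprVn -natrX.
    by rewrite ler_sqr ?nnegrE ?(ph i).1// (le_trans _ (ph i).1).
  have hs2 i : (1 + t * h i) ^+ 2 <= 4.
    have -> : 4 = 2 ^+ 2 :> R by rewrite -natrX.
    by rewrite ler_sqr ?nnegrE ?(ph i).2// (le_trans _ (ph i).1).
  have := @hsq_spec_vec _ 1 W _ _ _ (col j (V^t*)) hW hs1 hs2.
  rewrite hsq_adj_col// !mulr1 -/P => -[v1 v2]; split.
    apply: le_trans (qf_spec_ge _ hU (fun j => (hlohi j).1)).
    by rewrite ler_wpM2l// ltW.
  apply: le_trans (qf_spec_le _ hU (fun j => (hlohi j).2)) _.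
  rewrite mulrC ler_wpM2r//; apply: le_trans (hlohi j).2.
  exact: ltW.
have hp j : lo / 4 <= p j /\ p j <= 4 * hi.
  have [l1 l2] := hlohi j; have := p0 j; split; lra.
have := @klein _ V U a p (fun x => ln x ^+ 2) (fun x => 2 * ln x / x) K0 hV hU.
move=> /(_ (fun i j => hK _ _ (ha i).1 (ha i).2 (hp j).1 (hp j).2)).
rewrite -eA -/B -[spec U (_ \o p)]/F.
have BF : B *m F = 2%:C *: L.
  rewrite specM// specZ; apply: eq_spec => j /=; rewrite mulrC mulfVK//.
  by rewrite gt_eqF.
have FB : F *m B = 2%:C *: L.
  rewrite specM// specZ; apply: eq_spec => j /=; rewrite mulfVK//.
  by rewrite gt_eqF.
have -> : P *m B *m P - B = t%:C *: (H *m B + B *m H + t%:C *: (H *m B *m H)).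
  rewrite -eP mulmxDl mul1mx mulmxDr !mulmx1 mulmxDl -!scalemxAl -!scalemxAr.
  by rewrite !scalerDr -(addrA B) [B + _]addrC addrK addrA.
move=> hh; rewrite -lerBlDl.
have trE : Re (\tr (t%:C *: (H *m B + B *m H + t%:C *: (H *m B *m H)) *m F)) =
    4 * t * Re (\tr (H *m L)) + t ^+ 2 * Re (\tr (H *m B *m H *m F)).
  rewrite -scalemxAl mxtraceZ reM !mulmxDl -scalemxAl !raddfD /= mxtraceZ reM.
  rewrite -(mulmxA H B F) BF -scalemxAr mxtraceZ reM.
  have -> : Re (\tr (B *m H *m F)) = 2 * Re (\tr (H *m L)).
    by rewrite -mulmxA mxtrace_mulC -mulmxA FB -scalemxAr mxtraceZ reM.
  by ring.
move: hh; rewrite trE hsqZ => hh.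
have q1 : K0 * (t ^+ 2 * hsq (H *m B + B *m H + t%:C *: (H *m B *m H))) <= t ^+ 2 * K1.
  rewrite mulrCA ler_wpM2l ?sqr_ge0// ler_wpM2l//.
  apply: le_trans (hsqD_le _ _) _; rewrite lerD2l hsqZ mulrCA ler_piMl//.
    by rewrite mulr_ge0 ?hsq_ge0.
  by rewrite expr_le1// ltW.
have q2 : t ^+ 2 * Re (\tr (H *m B *m H *m F)) <= t ^+ 2 * K2.
  by rewrite ler_wpM2l ?sqr_ge0// ler_norm.
rewrite -/L; move: hh q1 q2.
set x1 := \sum_i _; set x2 := \sum_i _; set x3 := Re _; set x4 := Re _.
set x5 := K0 * _.
by move=> hh q1 q2; rewrite [t ^+ 2 * (_ + _)]mulrDr; lra.
Qed.

Definition cost n d (w : 'I_n -> R) (X : 'I_n -> 'M[C]_d) (M : 'M[C]_d) : R :=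
  \sum_i w i * dist2 M (X i).

Definition is_barycenter n d (w : 'I_n -> R) (X : 'I_n -> 'M[C]_d) G : Prop :=
  pd G /\ forall N, pd N -> cost w X G <= cost w X N.

Lemma Re_tr_mul_sum n d (w : 'I_n -> R) (Z : 'M[C]_d) (Y : 'I_n -> 'M[C]_d) :
  Re (\tr (Z *m \sum_i (w i)%:C *: Y i)) = \sum_i w i * Re (\tr (Z *m Y i)).
Proof.
rewrite mulmx_sumr (raddf_sum (@mxtrace C d)) raddf_sum; apply: eq_bigr => i _.
by rewrite /= -scalemxAr mxtraceZ reM.
Qed.

Lemma sum_spec_adj n d (w : 'I_n -> R) (U : 'I_n -> 'M[C]_d) a :
  (\sum_i (w i)%:C *: spec (U i) (a i))^t* = \sum_i (w i)%:C *: spec (U i) (a i).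
Proof.
elim/big_rec: _ => [|i A _ hA]; first by apply/matrixP => i j; rewrite !mxE conjC0.
by rewrite adjD hA adjZ spec_adj.
Qed.

(** Moving G against A, the sum in question, changes the cost by at most - 4 t hsq A + t^2 k with k
    the weighted sum of the second-order constants. Minimality makes this nonnegative for every
    small t > 0, which forces A = 0. *)
Lemma barycenter_eq n d (w : 'I_n -> R) (X U : 'I_n -> 'M[C]_d)
    (p : 'I_n -> 'I_d -> R) (G S : 'M[C]_d) :
  (forall i, 0 <= w i) -> is_barycenter w X G -> S \in unitmx -> G = S *m S^t* ->
  (forall i, U i \is unitarymx) -> (forall i j, 0 < p i j) ->
  (forall i, X i = S *m spec (U i) (p i) *m S^t*) ->
  \sum_i (w i)%:C *: spec (U i) (@ln R \o p i) = 0.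
Proof.
move=> w0 [pG minG] uS eG hU p0 eX.
set A := \sum_i _.
have hA : A^t* = A := sum_spec_adj _ _ _.
have [W [h [hW eA]]] := herm_spec hA.
pose H := spec W (fun j => - h j).
have eH : H = - A by rewrite eA specN.
have fv i := first_variation (fun j => - h j) uS hW (hU i) (p0 i) (eX i).
pose K i := sval (cid2 (fv i)).
have K0 i : 0 <= K i by rewrite /K; case: cid2.
have hK i : forall t : R, 0 < t -> t <= 1 -> (forall j, `|t * - h j| <= 2^-1) ->
    pd (perturb S H t) /\ dist2 (perturb S H t) (X i) <=
      \sum_j ln (p i j) ^+ 2 + 4 * t * Re (\tr (H *m spec (U i) (@ln R \o p i))) + t ^+ 2 * K i.
  by rewrite /K; case: cid2.
have costG : cost w X G = \sum_i w i * (\sum_j ln (p i j) ^+ 2).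
  by apply: eq_bigr => i _; rewrite (dist2E pG eG (hU i) (eX i)).
have [b b0 hb] := sum_max_bound h.
have key (t : R) : 0 < t -> t <= 1 -> t * b <= 2^-1 ->
    4 * hsq A <= t * \sum_i w i * K i.
  move=> t0 t1 tb.
  have th j : `|t * - h j| <= 2^-1.
    by rewrite normrM normrN (gtr0_norm t0); apply: le_trans tb; rewrite ler_wpM2l// ltW.
  (* Positive definiteness of the perturbed matrix is obtained from [first_variation] at some index,
     so n = 0 is treated apart. *)
  have [i0|n0] := pickP (fun _ : 'I_n => true); last first.
    have -> : A = 0 by rewrite /A big1 // => i _; move: (n0 i).
    by rewrite hsq0 mulr0 big1 ?mulr0// => i _; move: (n0 i).
  have [pM _] := hK i0 t t0 t1 th.
  have := minG _ pM; rewrite costG => hm.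
  have : cost w X (perturb S H t) <= \sum_i w i * (\sum_j ln (p i j) ^+ 2)
     + t * (4 * Re (\tr (H *m A)) + t * \sum_i w i * K i).
    rewrite /A Re_tr_mul_sum !mulr_sumr -big_split /= mulr_sumr -big_split /=.
    apply: ler_sum => i _; have [_] := hK i t t0 t1 th.
    move=> /(ler_wpM2l (w0 i)) /le_trans; apply.
    by rewrite le_eqVlt; apply/orP; left; apply/eqP; ring.
  move=> /(le_trans hm); rewrite lerDl pmulr_rge0//.
  rewrite eH mulNmx !raddfN /= -{1}hA -hsqE mulrN addrC subr_ge0; exact.
apply: hsq_eq0; apply/eqP; rewrite eq_le hsq_ge0 andbT leNgt; apply/negP => hs0.
set k := \sum_i w i * K i in key.
have k0 : 0 <= k by apply: sumr_ge0 => i _; exact: mulr_ge0.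
(* This step meets three demands together: t <= 1, t b <= 1/2, and t k <= hsq A, the last
   contradicting 4 hsq A <= t k. *)
pose t := hsq A / (k + hsq A * (2 * b + 1)).
have d0 : 0 < k + hsq A * (2 * b + 1).
  by rewrite ltr_wpDl// mulr_gt0// ltr_wpDl// mulr_ge0.
have t0 : 0 < t by rewrite divr_gt0.
have t1 : t <= 1.
  rewrite ler_pdivrMr// mul1r; apply: ler_wpDl => //.
  by rewrite ler_pMr// lerDr mulr_ge0.
have tb : t * b <= 2^-1.
  rewrite mulrAC ler_pdivrMr// mulrDr; apply: ler_wpDl; first by rewrite mulr_ge0.
  rewrite mulrCA ler_wpM2l ?ltW//; lra.
have := key t t0 t1 tb; rewrite leNgt => /negP; apply.
apply: (@le_lt_trans _ _ (hsq A)); last by lra.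
rewrite /t mulrAC ler_pdivrMr// ler_wpM2l ?(ltW hs0)// lerDl.
by rewrite mulr_ge0 ?(ltW hs0)// addr_ge0// mulr_ge0.
Qed.

Lemma expm_ln d (U : 'M[C]_d) (p : 'I_d -> R) : U \is unitarymx ->
  (forall j, 0 < p j) -> expm (spec U (@ln R \o p)) = spec U p.
Proof.
by move=> hU p0; rewrite expm_spec//; apply: eq_spec => j /=; rewrite lnK// posrE.
Qed.

(** Congruence by S^-1 moves the base point S S^* to the identity, where the logarithm is the
    exponential chart. *)
Lemma dist2_relative d (S U V : 'M[C]_d) (a p : 'I_d -> R) : S \in unitmx ->
  U \is unitarymx -> V \is unitarymx -> (forall j, 0 < a j) -> (forall j, 0 < p j) ->
  hsq (spec U (@ln R \o a) - spec V (@ln R \o p)) <=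
    dist2 (S *m spec U a *m S^t*) (S *m spec V p *m S^t*).
Proof.
move=> uS hU hV a0 p0; rewrite dist2_congr//; last 2 first.
- exact: pd_spec.
- exact: pd_spec.
by rewrite -(expm_ln hU a0) -(expm_ln hV p0); apply: exp_metric_increasing; exact: spec_adj.
Qed.

(* In exponential coordinates at G, distances to G are exact and all others only grow,
   so this is the Euclidean identity, its linear term vanishing by barycenter_eq. *)
Lemma variance_ineq n d (w : 'I_n -> R) (X : 'I_n -> 'M[C]_d) G M :
  (forall i, 0 <= w i) -> \sum_i w i = 1 -> (forall i, pd (X i)) ->
  is_barycenter w X G -> pd M -> cost w X G + dist2 G M <= cost w X M.
Proof.
move=> w0 w1 pX bG pM; have [pG _] := bG.
have [S [uS eG]] := pd_factor pG.
have [V [m [hV m0 eM]]] := pd_relative G pM uS.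
have rX i := pd_relative G (pX i) uS.
pose U i := sval (cid (rX i)).
pose p i := sval (cid (svalP (cid (rX i)))).
have [hU p0 eX] : [/\ forall i, U i \is unitarymx, forall i j, 0 < p i j &
    forall i, X i = S *m spec (U i) (p i) *m S^t*].
  by split=> [i|i|i]; have [] := svalP (cid (svalP (cid (rX i)))).
have bal := barycenter_eq w0 bG uS eG hU p0 eX.
pose Z := spec V (@ln R \o m).
pose Y i := spec (U i) (@ln R \o p i).
have eGX i : dist2 G (X i) = hsq (Y i).
  by rewrite (dist2E pG eG (hU i) (eX i)) hsq_spec.
have eGM : dist2 G M = hsq Z by rewrite (dist2E pG eG hV eM) hsq_spec.
have h i : hsq Z + hsq (Y i) - 2 * Re (\tr (Z *m Y i)) <= dist2 M (X i).
  rewrite -hsq_subE ?spec_adj// eM eX; exact: dist2_relative.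
have : \sum_i w i * (hsq Z + hsq (Y i) - 2 * Re (\tr (Z *m Y i))) <= cost w X M.
  by apply: ler_sum => i _; rewrite ler_wpM2l.
apply: le_trans; rewrite eGM /cost.
have tr0 : \sum_i w i * Re (\tr (Z *m Y i)) = 0.
  transitivity (Re (\tr (Z *m \sum_i (w i)%:C *: Y i))).
    by rewrite Re_tr_mul_sum.
  by rewrite bal mulmx0 mxtrace0 raddf0.
have -> : \sum_i w i * (hsq Z + hsq (Y i) - 2 * Re (\tr (Z *m Y i))) =
    hsq Z * \sum_i w i + \sum_i w i * hsq (Y i) - 2 * \sum_i w i * Re (\tr (Z *m Y i)).
  rewrite !mulr_sumr -sumrN -!big_split /=; apply: eq_bigr => i _; ring.
rewrite w1 tr0 mulr0 subr0 mulr1 addrC lerD2l le_eqVlt; apply/orP; left.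
by apply/eqP; apply: eq_bigr => i _; rewrite eGX.
Qed.

Lemma hsqN m n (A : 'M[C]_(m, n)) : hsq (- A) = hsq A.
Proof.
have -> : - A = (-1)%:C *: A by rewrite rmorphN rmorph1 scaleN1r.
by rewrite hsqZ sqrrN expr1n mul1r.
Qed.

(** If Y = S B S^* with X = S S^*, then S B^(1/2) is a frame of Y in which X has relative matrix
    B^-1; inverting the eigenvalues only changes the signs of their logarithms. *)
Lemma dist2_sym d (X Y : 'M[C]_d) : pd X -> pd Y -> dist2 X Y = dist2 Y X.
Proof.
move=> pX pY; have [S [uS eX]] := pd_factor pX.
have [U [p [hU p0 eY]]] := pd_relative X pY uS.
rewrite (dist2E pX eX hU eY).
have sp j : 0 < Num.sqrt (p j) by rewrite sqrtr_gt0.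
pose Q := spec U (fun j => Num.sqrt (p j)).
have hQ : Q^t* = Q := spec_adj _ _.
have QQ : Q *m Q = spec U p.
  by rewrite specM//; apply: eq_spec => j; rewrite -expr2 sqr_sqrtr// ltW.
have Q1 : Q *m spec U (fun j => (p j)^-1) *m Q = 1%:M.
  rewrite !specM// -(spec1 hU); apply: eq_spec => j /=.
  by rewrite mulrAC -expr2 sqr_sqrtr ?ltW// divff// gt_eqF.
rewrite (@dist2E d Y X (S *m Q) U (fun j => (p j)^-1))//.
- by apply: eq_bigr => j _; rewrite lnV ?posrE// sqrrN.
- by rewrite adjM hQ eY -QQ !mulmxA.
- have gen (P N : 'M[C]_d) : P^t* = P -> P *m N *m P = 1%:M ->
      S *m S^t* = S *m P *m N *m (S *m P)^t*.
    move=> hP e; rewrite adjM hP -!mulmxA.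
    by have -> : P *m (N *m (P *m S^t*)) = S^t* by rewrite !mulmxA e mul1mx.
  by rewrite eX; exact: gen.
Qed.

Lemma spec_le_hsq d (W : 'M[C]_d) (c : 'I_d -> R) (m : R) j : W \is unitarymx ->
  0 <= m -> hsq (spec W c) <= m ^+ 2 -> `|c j| <= m.
Proof.
move=> hW m0; rewrite hsq_spec// => h.
have hc : c j ^+ 2 <= m ^+ 2.
  apply: le_trans h; rewrite (bigD1 j)//= lerDl sumr_ge0// => i _.
  exact: sqr_ge0.
by have := norm_le_sqrt hc; rewrite sqrtr_sqr (ger0_norm m0).
Qed.

Lemma expm_hsq_le d (A B : 'M[C]_d) (m : R) : A^t* = A -> B^t* = B ->
  hsq A <= m ^+ 2 -> hsq B <= m ^+ 2 -> 0 <= m ->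
  hsq (expm A - expm B) <= expR (2 * m) * hsq (A - B).
Proof.
move=> /herm_spec[U [a [hU ->]]] /herm_spec[V [b [hV ->]]] hA hB m0.
rewrite !expm_spec// !hsq_spec_sub// mulr_sumr; apply: ler_sum => i _.
rewrite mulr_sumr; apply: ler_sum => j _; rewrite mulrA ler_wpM2r ?nrm2_ge0//.
by rewrite mulrC; apply: expR_sub_sqr_le; [exact: (spec_le_hsq _ hU)|exact: (spec_le_hsq _ hV)].
Qed.

(** The Hilbert-Schmidt distance controls only the weighted squares of x = |a_i - b_j|; the free
    parameter eta converts them through x <= eta + x^2 / eta. *)
Lemma sum_fun_cont d (U V : 'M[C]_d) (a b : 'I_d -> R) (f : R -> R) (K eta : R) :
  U \is unitarymx -> V \is unitarymx -> 0 <= K -> 0 < eta ->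
  (forall i j, `|f (a i) - f (b j)| <= K * `|a i - b j|) ->
  `|\sum_i f (a i) - \sum_i f (b i)| <=
     K * (d%:R * eta + hsq (spec U a - spec V b) / eta).
Proof.
move=> hU hV K0 eta0 h; have hW := unitary_mul_adj hU hV.
rewrite hsq_spec_sub//.
rewrite -(sum_unitary_l (fun i => f (a i)) hW) -(sum_unitary_r (fun i => f (b i)) hW).
have -> : d%:R * eta = \sum_i \sum_j eta * nrm2 ((U *m V^t*) i j).
  by rewrite (sum_unitary_l (fun=> eta) hW) sumr_const card_ord mulr_natl.
rewrite -sumrB mulr_suml -big_split /= mulr_sumr.
apply: le_trans (ler_norm_sum _ _ _) _; apply: ler_sum => i _.
rewrite -sumrB mulr_suml -big_split /= mulr_sumr.
apply: le_trans (ler_norm_sum _ _ _) _; apply: ler_sum => j _.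
rewrite -mulrBl mulrAC -mulrDl normrM (ger0_norm (nrm2_ge0 _)) mulrA.
rewrite ler_wpM2r ?nrm2_ge0//; apply: le_trans (h i j) _; rewrite ler_wpM2l//.
rewrite -real_normK ?num_real//; set x := `|_|.
rewrite -subr_ge0 -(pmulr_rge0 _ eta0) mulrBr mulrDr mulrCA divff ?gt_eqF// mulr1.
have := sqr_ge0 (x - eta); have := normr_ge0 (a i - b j); rewrite -/x => x0 s0.
by have := mulr_ge0 x0 (ltW eta0); nra.
Qed.

(** For B near A the eigenvalues of e^B relative to X stay in one interval [l, h] of positive
    numbers, on which ln^2 is Lipschitz, so [sum_fun_cont] applies to the relative matrices. *)
Lemma dist2_exp_cont d (X A : 'M[C]_d) (eps : R) : pd X -> A^t* = A -> 0 < eps ->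
  exists2 del : R, 0 < del & forall B, B^t* = B -> hsq (A - B) <= del ->
    `|dist2 (expm A) X - dist2 (expm B) X| <= eps.
Proof.
move=> pX hA eps0; have [V [x [hV x0 eX]]] := pdP pX.
have sx j : 0 < Num.sqrt (x j) by rewrite sqrtr_gt0.
pose S := spec V (fun j => Num.sqrt (x j)).
have eXS : X = S *m S^t*.
  by rewrite eX spec_adj specM//; apply: eq_spec => j; rewrite -expr2 sqr_sqrtr// ltW.
have [uS eT] := specV hV (fun j => lt0r_neq0 (sx j)).
have uS' : S \in unitmx := uS.
have [lo [hi [lo0 hlohi]]] : exists lo hi : R, 0 < lo /\
    forall j, lo <= (Num.sqrt (x j))^-1 ^+ 2 /\ (Num.sqrt (x j))^-1 ^+ 2 <= hi.
  by apply: pos_bounds => j; rewrite exprn_gt0 ?invr_gt0.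
(* Chosen so that m^2 bounds hsq A as well as hsq B whenever hsq (A - B) <= 1, as then hsq B <= 2
   hsq A + 2. *)
pose m := 2 * hsq A + 3.
have m1 : 1 <= m by have := hsq_ge0 A; rewrite /m; lra.
have m0 : 0 <= m by apply: le_trans m1.
have mA : hsq A <= m ^+ 2.
  by have := hsq_ge0 A; rewrite expr2 /m; nra.
have aux (z s t : R) : 0 <= z -> t <= 1 -> s <= 2 * z + 2 * t -> s <= (2 * z + 3) ^+ 2.
  by move=> z0 t1 h; rewrite expr2; nra.
pose l := expR (- m) * lo; pose h := expR m * hi.
have l0 : 0 < l by rewrite mulr_gt0// expR_gt0.
pose K := 2 * (`|ln l| + `|ln h|) / l.
have K0 : 0 <= K by rewrite divr_ge0 ?(ltW l0)// mulr_ge0// addr_ge0.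
have hi0 (j : 'I_d) : 0 <= hi by apply: le_trans (hlohi j).2; exact: sqr_ge0.
have eig B : B^t* = B -> hsq B <= m ^+ 2 -> exists W (q : 'I_d -> R),
    [/\ W \is unitarymx, forall j, l <= q j /\ q j <= h,
        expm B = S *m spec W q *m S^t* & dist2 (expm B) X = \sum_j ln (q j) ^+ 2].
  move=> hB mB; have pB := pd_expm hB.
  have [W [q [hW q0 e]]] := pd_relative X pB uS'.
  exists W, q; split => //; last by rewrite dist2_sym// (dist2E pX eXS hW e).
  move=> j; have [U [b [hU eB]]] := herm_spec hB.
  have bm i : `|b i| <= m.
    by apply: (spec_le_hsq i hU m0); rewrite -eB.
  have := qf_adj_col q j hW.
  have -> : spec W q = (invmx S)^t* *m expm B *m invmx S.
    have gen (P N : 'M[C]_d) : P \in unitmx -> P^t* = P ->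
       N = (invmx P)^t* *m (P *m N *m P^t*) *m invmx P.
      move=> uP hP; rewrite adj_inv hP !mulmxA mulVmx// mul1mx.
      by rewrite -mulmxA mulmxV// mulmx1.
    by rewrite e; apply: gen => //; exact: spec_adj.
  rewrite qf_congr eT eB expm_spec// => <-.
  have [h1 h2] := hsq_spec_vec (col j (W^t*)) hV (fun j => (hlohi j).1) (fun j => (hlohi j).2).
  rewrite hsq_adj_col// !mulr1 in h1 h2.
  have e1 i : expR (- m) <= expR (b i).
    by rewrite ler_expR; have := bm i; rewrite ler_norml => /andP[].
  have e2 i : expR (b i) <= expR m.
    by rewrite ler_expR; have := bm i; rewrite ler_norml => /andP[].
  split.
    by apply: le_trans (qf_spec_ge _ hU e1); rewrite ler_wpM2l ?expR_ge0.
  by apply: le_trans (qf_spec_le _ hU e2) _; rewrite ler_wpM2l ?expR_ge0.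
pose c := hi * (hi * expR (2 * m)).
(* [eta] ensures K (d + 1) eta <= eps, and [del] keeps the squared distance of the relative matrices
   below eta^2, so that both terms of [sum_fun_cont] are multiples of eta. *)
pose eta := eps / (K * (d%:R + 1) + 1).
have D0 : 0 < K * (d%:R + 1) + 1 by rewrite ltr_wpDl// mulr_ge0// addr_ge0.
have eta0 : 0 < eta by rewrite divr_gt0.
pose del := Num.min 1 (eta ^+ 2 / (`|c| + 1)).
have c1 : 0 < `|c| + 1 by rewrite ltr_wpDl.
exists del => [|B hB hAB]; first by rewrite lt_min ltr01 divr_gt0// exprn_gt0.
have mB : hsq B <= m ^+ 2.
  have : hsq B <= 2 * hsq A + 2 * hsq (A - B).
    rewrite [in leLHS](_ : B = A + - (A - B)); last by rewrite opprB addrC subrK.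
    by apply: le_trans (hsqD_le _ _) _; rewrite hsqN.
  have : hsq (A - B) <= 1 by apply: le_trans hAB _; rewrite ge_min lexx.
  by move=> h1 h2; exact: (aux _ _ _ (hsq_ge0 A) h1 h2).
have [W [q [hW hq e dA]]] := eig A hA mA.
have [Z [p [hZ hp e' dB]]] := eig B hB mB.
rewrite dA dB.
have := @sum_fun_cont d W Z q p (fun y => ln y ^+ 2) K eta hW hZ K0 eta0.
move=> /(_ (fun i j => ln_sqr_lipschitz l0 (hq i).1 (hq i).2 (hp j).1 (hp j).2)).
move=> /le_trans; apply.
have hN : hsq (spec W q - spec Z p) <= eta ^+ 2.
  have -> : spec W q - spec Z p = invmx S *m (invmx S *m (expm A - expm B)^t*)^t*.
    have gen (P N M : 'M[C]_d) : P \in unitmx -> P^t* = P -> N^t* = N -> M^t* = M ->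
       N - M = invmx P *m (invmx P *m (P *m N *m P^t* - P *m M *m P^t*)^t*)^t*.
      move=> uP hP hN hM; rewrite adjM trmxCK adj_inv hP -mulmxBl -mulmxBr.
      by rewrite !mulmxA mulVmx// mul1mx -mulmxA mulmxV// mulmx1.
    by rewrite e e'; apply: gen => //; exact: spec_adj.
  rewrite eT; have hs j : (Num.sqrt (x j))^-1 ^+ 2 <= hi := (hlohi j).2.
  apply: le_trans (hsq_spec_mul_le _ hV hs) _.
  rewrite hsq_adj.
  (* The sign of [hi] is known only through an index, so d = 0 is separate. *)
  have [j0 _|dn0] := pickP (fun _ : 'I_d => true); last first.
    have z (N : 'M[C]_d) : hsq N = 0 by rewrite /hsq big1// => i _; move: (dn0 i).
    by rewrite z mulr0 sqr_ge0.
  have hh := hi0 j0.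
  apply: (@le_trans _ _ (hi * (hi * hsq (expm A - expm B)))).
    by rewrite ler_wpM2l// -(hsq_adj (expm A - expm B)); exact: hsq_spec_mul_le.
  apply: (@le_trans _ _ (c * hsq (A - B))).
    rewrite /c -!mulrA; do 2!rewrite ler_wpM2l//.
    exact: expm_hsq_le.
  apply: (@le_trans _ _ (`|c| * hsq (A - B))).
    by rewrite ler_wpM2r ?hsq_ge0// ler_norm.
  apply: (@le_trans _ _ (`|c| * (eta ^+ 2 / (`|c| + 1)))).
    by rewrite ler_wpM2l//; apply: le_trans hAB _; rewrite ge_min lexx orbT.
  rewrite mulrCA ger_pMr ?exprn_gt0// ler_pdivrMr// mul1r lerDl ler01 //.
apply: (@le_trans _ _ (K * (d%:R * eta + eta))).
  by rewrite ler_wpM2l// lerD2l ler_pdivrMr// -expr2.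
rewrite -[X in _ * (_ + X)]mul1r -mulrDl mulrA /eta mulrCA.
by rewrite ger_pMr// ler_pdivrMr// mul1r lerDl.
Qed.

(** * Existence, uniqueness and stability of barycenters *)

Definition rmx_coord d (x : 'rV[R]_(d * d + d * d)) : 'M[C]_d :=
  \matrix_(i, j) ((x 0 (lshift _ (mxvec_index i j)))%:C
                  + 'i * (x 0 (rshift _ (mxvec_index i j)))%:C).

(** Symmetrizing lets every real vector parametrize a Hermitian matrix, so the extreme value theorem
    on boxes of row vectors reaches functions that are controlled on Hermitian matrices only. *)
Definition herm_coord d (x : 'rV[R]_(d * d + d * d)) : 'M[C]_d :=
  (2^-1)%:C *: (rmx_coord x + (rmx_coord x)^t*).

Lemma herm_coord_adj d x : (@herm_coord d x)^t* = herm_coord x.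
Proof. by rewrite /herm_coord adjZ adjD trmxCK addrC. Qed.

Lemma nrm2_rect (a b : R) : nrm2 (a%:C + 'i * b%:C) = a ^+ 2 + b ^+ 2.
Proof.
apply: complexI; rewrite -conjM_nrm2 rmorphD rmorphM /= !conj_real conjCi.
rewrite rmorphD !rmorphXn /=.
rewrite (_ : _ * _ = a%:C ^+ 2 - 'i ^+ 2 * b%:C ^+ 2); last by ring.
by rewrite sqrCi mulN1r opprK.
Qed.

Lemma herm_coord_surj d (B : 'M[C]_d) : B^t* = B ->
  exists2 x, herm_coord x = B & forall k, (x 0 k) ^+ 2 <= hsq B.
Proof.
move=> hB.
pose a : 'M[R]_d := \matrix_(i, j) Re ('Re (B i j)).
pose b : 'M[R]_d := \matrix_(i, j) Re ('Im (B i j)).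
pose x := row_mx (mxvec a) (mxvec b).
have eB i j : B i j = (a i j)%:C + 'i * (b i j)%:C.
  by rewrite {1}[B i j]Crect !mxE !re_real ?Creal_Re ?Creal_Im.
exists x.
  suff e : rmx_coord x = B.
    rewrite /herm_coord e hB.
    have h2 : (2^-1)%:C * 2%:R = 1.
      by rewrite -(rmorph_nat (rc E)) -rmorphM mulVf ?rmorph1// pnatr_eq0.
    by apply/matrixP => i j; rewrite !mxE -[RHS]mul1r -h2; ring.
  by apply/matrixP => i j; rewrite mxE row_mxEl row_mxEr !mxvecE -eB.
have ab i j : a i j ^+ 2 <= hsq B /\ b i j ^+ 2 <= hsq B.
  have : a i j ^+ 2 + b i j ^+ 2 <= hsq B.
    rewrite -nrm2_rect -eB /hsq (bigD1 i)//= (bigD1 j)//= -addrA lerDl.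
    by rewrite addr_ge0// !sumr_ge0// => *; rewrite ?nrm2_ge0// sumr_ge0// => *; exact: nrm2_ge0.
  by have := sqr_ge0 (a i j); have := sqr_ge0 (b i j); lra.
move=> k; case: (split_ordP k) => l ->.
  by rewrite row_mxEl; case/mxvec_indexP: l => i j; rewrite mxvecE (ab i j).1.
by rewrite row_mxEr; case/mxvec_indexP: l => i j; rewrite mxvecE (ab i j).2.
Qed.

Lemma herm_coord_sub d (x y : 'rV[R]_(d * d + d * d)) (e : R) :
  (forall k, `|x 0 k - y 0 k| <= e) ->
  hsq (herm_coord x - herm_coord y) <= d%:R * (d%:R * (2 * e ^+ 2)).
Proof.
move=> h.
have -> : herm_coord x - herm_coord y = herm_coord (x - y).
  rewrite /herm_coord -scalerBr; congr (_ *: _).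
  rewrite opprD addrACA -adjN -adjD.
  suff -> : rmx_coord x - rmx_coord y = rmx_coord (x - y) by [].
  by apply/matrixP => i j; rewrite !mxE !rmorphB /=; ring.
have -> : d%:R * (d%:R * (2 * e ^+ 2)) = \sum_(i < d) \sum_(j < d) (2 * e ^+ 2).
  by rewrite !sumr_const !card_ord !mulr_natl.
apply: (@le_trans _ _ (hsq (rmx_coord (x - y)))).
  rewrite hsqZ; apply: le_trans (ler_wpM2l (sqr_ge0 _) (hsqD_le _ _)) _.
  by rewrite hsq_adj; have := hsq_ge0 (rmx_coord (x - y)); lra.
have he k : (x 0 k - y 0 k) ^+ 2 <= e ^+ 2.
  by rewrite -real_normK ?num_real// ler_sqr ?nnegrE// (le_trans _ (h k)).
apply: ler_sum => i _; apply: ler_sum => j _; rewrite !mxE nrm2_rect.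
by have := he (lshift _ (mxvec_index i j)); have := he (rshift _ (mxvec_index i j)); lra.
Qed.

(** The coordinate box contains the coordinates of the whole ball hsq B <= rho but may exceed it,
    which is why the minimizer is not claimed to lie in the ball. *)
Lemma hermitian_min d (F : 'M[C]_d -> R) (rho : R) :
  (forall A, A^t* = A -> forall eps : R, 0 < eps -> exists2 del : R, 0 < del &
     forall B, B^t* = B -> hsq (A - B) <= del -> `|F A - F B| <= eps) ->
  exists A, A^t* = A /\ forall B, B^t* = B -> hsq B <= rho -> F A <= F B.
Proof.
move=> hF; pose c : R := Num.sqrt `|rho|.
pose box : set 'rV[R]_(d * d + d * d) := [set v | forall i, `[- c, c]%classic (v ord0 i)]%classic.
have cbox : compact box.
  by apply: (@rV_compact _ _ (fun=> `[- c, c]%classic)) => i; exact: segment_compact.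
have nbox : (box !=set0)%classic.
  by exists 0 => i /=; rewrite in_itv /= mxE lerNl oppr0 sqrtr_ge0.
have cF : continuous (F \o @herm_coord d).
  move=> x; apply/(@cvgrPdist_le _ _ _ _ (nbhs_filter x)) => eps eps0.
  have [del del0 hdel] := hF _ (herm_coord_adj x) eps eps0.
  pose r : R := Num.min 1 (del / (d%:R * d%:R * 2 + 1)).
  have D0 : 0 < d%:R * d%:R * 2 + 1 :> R by rewrite ltr_wpDl.
  have r0 : 0 < r by rewrite lt_min ltr01 divr_gt0.
  apply/nbhs_ballP; exists r => //= y [_ hy].
  apply: hdel; first exact: herm_coord_adj.
  apply: le_trans (herm_coord_sub (e := r) _) _ => [k|].
    by have := hy 0 k; rewrite /ball /= => /ltW.
  have r1 : r <= 1 by rewrite ge_min lexx.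
  have r2 : r * (d%:R * d%:R * 2 + 1) <= del.
    by rewrite -ler_pdivlMr// ge_min lexx orbT.
  have -> : d%:R * (d%:R * (2 * r ^+ 2)) = r * (r * (d%:R * d%:R * 2)) by ring.
  apply: le_trans r2; rewrite ler_wpM2l ?(ltW r0)//.
  by apply: (@le_trans _ _ (d%:R * d%:R * 2)); rewrite ?lerDl// ler_piMl.
have [x xbox hx] := EVT_min_rV nbox cbox (continuous_subspaceT cF).
exists (herm_coord x); split=> [|B hB hBr]; first exact: herm_coord_adj.
have [y ey hy] := herm_coord_surj hB.
rewrite -ey; apply: hx; rewrite inE /box /= => i; rewrite in_itv /= -ler_norml.
have : y 0 i ^+ 2 <= `|rho| by apply: le_trans (hy i) (le_trans hBr (ler_norm _)).
exact: norm_le_sqrt.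
Qed.

Lemma cost_cont n d (w : 'I_n -> R) (X : 'I_n -> 'M[C]_d) A (eps : R) :
  (forall i, pd (X i)) -> A^t* = A -> 0 < eps ->
  exists2 del : R, 0 < del & forall B, B^t* = B -> hsq (A - B) <= del ->
    `|cost w X (expm A) - cost w X (expm B)| <= eps.
Proof.
move=> pX hA eps0; have [b b0 hb] := sum_max_bound w.
pose e := eps / (n%:R * b + 1).
have D0 : 0 < n%:R * b + 1 by rewrite ltr_wpDl// mulr_ge0.
have e0 : 0 < e by rewrite divr_gt0.
have h i := dist2_exp_cont (pX i) hA e0.
pose del i := s2val (cid2 (h i)).
have del0 i : 0 < del i by rewrite /del; case: cid2.
have hdel i : forall B, B^t* = B -> hsq (A - B) <= del i ->
    `|dist2 (expm A) (X i) - dist2 (expm B) (X i)| <= e.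
  by rewrite /del; case: cid2.
have [lo [hi [lo0 hlo]]] := pos_bounds del0.
exists lo => // B hB hAB; rewrite /cost -sumrB.
apply: le_trans (ler_norm_sum _ _ _) _.
apply: (@le_trans _ _ (\sum_(i < n) b * e)).
  apply: ler_sum => i _; rewrite -mulrBr normrM; apply: ler_pM => //.
  by apply: hdel => //; apply: le_trans hAB (hlo i).1.
rewrite sumr_const card_ord -mulr_natl mulrA /e mulrCA ger_pMr//.
by rewrite ler_pdivrMr// mul1r lerDl.
Qed.

Lemma dist2_1_exp d (H : 'M[C]_d) : H^t* = H -> dist2 1%:M (expm H) = hsq H.
Proof.
move=> /herm_spec[U [a [hU ->]]].
have p1 : pd (1%:M : 'M[C]_d) by rewrite -(spec1 hU); exact: pd_spec.
rewrite (@dist2E d 1%:M _ 1%:M U (expR \o a))//.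
- by rewrite hsq_spec//; apply: eq_bigr => j _ /=; rewrite expRK.
- by rewrite adj1 mulmx1.
- by rewrite adj1 mulmx1 mul1mx expm_spec.
Qed.

Lemma pd_log d (X : 'M[C]_d) : pd X -> exists2 H, H^t* = H & X = expm H.
Proof.
move=> /pdP[U [p [hU p0 ->]]]; exists (spec U (@ln R \o p)); first exact: spec_adj.
by rewrite expm_ln.
Qed.

(** With y the sum of the hsq (ln X_i), the cost at 1 is at most y, while for hsq M > 4 y each
    squared distance from e^M to X_i is at least hsq M / 2 - y > y. The radius does not depend on w,
    which later gives bounds uniform over the simplex. *)
Lemma barycenter_exists n d (X : 'I_n -> 'M[C]_d) : (forall i, pd (X i)) ->
  exists rho : R, forall w : 'I_n -> R, (forall i, 0 <= w i) -> \sum_i w i = 1 ->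
  exists H, [/\ H^t* = H, hsq H <= rho & is_barycenter w X (expm H)].
Proof.
move=> pX; pose Y i := s2val (cid2 (pd_log (pX i))).
have hY i : (Y i)^t* = Y i by rewrite /Y; case: cid2.
have eX i : X i = expm (Y i) by rewrite /Y; case: cid2.
pose y := \sum_i hsq (Y i).
have yi i : hsq (Y i) <= y.
  by rewrite /y (bigD1 i)//= lerDl sumr_ge0// => j _; exact: hsq_ge0.
have y0 : 0 <= y by apply: sumr_ge0 => i _; exact: hsq_ge0.
exists (4 * y) => w w0 w1.
have lower (M : 'M[C]_d) : M^t* = M -> 4 * y < hsq M -> cost w X 1%:M < cost w X (expm M).
  move=> hM My.
  have c1 : cost w X 1%:M <= y.
    rewrite -[y]mul1r -w1 mulr_suml; apply: ler_sum => i _.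
    by rewrite ler_wpM2l// eX dist2_1_exp.
  apply: le_lt_trans c1 _.
  apply: (@lt_le_trans _ _ (\sum_i w i * (hsq M / 2 - y))).
    by rewrite -mulr_suml w1 mul1r; lra.
  apply: ler_sum => i _; rewrite ler_wpM2l// eX.
  apply: le_trans (exp_metric_increasing hM (hY i)).
  have : hsq M <= 2 * hsq (M - Y i) + 2 * hsq (Y i).
    by rewrite -{1}(subrK (Y i) M); exact: hsqD_le.
  by have := yi i; lra.
have [A [hA minA]] := hermitian_min (4 * y) (fun A hA eps eps0 => @cost_cont n d w X A eps pX hA eps0).
have h0 : (0 : 'M[C]_d)^t* = 0 by apply/matrixP => i j; rewrite !mxE conjC0.
have e0 : expm (0 : 'M[C]_d) = 1%:M.
  have [U [a [hU _]]] := herm_spec h0.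
  have -> : (0 : 'M[C]_d) = spec U (fun=> 0).
    have := specZ U 0 (fun=> 0); rewrite rmorph0 scale0r => ->.
    by apply: eq_spec => j; rewrite mulr0.
  by rewrite expm_spec// -(spec1 hU); apply: eq_spec => j; rewrite expR0.
have A0 : cost w X (expm A) <= cost w X 1%:M.
  by rewrite -e0; apply: minA; rewrite // hsq0 mulr_ge0.
exists A; split => //.
  by rewrite leNgt; apply/negP => /(lower _ hA); rewrite ltNge A0.
split=> [|N pN]; first exact: pd_expm.
have [H hH ->] := pd_log pN.
have [hs|/(lower _ hH)/ltW] := leP (hsq H) (4 * y); first exact: minA.
exact: le_trans.
Qed.

Lemma dist2_eq0 d (X Y : 'M[C]_d) : pd X -> pd Y -> dist2 X Y <= 0 -> X = Y.
Proof.
move=> /pd_log[A hA ->] /pd_log[B hB ->] h.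
suff -> : A = B by [].
apply/eqP; rewrite -subr_eq0; apply/eqP/hsq_eq0/eqP.
by rewrite eq_le hsq_ge0 andbT (le_trans (exp_metric_increasing hA hB)).
Qed.

Lemma barycenter_unique n d (w : 'I_n -> R) (X : 'I_n -> 'M[C]_d) G G' :
  (forall i, 0 <= w i) -> \sum_i w i = 1 -> (forall i, pd (X i)) ->
  is_barycenter w X G -> is_barycenter w X G' -> G = G'.
Proof.
move=> w0 w1 pX bG bG'; apply: dist2_eq0; [exact: bG.1|exact: bG'.1|].
have := variance_ineq w0 w1 pX bG bG'.1; have := bG'.2 _ bG.1; lra.
Qed.

Lemma dist2_exp_bounded d (X : 'M[C]_d) (rho : R) : pd X ->
  exists K : R, forall H, H^t* = H -> hsq H <= rho -> dist2 (expm H) X <= K.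
Proof.
move=> pX.
have cont (A : 'M[C]_d) : A^t* = A -> forall eps : R, 0 < eps -> exists2 del : R, 0 < del &
    forall B, B^t* = B -> hsq (A - B) <= del ->
    `|- dist2 (expm A) X - - dist2 (expm B) X| <= eps.
  move=> hA eps eps0; have [del del0 h] := dist2_exp_cont pX hA eps0.
  exists del => // B hB hAB; have := h B hB hAB.
  by rewrite -normrN opprB opprK addrC.
have [A [hA minA]] := hermitian_min rho cont.
by exists (dist2 (expm A) X) => H hH hr; rewrite -lerN2; exact: minA.
Qed.

(* Add the variance inequalities of the two weights at each other's barycenter. *)
Lemma barycenter_holder n d (X : 'I_n -> 'M[C]_d) (rho : R) : (forall i, pd (X i)) ->
  exists2 L : R, 0 <= L & forall (w w' : 'I_n -> R) H H',
    (forall i, 0 <= w i) -> \sum_i w i = 1 -> (forall i, 0 <= w' i) -> \sum_i w' i = 1 ->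
    H^t* = H -> H'^t* = H' -> hsq H <= rho -> hsq H' <= rho ->
    is_barycenter w X (expm H) -> is_barycenter w' X (expm H') ->
    hsq (expm H - expm H') <= L * \sum_i `|w i - w' i|.
Proof.
move=> pX; pose K i := sval (cid (dist2_exp_bounded rho (pX i))).
have hK i : forall H, H^t* = H -> hsq H <= rho -> dist2 (expm H) (X i) <= K i.
  by rewrite /K; case: cid.
have [k k0 hk] := sum_max_bound K.
pose m := Num.sqrt `|rho|.
have hm h : h <= rho -> h <= m ^+ 2.
  by move=> /le_trans; apply; rewrite sqr_sqrtr ?ler_norm.
exists (expR (2 * m) * k); first by rewrite mulr_ge0 ?expR_ge0.
move=> w w' H H' w0 w1 w0' w1' hH hH' bH bH' bG bG'.
have pG := bG.1; have pG' := bG'.1.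
have v := variance_ineq w0 w1 pX bG pG'.
have v' := variance_ineq w0' w1' pX bG' pG.
rewrite (dist2_sym pG' pG) in v'.
apply: le_trans (expm_hsq_le hH hH' (hm _ bH) (hm _ bH') (sqrtr_ge0 _)) _.
rewrite -mulrA ler_wpM2l ?expR_ge0//.
apply: le_trans (exp_metric_increasing hH hH') _.
have : cost w X (expm H') - cost w X (expm H) + (cost w' X (expm H) - cost w' X (expm H'))
   <= 2 * (k * \sum_i `|w i - w' i|).
  rewrite /cost -!sumrB -big_split /= mulr_sumr mulr_sumr; apply: ler_sum => i _.
  have -> : w i * dist2 (expm H') (X i) - w i * dist2 (expm H) (X i) +
    (w' i * dist2 (expm H) (X i) - w' i * dist2 (expm H') (X i)) =
    (w i - w' i) * (dist2 (expm H') (X i) - dist2 (expm H) (X i)) by ring.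
  apply: le_trans (ler_norm _) _; rewrite normrM mulrC mulrA ler_wpM2r//.
  have b1 := hK i H hH bH; have b2 := hK i H' hH' bH'.
  have kk := le_trans (ler_norm _) (hk i).
  have p1 := dist2_ge0 (expm H) (X i); have p2 := dist2_ge0 (expm H') (X i).
  by rewrite ler_norml; apply/andP; split; lra.
by lra.
Qed.

(** * Determinants of compressions at a barycenter *)

Lemma invmxM n (A B : 'M[C]_n) : A \in unitmx -> B \in unitmx ->
  invmx (A *m B) = invmx B *m invmx A.
Proof.
move=> uA uB; have uAB : A *m B \in unitmx by rewrite unitmx_mul uA.
have e : A *m B *m (invmx B *m invmx A) = 1%:M.
  by rewrite mulmxA mulmxK// mulmxV.
by rewrite -[RHS](mulKmx uAB) e mulmx1.
Qed.

(** Polar decomposition, with T the square root of T0^* T0 and Q = T0 T^-1. *)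
Lemma iso_factor d r (T0 : 'M[C]_(d, r)) : pd (T0^t* *m T0) ->
  exists Q T, [/\ Q^t* *m Q = 1%:M, T0 = Q *m T & T \in unitmx].
Proof.
move=> /pdP[W [nu [hW nu0 e]]].
have s0 j : Num.sqrt (nu j) != 0 by rewrite gt_eqF// sqrtr_gt0.
pose T := spec W (fun j => Num.sqrt (nu j)).
have [uT eT] := specV hW s0.
exists (T0 *m invmx T), T; split => //; last by rewrite mulmxKV.
rewrite adjM mulmxA -(mulmxA _ (T0^t*)) e eT spec_adj !specM// -(spec1 hW).
apply: eq_spec => j; rewrite mulrAC -invfM -expr2 sqr_sqrtr ?mulVf ?gt_eqF//.
exact: ltW.
Qed.

(* The first-order condition at the barycenter cancels the traces from Jensen's inequality. *)
Lemma barycenter_det_ineq n d r (w : 'I_n -> R) (X : 'I_n -> 'M[C]_d) G (V : 'M[C]_(d, r)) :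
  (forall i, 0 <= w i) -> \sum_i w i = 1 -> (forall i, pd (X i)) ->
  is_barycenter w X G -> V^t* *m V = 1%:M ->
  0 <= \sum_i w i * ln (Re (\det (V^t* *m invmx (X i) *m V)))
       + \sum_q ln (qf G (col q V)).
Proof.
move=> w0 w1 pX bG hV; have [pG _] := bG.
have [S [uS eG]] := pd_factor pG.
have rX i := pd_relative G (pX i) uS.
pose U i := sval (cid (rX i)).
pose p i := sval (cid (svalP (cid (rX i)))).
have [hU p0 eX] : [/\ forall i, U i \is unitarymx, forall i j, 0 < p i j &
    forall i, X i = S *m spec (U i) (p i) *m S^t*].
  by split=> [i|i|i]; have [] := svalP (cid (svalP (cid (rX i)))).
have bal := barycenter_eq w0 bG uS eG hU p0 eX.
have uSa : S^t* \in unitmx by rewrite adj_unit.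
pose T0 := invmx S *m V.
have eN : T0^t* *m T0 = V^t* *m invmx G *m V.
  by rewrite /T0 eG invmxM// adjM adj_inv !mulmxA.
have pGi : pd (invmx G).
  have := pG; move=> /pdP[W [g [hW g0 ->]]].
  have [_ ->] := specV hW (fun j => lt0r_neq0 (g0 j)).
  by apply: pd_spec => // j; rewrite invr_gt0.
have inj := fun v : 'cV[C]_r => @iso_inj _ _ V v hV.
have pN : pd (T0^t* *m T0) by rewrite eN; exact: pd_congr.
have [Q [T [hQ eT0 uT]]] := iso_factor pN.
have pi0 i j : 0 < (p i j)^-1 by rewrite invr_gt0.
have eXi i : V^t* *m invmx (X i) *m V =
    T^t* *m (Q^t* *m spec (U i) (fun j => (p i j)^-1) *m Q) *m T.
  have [us <-] := specV (hU i) (fun j => lt0r_neq0 (p0 i j)).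
  have gen (P : 'M[C]_d) : P \in unitmx ->
      V^t* *m invmx (S *m P *m S^t*) *m V = T0^t* *m invmx P *m T0.
    by move=> uP; rewrite !invmxM ?unitmx_mul ?uS// /T0 adjM adj_inv !mulmxA.
  by rewrite eX gen// eT0 adjM !mulmxA.
have pQ i : pd (Q^t* *m spec (U i) (fun j => (p i j)^-1) *m Q).
  by apply: pd_congr (pd_spec (hU i) (pi0 i)) _ => v; exact: iso_inj.
have detN : Re (\det (T0^t* *m T0)) = Re (\det (T^t* *m T)).
  by rewrite eT0 adjM mulmxA -(mulmxA _ (Q^t*)) hQ mulmx1.
have dN0 := det_pd_gt0 pN.
(* The factor det (V^* G^-1 V), written with [T0], is common to all i and enters the weighted sum
   once because the weights add up to 1. What remains is a compression by the isometry Q of the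
   inverse relative matrix, ready for Jensen. *)
have lnX i : ln (Re (\det (V^t* *m invmx (X i) *m V))) =
   ln (Re (\det (T0^t* *m T0))) +
   ln (Re (\det (Q^t* *m spec (U i) (fun j => (p i j)^-1) *m Q))).
  rewrite -lnM ?posrE ?det_pd_gt0// detN eXi.
  rewrite [in LHS]det_mulmx [\det (T^t* *m (_ *m _))]det_mulmx [\det (T^t* *m T)]det_mulmx mulrAC.
  have ReMr (z : C) (y : R) : Re (z * y%:C) = Re z * y by rewrite mulrC reM mulrC.
  by rewrite {1}(pd_det_real (pQ i)) ReMr.
have lnQ i : Re (\tr (Q^t* *m spec (U i) (@ln R \o (fun j => (p i j)^-1)) *m Q)) <=
   ln (Re (\det (Q^t* *m spec (U i) (fun j => (p i j)^-1) *m Q))).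
  exact: ln_det_compress.
have had : ln (Re (\det (V^t* *m G *m V))) <= \sum_q ln (qf G (col q V)).
  have pVG : pd (V^t* *m G *m V) by exact: pd_congr.
  have qpos q : 0 < qf G (col q V).
    apply: pG.2; apply/negP => /eqP h.
    by have := hsq_col_iso q hV; rewrite h hsq0 => /eqP; rewrite eq_sym oner_eq0.
  rewrite -ln_prod// ler_ln ?posrE ?det_pd_gt0 ?prodr_gt0//.
  apply: le_trans (hadamard pVG) _; rewrite le_eqVlt; apply/orP; left; apply/eqP.
  apply: eq_bigr => q _; rewrite -qf_delta qf_congr colE //.
(* Links the Hadamard bound on V^* G V with the bound [sumX] on V^* G^-1 V: the product of the two
   determinants is at least 1. *)
have cs := det_compress_mul_ge1 hV pG.
have d1 : 0 < Re (\det (V^t* *m G *m V)) by apply/det_pd_gt0/pd_congr.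
rewrite -eN -(ler_ln (x := 1)) ?posrE ?mulr_gt0// ln1 lnM ?posrE// in cs.
have sumX : ln (Re (\det (T0^t* *m T0))) <=
    \sum_i w i * ln (Re (\det (V^t* *m invmx (X i) *m V))).
  under eq_bigr do rewrite lnX mulrDr.
  rewrite big_split /= -mulr_suml w1 mul1r lerDl.
  apply: (@le_trans _ _ (\sum_i w i * Re (\tr (Q^t* *m spec (U i) (@ln R \o (fun j => (p i j)^-1)) *m Q)))); last first.
    by apply: ler_sum => i _; rewrite ler_wpM2l.
  have trE i : Re (\tr (Q^t* *m spec (U i) (@ln R \o (fun j => (p i j)^-1)) *m Q)) =
     - Re (\tr ((Q *m Q^t*) *m spec (U i) (@ln R \o p i))).
    have -> : spec (U i) (@ln R \o (fun j => (p i j)^-1)) = - spec (U i) (@ln R \o p i).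
      by rewrite specN; apply: eq_spec => j /=; rewrite lnV// posrE.
    rewrite mulmxN mulNmx !raddfN /= mxtrace_mulC mulmxA //.
  under eq_bigr do rewrite trE mulrN.
  by rewrite sumrN -Re_tr_mul_sum bal mulmx0 mxtrace0 raddf0 oppr0.
by lra.
Qed.

(** * Schubert conditions *)

Definition eigs_up n (A : 'M[C]_n) : seq R :=
  sort <=%R [seq Re z | z <- sval (closed_field_poly_normal (char_poly A))].

Lemma char_poly_spec n (U : 'M[C]_n) (a : 'I_n -> R) : U \is unitarymx ->
  char_poly (spec U a) = \prod_j ('X - ((a j)%:C)%:P).
Proof.
move=> hU; set D := diag_mx (\row_j (a j)%:C).
have eD : char_poly D = \prod_j ('X - ((a j)%:C)%:P).
  rewrite char_poly_trig; last exact: diag_mx_is_trig.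
  by apply: eq_bigr => j _; rewrite !mxE eqxx mulr1n.
rewrite -eD /char_poly.
have -> : char_poly_mx (spec U a) =
    map_mx polyC (U^t*) *m char_poly_mx D *m map_mx polyC U.
  rewrite /char_poly_mx mulmxBr mulmxBl -!map_mxM -/(spec U a); congr (_ - _).
  by rewrite scalar_mxC -mulmxA -map_mxM unitary_adjl// map_mx1 mulmx1.
rewrite !det_mulmx mulrAC -det_mulmx -map_mxM unitary_adjl// map_mx1.
by rewrite det1 mul1r.
Qed.

Lemma eigs_up_spec n (U : 'M[C]_n) (a : 'I_n -> R) : U \is unitarymx ->
  eigs_up (spec U a) = sort <=%R [seq a j | j <- enum 'I_n].
Proof.
move=> hU; rewrite /eigs_up; case: closed_field_poly_normal => r /= e.
apply/perm_sortP.
- by move=> x y; exact: le_total.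
- by move=> x y z; exact: le_trans.
- by move=> x y; exact: le_anti.
have : perm_eq r [seq (a j)%:C | j <- enum 'I_n].
  apply: prod_XsubC_eq; rewrite big_map big_enum /= -(char_poly_spec a hU) e.
  by rewrite (monicP (char_poly_monic _)) scale1r.
move=> /(perm_map Re) /perm_trans; apply; rewrite -map_comp.
have /eq_map -> : Re \o (fun j => (a j)%:C) =1 a by move=> j /=; rewrite rcK.
exact: perm_refl.
Qed.

Definition lambda n (A : 'M[C]_n) (k : 'I_n) : R := (eigs_up A)`_k.

Lemma spec_perm n (U : 'M[C]_n) (a : 'I_n -> R) (s : {perm 'I_n}) :
  spec (row_perm s U) (a \o s) = spec U a.
Proof.
apply/matrixP => i j; rewrite /spec !mul_mx_diag !mxE [RHS](reindex_inj (@perm_inj _ s)).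
by apply: eq_bigr => k _; rewrite !mxE.
Qed.

(** Since [lambda] sorts the roots of the characteristic polynomial, it carries no eigenvectors;
    permuting the rows of a diagonalizing unitary by a sorting permutation aligns the two. *)
Lemma herm_spec_lambda n (A : 'M[C]_n) : A^t* = A ->
  exists U, [/\ U \is unitarymx, A = spec U (lambda A) &
    forall i j : 'I_n, (i <= j)%N -> lambda A i <= lambda A j].
Proof.
move=> /herm_spec[U [a [hU ->]]]; have [s hs] := sorting_perm a.
have el k : lambda (spec U a) k = a (s k).
  rewrite /lambda eigs_up_spec//.
  have -> : sort <=%R [seq a j | j <- enum 'I_n] = [seq a (s j) | j <- enum 'I_n].
    apply: (sorted_eq (leT := <=%R)).
    - by move=> x y z; exact: le_trans.
    - by move=> x y; exact: le_anti.
    - by apply: sort_sorted => x y; exact: le_total.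
    - apply: (homo_sorted (e := fun i j : 'I_n => (i <= j)%N)) => [i j|]; first exact: hs.
      by have := iota_sorted 0 n; rewrite -val_enum_ord sorted_map.
    - rewrite perm_sort (map_comp a s); apply: perm_map; rewrite perm_sym.
      apply: uniq_perm; rewrite ?(map_inj_uniq (@perm_inj _ s)) ?enum_uniq// => i.
      by rewrite mem_enum inE; apply/mapP; exists (s^-1%g i); rewrite ?mem_enum// permKV.
  by rewrite (nth_map k) ?size_enum_ord// nth_ord_enum.
exists (row_perm s U); split => [||i j ij].
- by rewrite row_permE mul_unitarymx// ; apply/unitarymxP; rewrite tr_perm_mx map_perm_mx -perm_mxM mulgV perm_mx1.
- by rewrite -[LHS](spec_perm U a s); apply: eq_spec => k; rewrite el.
- by rewrite !el; exact: hs.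
Qed.

Lemma lambda_gt0 n (A : 'M[C]_n) k : pd A -> 0 < lambda A k.
Proof.
move=> pA; have [hA qA] := pA; have [U [hU eA _]] := herm_spec_lambda hA.
rewrite -(qf_adj_col (lambda A) k hU) -eA qA//; apply/negP => /eqP h.
by have := hsq_adj_col k hU; rewrite h hsq0 => /eqP; rewrite eq_sym oner_eq0.
Qed.

(** For U as in [herm_spec_lambda], f = id gives the flag of increasing eigenvalues and f =
    [rev_ord] that of decreasing ones. *)
Definition eigflag n (U : 'M[C]_n) (f : 'I_n -> 'I_n) (k : 'I_n) : {vspace 'cV[C]_n} :=
  <<[seq col (f j) (U^t*) | j <- take k.+1 (enum 'I_n)]>>%VS.

Lemma eigflag_free n (U : 'M[C]_n) (f : 'I_n -> 'I_n) : U \is unitarymx -> injective f ->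
  free [seq col (f j) (U^t*) | j <- enum 'I_n].
Proof.
move=> hU f_inj.
have sz : size [seq col (f j) (U^t*) | j <- enum 'I_n] == n by rewrite size_map size_enum_ord.
suff : free (Tuple sz) by [].
apply/freeP => k h i.
have : (U *m \sum_(j < n) k j *: (Tuple sz)`_j) (f i) 0 = 0 by rewrite h mulmx0 mxE.
rewrite mulmx_sumr summxE (bigD1 i)//= big1 ?addr0 => [|j ji].
  rewrite -scalemxAr (nth_map i) ?size_enum_ord// nth_ord_enum unitary_col_adj//.
  by rewrite !mxE !eqxx mulr1.
rewrite -scalemxAr (nth_map i) ?size_enum_ord// nth_ord_enum unitary_col_adj//.
by rewrite !mxE (inj_eq f_inj) eq_sym (negbTE ji) mulr0.
Qed.

Lemma eigflag_complete n (U : 'M[C]_n) (f : 'I_n -> 'I_n) : U \is unitarymx -> injective f ->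
  (forall k : 'I_n, \dim (eigflag U f k) = k.+1) /\
  (forall k l : 'I_n, (k <= l)%N -> (eigflag U f k <= eigflag U f l)%VS).
Proof.
move=> hU f_inj; split=> [k|k l kl].
  have fr := eigflag_free hU f_inj.
  rewrite -(cat_take_drop k.+1 (enum 'I_n)) map_cat in fr.
  have := catl_free fr; rewrite /free => /eqP ->.
  by rewrite size_map size_takel// size_enum_ord.
apply: sub_span => v /mapP[j hj ->]; apply: map_f.
have kl1 : (k.+1 <= l.+1)%N by [].
by rewrite -(take_takel _ kl1) in hj; exact: mem_take hj.
Qed.

Lemma eigflag_coord n (U : 'M[C]_n) (f : 'I_n -> 'I_n) k v (j : 'I_n) :
  U \is unitarymx -> injective f -> v \in eigflag U f k -> (k < j)%N ->
  (U *m v) (f j) 0 = 0.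
Proof.
move=> hU f_inj hv kj.
pose g := linfun (mulmx (row (f j) U) : 'cV[C]_n -> 'cV[C]_1).
have : (eigflag U f k <= lker g)%VS.
  apply/span_subvP => u /mapP[i hi ->]; rewrite memv_ker lfunE /=.
  rewrite -row_mul unitary_col_adj//; apply/eqP/matrixP => a b.
  rewrite !mxE ord1 (inj_eq f_inj) eqxx andbT -val_eqE /= eqn_leq.
  have ik : (i < k.+1)%N.
    have := hi; rewrite -(mem_map val_inj) map_take val_enum_ord take_iota => /=.
    by rewrite mem_iota add0n leq_min => /andP[_ /andP[]].
  by rewrite [(j <= i)%N]leqNgt (leq_trans ik kj).
move=> /subvP/(_ v hv); rewrite memv_ker lfunE /= => /eqP.
by rewrite -row_mul => /matrixP/(_ 0 0); rewrite !mxE.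
Qed.

Lemma qf_spec_le_supp d (U : 'M[C]_d) (p : 'I_d -> R) (hi : R) v : U \is unitarymx ->
  (forall j, p j <= hi \/ (U *m v) j 0 = 0) -> qf (spec U p) v <= hi * hsq v.
Proof.
move=> hU hp; rewrite qf_spec -(hsq_unitary_l v hU) /hsq mulr_sumr.
apply: ler_sum => j _; rewrite big_ord1.
have [h|->] := hp j; last by rewrite nrm2_0 !mulr0.
by rewrite ler_wpM2r ?nrm2_ge0.
Qed.

Lemma linear_col_mem d r (L : {vspace 'cV[C]_d}) (V : 'M[C]_(d, r)) (y : 'cV[C]_r) :
  (forall q, col q V \in L) -> V *m y \in L.
Proof.
move=> h; have -> : V *m y = \sum_q y q 0 *: col q V.
  apply/matrixP => i j; rewrite ord1 mxE summxE; apply: eq_bigr => q _.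
  by rewrite !mxE mulrC.
by apply: memv_suml => q _; apply: memvZ.
Qed.

(** Gram-Schmidt by dimension count: the intersection of L and F_r has dimension at least r + 1,
    while V^* maps it into dimension r, so it contains a nonzero vector orthogonal to the r columns
    already found. *)
Lemma adapted_iso d (L : {vspace 'cV[C]_d}) (F : nat -> {vspace 'cV[C]_d}) r :
  (forall q, (q < r)%N -> (q.+1 <= \dim (L :&: F q))%N) ->
  exists V : 'M[C]_(d, r), V^t* *m V = 1%:M /\
    forall q : 'I_r, col q V \in (L :&: F q)%VS.
Proof.
elim: r => [|r IH] hF.
  by exists 0; split=> [|[]//]; apply/matrixP; case.
have [V [hV hcol]] := IH (fun q qr => hF q (leqW qr)).
pose W := (L :&: F r)%VS.
pose g := linfun (mulmx (V^t*) : 'cV[C]_d -> 'cV[C]_r).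
have dimker : (0 < \dim (W :&: lker g))%N.
  have := limg_ker_dim g W; have := hF r (ltnSn r).
  have : (\dim (g @: W) <= r)%N.
    by apply: leq_trans (dimvS (subvf _)) _; rewrite dimvf /dim /= muln1.
  rewrite -/W => h1 h2 h3; rewrite -h3 in h2.
  by rewrite -(ltn_add2r (\dim (g @: W))) add0n; apply: leq_ltn_trans h1 h2.
have [v v0 vk] : exists2 v : 'cV[C]_d, v != 0 & v \in (W :&: lker g)%VS.
  exists (vpick (W :&: lker g)); last exact: memv_pick.
  by rewrite vpick0 -dimv_eq0 -lt0n.
have {vk} : (v \in W) && (v \in lker g) by rewrite -memv_cap.
case/andP => vW; rewrite memv_ker lfunE /= => /eqP vorth.
have h0 : 0 < hsq v by exact: hsq_gt0.
pose u := ((Num.sqrt (hsq v))^-1)%:C *: v.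
have hu : u^t* *m u = 1%:M.
  apply/matrixP => i j; rewrite !ord1 hsq_col mxE eqxx hsqZ exprVn sqr_sqrtr ?hsq_ge0//.
  by rewrite mulVf ?gt_eqF// rmorph1.
have uW : u \in W by apply: memvZ.
have Vu : V^t* *m u = 0 by rewrite -scalemxAr vorth scaler0.
have uV : u^t* *m V = 0.
  have := congr1 (fun A => A^t*) Vu; rewrite /= adjM trmxCK => ->.
  by apply/matrixP => i j; rewrite !mxE conjC0.
pose V1 : 'M[C]_(d, r + 1) := row_mx V u.
have hV1 : V1^t* *m V1 = 1%:M.
  rewrite /V1 tr_row_mx map_col_mx mul_col_row hV Vu uV hu.
  by rewrite -scalar_mx_block.
have colV1 (q : 'I_(r + 1)) : col q V1 \in (L :&: F q)%VS.
  case: (split_ordP q) => k ->.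
    by rewrite /V1 colKl; exact: hcol.
  have -> : col (rshift r k) V1 = u.
    by rewrite /V1 colKr; apply/matrixP => a b; rewrite mxE !ord1.
  by rewrite /= ord1 addn0.
by move: V1 hV1 colV1; rewrite addn1 => V1 h1 h2; exists V1.
Qed.

Lemma iso_basis_proj d r (L : {vspace 'cV[C]_d}) (V : 'M[C]_(d, r)) v :
  \dim L = r -> V^t* *m V = 1%:M -> (forall q, col q V \in L) -> v \in L ->
  V *m (V^t* *m v) = v.
Proof.
move=> dL hV hc vL.
pose g := linfun (mulmx (V^t*) : 'cV[C]_d -> 'cV[C]_r).
have full : (g @: L)%VS = fullv.
  apply/eqP; rewrite eqEsubv subvf /=; apply/subvP => y _.
  have -> : y = g (V *m y) by rewrite lfunE /= mulmxA hV mul1mx.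
  by apply: memv_img; exact: linear_col_mem.
have : (L :&: lker g)%VS = 0%VS.
  apply/eqP; rewrite -dimv_eq0; have := limg_ker_dim g L.
  by rewrite full dimvf /dim /= muln1 dL => /eqP; rewrite -[X in _ == X]add0n eqn_add2r.
move=> k0; apply/eqP; rewrite -subr_eq0 -memv0 -k0 memv_cap memv_ker lfunE /=.
rewrite mulmxBr [V^t* *m (V *m _)]mulmxA hV mul1mx subrr eqxx andbT rpredB//.
exact: linear_col_mem.
Qed.

(** Allows a different basis of L for each matrix: the inequality at the barycenter uses one V,
    whereas each X_i needs a basis adapted to its own eigenflag. Two orthonormal bases differ by a
    unitary Q. *)
Lemma det_compress_basis d r (L : {vspace 'cV[C]_d}) (V V' : 'M[C]_(d, r)) (A : 'M[C]_d) :
  \dim L = r -> V^t* *m V = 1%:M -> V'^t* *m V' = 1%:M ->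
  (forall q, col q V \in L) -> (forall q, col q V' \in L) ->
  \det (V'^t* *m A *m V') = \det (V^t* *m A *m V).
Proof.
move=> dL hV hV' hc hc'; pose Q := V^t* *m V'.
have eV' : V' = V *m Q.
  apply/matrixP => i q; have e : col q (V *m Q) = col q V'.
    rewrite -(iso_basis_proj dL hV hc (hc' q)) [in RHS]colE /Q.
    by rewrite colE !mulmxA.
  have := congr1 (fun M : 'cV[C]_d => M i 0) e.
  by rewrite [col q (V *m Q) i 0]mxE [col q V' i 0]mxE.
clearbody Q.
have QQ : Q^t* *m Q = 1%:M.
  by rewrite -hV' [in RHS]eV' adjM !mulmxA -(mulmxA (Q^t*)) hV mulmx1.
rewrite eV' adjM.
have -> : Q^t* *m V^t* *m A *m (V *m Q) = Q^t* *m (V^t* *m A *m V) *m Q by rewrite !mulmxA.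
by rewrite !det_mulmx mulrAC -det_mulmx QQ det1 mul1r.
Qed.

Lemma prod_enum d (A : {set 'I_d}) r (i0 : 'I_d) (f : 'I_d -> R) : #|A| = r ->
  \prod_(q < r) f (nth i0 (enum A) q) = \prod_(k in A) f k.
Proof.
move=> hA; subst r; rewrite [RHS]big_enum_val; apply: eq_bigr => q _.
by rewrite (enum_val_nth i0).
Qed.

Lemma schubert_adapted d r (A : {set 'I_d}) (i0 : 'I_d) (L : {vspace 'cV[C]_d})
    (F : 'I_d -> {vspace 'cV[C]_d}) : #|A| = r ->
  (forall q : 'I_#|A|, (q.+1 <= \dim (L :&: F (enum_val q)))%N) ->
  exists V : 'M[C]_(d, r), V^t* *m V = 1%:M /\
    forall q : 'I_r, col q V \in L /\ col q V \in F (nth i0 (enum A) q).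
Proof.
move=> hA hq; subst r.
have [q qA|V [hV h]] := @adapted_iso d L (fun q => F (nth i0 (enum A) q)) #|A|.
  by have := hq (Ordinal qA); rewrite (enum_val_nth i0).
by exists V; split=> // q; have := h q; rewrite memv_cap => /andP[].
Qed.

Lemma schubert_det_le d r (X U : 'M[C]_d) (I : {set 'I_d}) (L : {vspace 'cV[C]_d})
    (V : 'M[C]_(d, r)) :
  pd X -> U \is unitarymx -> X = spec U (lambda X) ->
  (forall i j : 'I_d, (i <= j)%N -> lambda X i <= lambda X j) ->
  #|I| = r -> \dim L = r ->
  (forall q : 'I_#|[set rev_ord i | i in I]|,
     (q.+1 <= \dim (L :&: eigflag U (@rev_ord d) (enum_val q)))%N) ->
  V^t* *m V = 1%:M -> (forall q, col q V \in L) ->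
  Re (\det (V^t* *m invmx X *m V)) <= \prod_(k in I) (lambda X k)^-1.
Proof.
move=> pX hU eX mono hI dL hq hV hc.
have l0 k : 0 < lambda X k := lambda_gt0 k pX.
have [_ eXi] := specV hU (fun j => lt0r_neq0 (l0 j)).
have pXi : pd (invmx X).
  by rewrite eX eXi; apply: pd_spec => // j; rewrite invr_gt0.
(* For r = 0 both sides are 1; otherwise I supplies the default index [i0] for [nth]. *)
case: r V hI dL hV hc => [|r] V hI dL hV hc.
  rewrite det_mx00 (cards0_eq hI) big_set0 -(rmorph1 (rc E)) rcK //.
have /card_gt0P[i0 _] : (0 < #|I|)%N by rewrite hI.
have hI' : #|[set rev_ord i | i in I]| = r.+1 by rewrite card_imset//; exact: rev_ord_inj.
have [V' [hV' hc']] := schubert_adapted i0 hI' hq.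
rewrite -(det_compress_basis (invmx X) dL hV hV' hc (fun q => (hc' q).1)).
have pV : pd (V'^t* *m invmx X *m V') by apply: pd_congr pXi _ => v; exact: iso_inj.
apply: le_trans (hadamard pV) _.
have -> : \prod_(k in I) (lambda X k)^-1 =
    \prod_(k in [set rev_ord i | i in I]) (lambda X (rev_ord k))^-1.
  rewrite big_imset /=; last by move=> x y _ _; exact: rev_ord_inj.
  by apply: eq_bigr => k _; rewrite rev_ordK.
rewrite -(prod_enum i0 _ hI'); apply: ler_prod => q _.
have -> : Re ((V'^t* *m invmx X *m V') q q) = qf (invmx X) (col q V').
  by rewrite -qf_delta qf_congr -colE.
set m := nth _ _ _; rewrite [in X in X && _]eX eXi.
have h1 := hsq_col_iso q hV'.
apply/andP; split.
  rewrite qf_spec sumr_ge0// => j _; rewrite mulr_ge0 ?nrm2_ge0//.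
  by rewrite invr_ge0 ltW.
rewrite -[leRHS]mulr1 -h1 [in leLHS]eX eXi; apply: qf_spec_le_supp => // j.
(* The q-th column has eigencoordinates only at indices j >= [rev_ord m], where the inverse
   eigenvalues are at most the one at [rev_ord m]. *)
have [jm|mj] := leqP (rev_ord m) j.
  by left; rewrite lef_pV2 ?posrE ?mono.
right; rewrite -(rev_ordK j); apply: (eigflag_coord hU rev_ord_inj (hc' q).2).
by rewrite -/m /=; move: mj; rewrite /= !ltn_subRL !addSn addnC.
Qed.

Lemma schubert_qf_le d r (S U : 'M[C]_d) (K : {set 'I_d}) (L : {vspace 'cV[C]_d}) :
  pd S -> U \is unitarymx -> S = spec U (lambda S) ->
  (forall i j : 'I_d, (i <= j)%N -> lambda S i <= lambda S j) ->
  #|K| = r -> (0 < r)%N ->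
  (forall q : 'I_#|K|, (q.+1 <= \dim (L :&: eigflag U id (enum_val q)))%N) ->
  exists V : 'M[C]_(d, r), [/\ V^t* *m V = 1%:M, forall q, col q V \in L &
    \prod_q qf S (col q V) <= \prod_(k in K) lambda S k].
Proof.
move=> pS hU eS mono hK r0 hq.
have /card_gt0P[i0 _] : (0 < #|K|)%N by rewrite hK.
have [V [hV hc]] := schubert_adapted i0 hK hq.
exists V; split=> // [q|]; first exact: (hc q).1.
rewrite -(prod_enum i0 _ hK); apply: ler_prod => q _.
set m := nth _ _ _; have h1 := hsq_col_iso q hV.
have l0 k : 0 < lambda S k := lambda_gt0 k pS.
apply/andP; split.
  rewrite {1}eS qf_spec sumr_ge0// => j _; rewrite mulr_ge0 ?nrm2_ge0//.
  exact: ltW.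
rewrite -[leRHS]mulr1 -h1 {1}eS; apply: qf_spec_le_supp => // j.
have [jm|mj] := leqP j m; first by left; rewrite mono.
right; have /= h := @eigflag_coord _ U id m (col q V) j hU (@inj_id _) (hc q).2 mj.
exact: h.
Qed.

(* The weights c / s q make the right-hand side linear in t with value c at t = s. *)
Lemma am_gm_weighted r (s t : 'I_r -> R) (c : R) : (0 < r)%N ->
  (forall q, 0 < s q) -> (forall q, 0 < t q) ->
  c = expR (r%:R^-1 * \sum_q ln (s q)) ->
  expR (r%:R^-1 * \sum_q ln (t q)) <= r%:R^-1 * \sum_q c / s q * t q.
Proof.
move=> r0 s0 t0 ec; have rn0 : (r%:R : R) != 0 by rewrite pnatr_eq0 -lt0n.
have c0 : 0 < c by rewrite ec expR_gt0.
have w0 (q : 'I_r) : 0 <= (r%:R^-1 : R) by rewrite invr_ge0.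
have w1 : \sum_(q < r) (r%:R^-1 : R) = 1 by rewrite sumr_const card_ord -[LHS]mulr_natl divff.
have p0 q : 0 < c / s q * t q by rewrite mulr_gt0// divr_gt0.
have pS : 0 < r%:R^-1 * \sum_q c / s q * t q.
  rewrite mulr_gt0 ?invr_gt0 ?ltr0n//; case: r r0 s t s0 t0 ec rn0 w0 w1 p0 => // r _ s t s0 t0 ec rn0 w0 w1 p0.
  by rewrite big_ord_recl ltr_wpDr// sumr_ge0// => q _; exact: ltW.
rewrite -[leRHS]lnK ?posrE// ler_expR.
have := jensen_ln w0 w1 p0; rewrite -!mulr_sumr; apply: le_trans.
rewrite ler_wpM2l ?invr_ge0//.
have -> : \sum_q ln (c / s q * t q) = \sum_q (ln c - ln (s q) + ln (t q)).
  by apply: eq_bigr => q _; rewrite lnM ?posrE ?divr_gt0// ln_div ?posrE.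
rewrite big_split /= sumrB sumr_const card_ord -[ln c *+ r]mulr_natl ec expRK mulrA divff// mul1r.
by rewrite subrr add0r.
Qed.

(** The quantifiers matter: V comes from the eigenflags of the X_i and of S, before w and G are
    given, so the bound can be integrated over w with V fixed. *)
Lemma schubert_barycenter n d r (X : 'I_n -> 'M[C]_d) (S : 'M[C]_d)
    (I : 'I_n -> {set 'I_d}) (K : {set 'I_d}) :
  (0 < r)%N -> (forall i, pd (X i)) -> pd S -> (forall i, #|I i| = r) -> #|K| = r ->
  (forall (U : 'I_n -> 'M[C]_d) (W : 'M[C]_d), (forall i, U i \is unitarymx) ->
     W \is unitarymx -> exists L : {vspace 'cV[C]_d}, [/\ \dim L = r,
       forall i (q : 'I_#|[set rev_ord k | k in I i]|),
         (q.+1 <= \dim (L :&: eigflag (U i) (@rev_ord d) (enum_val q)))%N &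
       forall q : 'I_#|K|, (q.+1 <= \dim (L :&: eigflag W id (enum_val q)))%N]) ->
  exists V : 'M[C]_(d, r), [/\ V^t* *m V = 1%:M,
    \prod_q qf S (col q V) <= \prod_(k in K) lambda S k &
    forall (w : 'I_n -> R) G, (forall i, 0 <= w i) -> \sum_i w i = 1 ->
      is_barycenter w X G ->
      \sum_i w i * ln (\prod_(k in I i) lambda (X i) k) <= \sum_q ln (qf G (col q V))].
Proof.
move=> r0 pX pS hI hK hL.
have eig (i : 'I_n) := herm_spec_lambda (pX i).1.
pose U i := sval (cid (eig i)).
have hU i : [/\ U i \is unitarymx, X i = spec (U i) (lambda (X i)) &
    forall k l : 'I_d, (k <= l)%N -> lambda (X i) k <= lambda (X i) l].
  by rewrite /U; case: cid.
have [W [hW eS monoS]] := herm_spec_lambda pS.1.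
have [|L [dL hLI hLK]] := hL U W _ hW; first by move=> i; have [] := hU i.
have [V [hV hc hprod]] := schubert_qf_le pS hW eS monoS hK r0 hLK.
exists V; split => // w G w0 w1 bG.
have := barycenter_det_ineq w0 w1 pX bG hV.
rewrite -lerBlDl sub0r; apply: le_trans; rewrite -sumrN; apply: ler_sum => i _.
rewrite -mulrN ler_wpM2l// lerNr.
have [hUi eXi monoi] := hU i.
have h := schubert_det_le (pX i) hUi eXi monoi (hI i) dL (hLI i) hV hc.
have l0 k : 0 < lambda (X i) k := lambda_gt0 k (pX i).
have P0 : 0 < \prod_(k in I i) lambda (X i) k by apply: prodr_gt0.
rewrite -lnV ?posrE// ler_ln ?posrE ?invr_gt0//.
  by rewrite -prodfV.
have pXi : pd (invmx (X i)).
  have [_] := specV hUi (fun j => lt0r_neq0 (l0 j)); rewrite -eXi => ->.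
  by apply: pd_spec => // j; rewrite invr_gt0.
by apply/det_pd_gt0/pd_congr => // v; exact: iso_inj.
Qed.

Lemma expm_qf_ge d (H : 'M[C]_d) (m : R) v : H^t* = H -> 0 <= m ->
  hsq H <= m ^+ 2 -> expR (- m) * hsq v <= qf (expm H) v.
Proof.
move=> /herm_spec[U [a [hU ->]]] m0 hm; rewrite expm_spec//.
apply: qf_spec_ge => // j; rewrite ler_expR.
by have := spec_le_hsq j hU m0 hm; rewrite ler_norml => /andP[].
Qed.

Lemma qf_entries d (A : 'M[C]_d) (v : 'cV[C]_d) :
  qf A v = \sum_i \sum_j (Re (Num.conj (v i 0) * v j 0) * Re (A i j)
                         - Im (Num.conj (v i 0) * v j 0) * Im (A i j)).
Proof.
rewrite /qf mxE raddf_sum exchange_big; apply: eq_bigr => j _ /=.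
rewrite mxE mulr_suml raddf_sum; apply: eq_bigr => i _ /=.
by rewrite -reMM [_^t* 0 i]mxE [v^T 0 i]mxE mulrAC.
Qed.

(** * Integration over the simplex *)

Lemma measurable_simplex n : measurable (@simplex R n).
Proof.
have -> : @simplex R n =
    (\bigcap_(i in [set: 'I_n]) ((fun w => tnth w i) @^-1` `[0, +oo[) `&`
     (fun w => \sum_(i < n) (tnth w i : measurableTypeR R)) @^-1` [set 1])%classic.
  apply/seteqP; split => w /= [h1 h2]; split => // i.
    by move=> _; rewrite /= in_itv /= h1.
  by have := h1 i I; rewrite /= in_itv /= andbT.
apply: measurableI.
  apply: fin_bigcap_measurable => // i _.
  rewrite -[X in measurable X]setTI; apply: (@measurable_tnth _ (measurableTypeR R) n i) => //.
rewrite -[X in measurable X]setTI.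
have mf : measurable_fun [set: n.-tuple (measurableTypeR R)]
    (fun w => \sum_(i < n) (tnth w i : measurableTypeR R)).
  by apply: measurable_sum => i; exact: measurable_tnth.
by apply: mf => //; exact: measurable_set1.
Qed.

(* A superlevel set is a countable union of grid cells, intersected with the simplex. *)
Lemma holder_measurable n (g : n.-tuple (measurableTypeR R) -> R) (L : R) :
  (forall w w', simplex w -> simplex w' ->
     (g w - g w') ^+ 2 <= L * \sum_(i < n) `|(tnth w i : R) - tnth w' i|) ->
  measurable_fun (@simplex R n) g.
Proof.
move=> hg mD; apply: (measurability _ (RGenOInfty.measurableE R)) => //.
move=> /= _ [_ [y ->] <-].
pose cell (u : nat * n.-tuple nat) : set (n.-tuple (measurableTypeR R)) :=
  (\bigcap_(i in [set: 'I_n]) ((fun w => tnth w i) @^-1`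
     `[(tnth u.2 i)%:R / u.1.+1%:R, (tnth u.2 i).+1%:R / u.1.+1%:R[))%classic.
have mcell u : measurable (cell u).
  apply: fin_bigcap_measurable => // i _.
  rewrite -[X in measurable X]setTI; apply: (@measurable_tnth _ (measurableTypeR R) n i) => //.
(* The last factor is everything or nothing: it keeps a cell exactly when g exceeds y on all its
   points in the simplex. *)
pose F u := (simplex `&` cell u `&` [set _ | forall w, simplex w -> cell u w -> y < g w])%classic.
have -> : (simplex `&` g @^-1` `]y, +oo[ = \bigcup_u F u)%classic; last first.
  apply: countable_bigcupT_measurable => [|u]; first exact: countableP.
  apply: measurableI; first exact: measurableI.
  have [P|nP] := pselect (forall w, simplex w -> cell u w -> y < g w).
    by rewrite (_ : [set _ | _]%classic = setT) //; apply/seteqP; split.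
  by rewrite (_ : [set _ | _]%classic = set0) //; apply/seteqP; split.
apply/seteqP; split => [w [Sw /=]|w [u _ [[Sw cw] /= h]]]; last first.
  by split => //=; rewrite in_itv /= andbT; exact: h.
rewrite in_itv /= andbT => yg.
have e0 : 0 < (g w - y) ^+ 2 by rewrite exprn_gt0// subr_gt0.
(* In a cell of side 1 / (k + 1) two points of the simplex are within l1 distance n / (k + 1), so g
   varies there by less than g w - y. *)
pose k := Num.bound (`|L| * n%:R / (g w - y) ^+ 2).
have hk : `|L| * n%:R / k.+1%:R < (g w - y) ^+ 2.
  have : 0 <= `|L| * n%:R / (g w - y) ^+ 2 
    by apply: divr_ge0; [rewrite mulr_ge0|exact: sqr_ge0].
  move=> /archi_boundP; rewrite -/k ltr_pdivrMr// => h.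
  rewrite ltr_pdivrMr ?ltr0n//; apply: lt_trans h _.
  by rewrite mulrC ltr_pM2l// ltr_nat.
pose c : n.-tuple nat := [tuple Num.truncn ((tnth w i : R) * k.+1%:R) | i < n].
have kn0 : 0 < k.+1%:R :> R by rewrite ltr0n.
have w0 i : 0 <= (tnth w i : R) by have [h _] := Sw; exact: h.
exists (k, c) => //; split; first split => //.
  move=> i _ /=; rewrite in_itv /= tnth_mktuple.
  have := truncn_itv (mulr_ge0 (w0 i) (ltW kn0)).
  by rewrite ler_pdivrMr// ltr_pdivlMr.
move=> w' Sw' cw'; rewrite ltNge; apply/negP => gy.
have := hg w w' Sw Sw'; rewrite leNgt => /negP; apply.
apply: (@lt_le_trans _ _ ((g w - y) ^+ 2)); last first.
  rewrite ler_sqr ?nnegrE ?subr_ge0 ?lerD2l ?lerN2// ltW//.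
  exact: le_lt_trans yg.
apply: le_lt_trans hk; apply: (@le_trans _ _ (`|L| * \sum_(i < n) `|(tnth w i : R) - tnth w' i|)).
  by rewrite ler_wpM2r ?ler_norm// sumr_ge0.
rewrite -mulrA ler_wpM2l//.
have -> : n%:R / k.+1%:R = \sum_(i < n) k.+1%:R^-1 :> R.
  by rewrite sumr_const card_ord mulr_natl.
have aux (a b p q : R) : p <= a -> p <= b -> a < p + q -> b < p + q -> `|a - b| <= q.
  by move=> *; rewrite ler_norml; apply/andP; split; lra.
apply: ler_sum => i _; have := cw' i I; rewrite /= in_itv /= tnth_mktuple.
have := truncn_itv (mulr_ge0 (w0 i) (ltW kn0)).
rewrite -ltr_pdivlMr// -ler_pdivrMr// => /andP[a1 a2] /andP[b1 b2].
move: a2 b2; rewrite -[X in X / _]natr1 mulrDl mul1r.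
exact: aux a1 b1.
Qed.

Section Integration.
Context (n : nat) (nu : probability (n.-tuple (measurableTypeR R)) R).

Lemma holder_integrable (g : n.-tuple (measurableTypeR R) -> R) (L : R) :
  (forall w w', simplex w -> simplex w' ->
     (g w - g w') ^+ 2 <= L * \sum_(i < n) `|(tnth w i : R) - tnth w' i|) ->
  nu.-integrable simplex (EFin \o g).
Proof.
move=> hg; apply: measurable_bounded_integrable.
- exact: measurable_simplex.
- by apply: le_lt_trans (ltry 1); apply: probability_le1; exact: measurable_simplex.
- exact: holder_measurable hg.
(* The simplex is empty for n = 0. *)
have [[w0 S0]|nS] := pselect (exists w, @simplex R n w); last first.
  by exists 0; split => // M _ w Sw; exfalso; apply: nS; exists w.
(* The 2 bounds the l1 distance between two points of the simplex. *)
exists (`|g w0| + Num.sqrt (`|L| * 2)); split; first exact: num_real.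
move=> M hM w Sw /=; apply: le_trans (ltW hM).
rewrite -{1}(subrK (g w0) (g w)) addrC; apply: le_trans (ler_normD _ _) _.
rewrite lerD2l; apply: norm_le_sqrt; apply: le_trans (hg w w0 Sw S0) _.
apply: (@le_trans _ _ (`|L| * \sum_(i < n) `|(tnth w i : R) - tnth w0 i|)).
  by rewrite ler_wpM2r ?ler_norm// sumr_ge0.
rewrite ler_wpM2l//; have [p1 s1] := Sw; have [p2 s2] := S0.
apply: (@le_trans _ _ (\sum_(i < n) ((tnth w i : R) + tnth w0 i))); last first.
  by rewrite big_split /= s1 s2.
apply: ler_sum => i _; have := p1 i; have := p2 i => h2 h1.
by rewrite ler_norml; apply/andP; split; lra.
Qed.

Lemma integrable_lincomb (I : Type) (s : seq I) (c : I -> R)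
    (f : I -> n.-tuple (measurableTypeR R) -> R) :
  (forall i, nu.-integrable simplex (EFin \o f i)) ->
  nu.-integrable simplex (EFin \o (fun w => \sum_(i <- s) c i * f i w)) /\
  \int[nu]_(w in simplex) (\sum_(i <- s) c i * f i w) =
    \sum_(i <- s) c i * \int[nu]_(w in simplex) f i w.
Proof.
move=> hf; have mS := @measurable_simplex n.
elim: s => [|i s [IH1 IH2]].
  have e : (fun w : n.-tuple (measurableTypeR R) => \sum_(i <- [::]) c i * f i w) = (fun=> 0).
    by apply/funext => w; rewrite big_nil.
  rewrite e big_nil Rintegral_cst// mul0r; split => //.
  by apply: (@eq_integrable _ _ _ _ _ _ (cst 0%E)) => //; exact: integrable0.
have e : (fun w => \sum_(j <- i :: s) c j * f j w) =
    (fun w => c i * f i w + \sum_(j <- s) c j * f j w).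
  by apply/funext => w; rewrite big_cons.
have ci : nu.-integrable simplex (EFin \o (fun w => c i * f i w)).
  have := integrableZl mS (c i) (hf i).
  by apply: eq_integrable => // w _; rewrite /= EFinM.
rewrite e big_cons; split.
  have := integrableD mS ci IH1.
  by apply: eq_integrable => // w _; rewrite /= EFinD.
by rewrite RintegralD// RintegralZl// IH2.
Qed.

End Integration.

(** All barycenters have logarithms in one ball, whence the lower bound uniform in w, which makes
    the integrated mean positive definite. Integrability of the entries rests on
    [barycenter_holder], a Hoelder bound of exponent 1/2. *)
Lemma barycenter_integrable n d (nu : probability (n.-tuple (measurableTypeR R)) R)
    (X : 'I_n -> 'M[C]_d) (Gm : n.-tuple (measurableTypeR R) -> 'M[C]_d) :
  (forall i, pd (X i)) ->
  (forall w, simplex w -> is_barycenter (tnth w) X (Gm w)) ->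
  [/\ exists2 e : R, 0 < e & forall w v, simplex w -> e * hsq v <= qf (Gm w) v,
      forall i j, nu.-integrable simplex (EFin \o (fun w => Re (Gm w i j))) &
      forall i j, nu.-integrable simplex (EFin \o (fun w => Im (Gm w i j)))].
Proof.
move=> pX bG; have [rho hrho] := barycenter_exists pX.
have hH w : simplex w -> exists2 H : 'M[C]_d, H^t* = H &
    [/\ hsq H <= rho, Gm w = expm H & is_barycenter (tnth w) X (expm H)].
  move=> [w0 w1]; have [H [hH Hrho bH]] := hrho (tnth w) w0 w1.
  exists H => //; split => //.
  exact: (barycenter_unique w0 w1 pX (bG w (conj w0 w1)) bH).
have [L L0 hL] := barycenter_holder rho pX.
have hG i j w w' : simplex w -> simplex w' ->
    nrm2 ((Gm w - Gm w') i j) <= L * \sum_(i < n) `|(tnth w i : R) - tnth w' i|.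
  move=> Sw Sw'; have [H hh [Hr -> bH]] := hH w Sw; have [H' hh' [Hr' -> bH']] := hH w' Sw'.
  have := hL _ _ _ _ Sw.1 Sw.2 Sw'.1 Sw'.2 hh hh' Hr Hr' bH bH'.
  apply: le_trans; rewrite /hsq (bigD1 i)//= (bigD1 j)//= -addrA lerDl.
  by rewrite addr_ge0 ?sumr_ge0// => *; rewrite ?sumr_ge0// => *; exact: nrm2_ge0.
split.
- exists (expR (- Num.sqrt `|rho|)); first exact: expR_gt0.
  move=> w v Sw; have [H hh [Hr -> _]] := hH w Sw.
  by apply: expm_qf_ge => //; rewrite sqr_sqrtr// (le_trans Hr)// ler_norm.
- move=> i j; apply: (@holder_integrable _ _ _ L) => w w' Sw Sw'.
  apply: le_trans (hG i j w w' Sw Sw'); rewrite !mxE /nrm2 raddfB /=.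
  by rewrite lerDl sqr_ge0.
- move=> i j; apply: (@holder_integrable _ _ _ L) => w w' Sw Sw'.
  apply: le_trans (hG i j w w' Sw Sw'); rewrite !mxE /nrm2 [in leRHS](raddfB (im E)) /=.
  by rewrite lerDr sqr_ge0.
Qed.

Lemma qf_integral n d (nu : probability (n.-tuple (measurableTypeR R)) R)
    (Gm : n.-tuple (measurableTypeR R) -> 'M[C]_d) (S : 'M[C]_d) v :
  (forall i j, nu.-integrable simplex (EFin \o (fun w => Re (Gm w i j)))) ->
  (forall i j, nu.-integrable simplex (EFin \o (fun w => Im (Gm w i j)))) ->
  (forall i j, Re (S i j) = \int[nu]_(w in simplex) Re (Gm w i j)) ->
  (forall i j, Im (S i j) = \int[nu]_(w in simplex) Im (Gm w i j)) ->
  nu.-integrable simplex (EFin \o (fun w => qf (Gm w) v)) /\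
  \int[nu]_(w in simplex) qf (Gm w) v = qf S v.
Proof.
move=> iR iI SR SI; have mS := @measurable_simplex n.
pose c (p : 'I_d * 'I_d) := Num.conj (v p.1 0) * v p.2 0.
have qfE A : qf A v = \sum_p Re (c p) * Re (A p.1 p.2) - \sum_p Im (c p) * Im (A p.1 p.2).
  by rewrite qf_entries -sumrB pair_big.
have [iA eA] := integrable_lincomb (index_enum ('I_d * 'I_d)%type) (fun p => Re (c p))
  (fun p => iR p.1 p.2).
have [iB eB] := integrable_lincomb (index_enum ('I_d * 'I_d)%type) (fun p => Im (c p))
  (fun p => iI p.1 p.2).
have -> : (fun w => qf (Gm w) v) = (fun w => \sum_p Re (c p) * Re (Gm w p.1 p.2) -
    \sum_p Im (c p) * Im (Gm w p.1 p.2)) by apply/funext => w; exact: qfE.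
split.
  by have := integrableB mS iA iB; apply: eq_integrable => // w _; rewrite /= EFinB.
rewrite RintegralB// eA eB qfE.
by congr (_ - _); apply: eq_bigr => p _; rewrite ?SR ?SI.
Qed.

Lemma simplex_prod_powR n (x : 'I_n -> R) (w : n.-tuple (measurableTypeR R)) :
  (forall i, 0 < x i) ->
  \prod_(i < n) x i `^ (tnth w i : R) = expR (\sum_(i < n) (tnth w i : R) * ln (x i)).
Proof.
move=> x0; rewrite expR_sum; apply: eq_bigr => i _.
by rewrite /powR gt_eqF.
Qed.

Lemma horn_integral n d r (nu : probability (n.-tuple (measurableTypeR R)) R)
    (X : 'I_n -> 'M[C]_d) (Gm : n.-tuple (measurableTypeR R) -> 'M[C]_d) (S : 'M[C]_d)
    (I : 'I_n -> {set 'I_d}) (K : {set 'I_d}) :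
  nu simplex = 1%E -> (0 < r)%N -> (forall i, pd (X i)) ->
  (forall w, simplex w -> is_barycenter (tnth w) X (Gm w)) ->
  (forall i j, Re (S i j) = \int[nu]_(w in simplex) Re (Gm w i j)) ->
  (forall i j, Im (S i j) = \int[nu]_(w in simplex) Im (Gm w i j)) ->
  (forall i, #|I i| = r) -> #|K| = r ->
  (forall (U : 'I_n -> 'M[C]_d) (W : 'M[C]_d), (forall i, U i \is unitarymx) ->
     W \is unitarymx -> exists L : {vspace 'cV[C]_d}, [/\ \dim L = r,
       forall i (q : 'I_#|[set rev_ord k | k in I i]|),
         (q.+1 <= \dim (L :&: eigflag (U i) (@rev_ord d) (enum_val q)))%N &
       forall q : 'I_#|K|, (q.+1 <= \dim (L :&: eigflag W id (enum_val q)))%N]) ->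
  gamma_mean nu (fun j => (\prod_(k in I j) lambda (X j) k) `^ r%:R^-1) <=
    (\prod_(k in K) lambda S k) `^ r%:R^-1.
Proof.
move=> hnu r0 pX bG SR SI hI hK hL; have mS := @measurable_simplex n.
have [[e e0 hge] iR iI] := barycenter_integrable nu pX bG.
have iqf v := qf_integral v iR iI SR SI.
have hS : S^t* = S.
  apply/matrixP => i j; rewrite !mxE; apply/eqP; rewrite -subr_eq0 -nrm2_eq0 /nrm2.
  rewrite !raddfB re_conj im_conj /= !SR !SI.
  have hij w : simplex w -> Gm w i j = Num.conj (Gm w j i).
    by move=> Sw; have [[h _] _] := bG w Sw; rewrite -{1}h !mxE.
  have -> : \int[nu]_(w in simplex) Re (Gm w i j) = \int[nu]_(w in simplex) Re (Gm w j i).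
    by apply: eq_Rintegral => w /set_mem Sw; rewrite hij// re_conj.
  have -> : \int[nu]_(w in simplex) Im (Gm w i j) = - \int[nu]_(w in simplex) Im (Gm w j i).
    rewrite -mulN1r -RintegralZl//.
    by apply: eq_Rintegral => w /set_mem Sw; rewrite hij// im_conj mulN1r.
  by rewrite !subrr expr0n addr0.
have cstE (c : R) : \int[nu]_(w in simplex) c = c.
  by rewrite Rintegral_cst// (_ : fine _ = 1) ?mulr1// -[RHS]/(fine 1%E) -hnu.
have pS : pd S.
  split => // v v0; have [iv <-] := iqf v.
  apply: (@lt_le_trans _ _ (e * hsq v)); first by rewrite mulr_gt0// hsq_gt0.
  rewrite -[leLHS]cstE; apply: le_Rintegral => //; last by move=> w Sw; exact: hge.
  by apply: finite_measure_integrable_cst.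
have [V [hV hprod hw]] := schubert_barycenter r0 pX pS hI hK hL.
have rp : 0 < r%:R^-1 :> R by rewrite invr_gt0 ltr0n.
pose P i := \prod_(k in I i) lambda (X i) k.
have P0 i : 0 < P i by apply: prodr_gt0 => k _; exact: lambda_gt0.
have Q0 : 0 < \prod_(k in K) lambda S k by apply: prodr_gt0 => k _; exact: lambda_gt0.
have Vq0 q : col q V != 0.
  by apply/eqP => h; have := hsq_col_iso q hV; rewrite h hsq0 => /eqP; rewrite eq_sym oner_eq0.
have s0 q : 0 < qf S (col q V) by exact: pS.2.
(* [c] is the geometric mean of the numbers v_q^* S v_q, [F] the integrand of [gamma_mean] in
   exponential form, and [B] the linear majorant whose integral will be [c]. *)
pose c := expR (r%:R^-1 * \sum_q ln (qf S (col q V))).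
pose F (w : n.-tuple (measurableTypeR R)) := expR (\sum_(i < n) (tnth w i : R) * (r%:R^-1 * ln (P i))).
pose B w := \sum_q (r%:R^-1 * (c / qf S (col q V))) * qf (Gm w) (col q V).
have FB w : simplex w -> F w <= B w.
  move=> Sw; have [pG _] := bG w Sw.
  have := hw (tnth w) (Gm w) Sw.1 Sw.2 (bG w Sw) => h.
  apply: (@le_trans _ _ (expR (r%:R^-1 * \sum_q ln (qf (Gm w) (col q V))))).
    rewrite ler_expR; apply: (@le_trans _ _ (r%:R^-1 * (\sum_i tnth w i * ln (P i)))).
      rewrite mulr_sumr; apply: ler_sum => i _.
      by rewrite mulrCA.
    by rewrite ler_wpM2l// ltW.
  apply: le_trans (am_gm_weighted r0 s0 _ erefl) _ => [q|]; first exact: pG.2.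
  by rewrite /B mulr_sumr; apply: ler_sum => q _; rewrite mulrA.
have [iB eB] := integrable_lincomb (index_enum 'I_r)
  (fun q => r%:R^-1 * (c / qf S (col q V))) (fun q => (iqf (col q V)).1).
have iF : nu.-integrable simplex (EFin \o F).
  apply: le_integrable iB => //.
    apply/measurable_EFinP; apply: measurable_funTS; apply: measurableT_comp => //.
    apply: measurable_sum => i; apply: measurable_funM => //.
    exact: measurable_tnth.
  move=> w Sw /=; rewrite lee_fin !ger0_norm ?expR_ge0//; first exact: FB.
  exact: le_trans (expR_ge0 _) (FB w Sw).
apply: (@le_trans _ _ c).
  rewrite /gamma_mean (_ : Rintegral _ _ _ = \int[nu]_(w in simplex) F w); last first.
    apply: eq_Rintegral => w _.
    apply: etrans (simplex_prod_powR w (fun i => powR_gt0 r%:R^-1 (P0 i))) _.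
    by congr expR; apply: eq_bigr => i _; rewrite ln_powR.
  apply: le_trans (le_Rintegral mS iF iB FB) _; rewrite eB.
  (* Integration has replaced v_q^* G v_q by v_q^* S v_q, which cancels the denominators and leaves
     r terms equal to c / r. *)
  under eq_bigr => q _ do rewrite (iqf _).2 -!mulrA mulVf ?gt_eqF// mulr1.
  rewrite sumr_const card_ord -[leLHS]mulr_natl mulrA mulfV ?mul1r//.
  by rewrite pnatr_eq0 -lt0n.
rewrite /c -ln_prod// [expR _](_ : _ = (\prod_q qf S (col q V)) `^ r%:R^-1); last first.
  by rewrite /powR gt_eqF// prodr_gt0.
apply: ge0_ler_powR hprod; rewrite ?nnegrE; [exact: ltW| |exact: ltW].
by apply: prodr_ge0 => q _; exact: ltW.
Qed.

End MatrixMeans.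

(** * The interface at [R[i]] and the link with the given definitions *)

Section Complex.
Context {R : realType}.

Lemma complex_conjE (z : R[i]) : Num.conj z = (complex.Re z) -i* (complex.Im z).
Proof. by case: z. Qed.

Lemma complex_reMM (x y : R[i]) :
  complex.Re (x * y) = complex.Re x * complex.Re y - complex.Im x * complex.Im y.
Proof. by case: x => a b; case: y. Qed.

Lemma complex_conjM (z : R[i]) :
  Num.conj z * z = (complex.Re z ^+ 2 + complex.Im z ^+ 2)%:C.
Proof. case: z => a b; apply/eqP; rewrite complex_conjE eq_complex /=; apply/andP.
by split; apply/eqP; rewrite ?expr2; ring. Qed.

Definition complexificationRi : complexification R R[i] :=
  @Complexification R R[i] (real_complex R) (@complex.Re R) (@complex.Im R)
    (fun=> erefl) (fun=> erefl) complex_reMM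
    (fun z => congr1 (@complex.Re R) (complex_conjE z))
    (fun z => congr1 (@complex.Im R) (complex_conjE z)) (@RRe_real R) complex_conjM.

Local Notation E := complexificationRi.

Lemma delta_sqr d (X Y : 'M[R[i]]_d) : delta X Y ^+ 2 = dist2 E X Y.
Proof.
rewrite /delta /hs_norm sqr_sqrtr; first by rewrite /dist2 [RHS]hsqE.
have <- := hsqE E (mxlog (mx_invsqrt X *m Y *m mx_invsqrt X)).
exact: hsq_ge0.
Qed.

Lemma karcher_costE n d (w : n.-tuple R) (X : 'I_n -> 'M[R[i]]_d) M :
  karcher_cost w X M = cost E (tnth w) X M.
Proof. by apply: eq_bigr => i _; rewrite delta_sqr. Qed.

Lemma posdefP d (A : 'M[R[i]]_d) : posdef A <-> pd E A.
Proof.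
have herm := @hermsymmxP _ d A.
split=> -[hA h]; split; try exact/herm.
  by move=> v v0; rewrite -ltcR; have := h v v0; rewrite (qf_herm_real E v (herm.1 hA)).
by move=> v v0; rewrite (qf_herm_real E v hA) ltcR; exact: h.
Qed.

Lemma karcher_mean_barycenter n d (w : n.-tuple R) (X : 'I_n -> 'M[R[i]]_d) :
  (forall i, 0 <= tnth w i) -> \sum_i tnth w i = 1 -> (forall j, posdef (X j)) ->
  is_barycenter E (tnth w) X (karcher_mean w X).
Proof.
move=> w0 w1 hX.
have [rho h] := barycenter_exists (fun j => (posdefP (X j)).1 (hX j)).
have [H [_ _ [pH mH]]] := h _ w0 w1.
(* A minimizer exists, so [karcher_mean] is one and not the default 0. *)
have := @xgetPex _ 0 [set M | posdef M /\
    forall N, posdef N -> karcher_cost w X M <= karcher_cost w X N]%classic.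
case=> [|pM mM].
  exists (expm E H); split; first exact/posdefP.
  by move=> N /posdefP pN; rewrite !karcher_costE; exact: mH.
split; first exact/posdefP.
move=> N /posdefP pN; have := mM N pN; rewrite !karcher_costE; exact.
Qed.

Lemma horn_eigflags n d r (I : 'I_n -> {set 'I_d}) (K : {set 'I_d})
    (U : 'I_n -> 'M[R[i]]_d) (W : 'M[R[i]]_d) :
  horn_tuple R r I K -> (forall i, U i \is unitarymx) -> W \is unitarymx ->
  exists L : {vspace 'cV[R[i]]_d}, [/\ \dim L = r,
    forall i (q : 'I_#|[set rev_ord k | k in I i]|),
      (q.+1 <= \dim (L :&: eigflag (U i) (@rev_ord d) (enum_val q)))%N &
    forall q : 'I_#|K|, (q.+1 <= \dim (L :&: eigflag W id (enum_val q)))%N].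
Proof.
move=> [_ [hK h]] hU hW.
have [||L [hL [dL hLK]]] := h (fun j => eigflag (U j) (@rev_ord d)) (eigflag W id).
- by move=> j; exact: eigflag_complete (hU j) rev_ord_inj.
- by apply: (eigflag_complete (f := id) hW) => ? ?.
exists L; split => //; first by rewrite dL.
by move=> i; have [] := hL i Logic.I.
Qed.
End Complex.

Theorem theorem23 (R : realType) (n d r : nat)
    (nu : probability (n.-tuple (measurableTypeR R)) R)
    (hnu : nu simplex = 1%E)
    (X : 'I_n -> 'M[R[i]]_d) (hX : forall j, posdef (X j))
    (I : 'I_n -> {set 'I_d}) (K : {set 'I_d})
    (hr : (0 < r)%N) (hIK : horn_tuple R r I K) :
  gamma_mean nu (fun j => (\prod_(k in I j) lambda_up k (X j)) `^ (r%:R^-1))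
    <= (\prod_(k in K) lambda_up k (geodesic_mean nu X)) `^ (r%:R^-1).
Proof.
have [hI [hK _]] := hIK.
have pX j := (posdefP (X j)).1 (hX j).
have bG w (Sw : simplex w) := karcher_mean_barycenter Sw.1 Sw.2 hX.
have hL U W := @horn_eigflags R n d r I K U W hIK.
have SR i j : re (@complexificationRi R) (geodesic_mean nu X i j) =
    \int[nu]_(w in simplex) re (@complexificationRi R) (karcher_mean w X i j).
  by rewrite mxE.
have SI i j : im (@complexificationRi R) (geodesic_mean nu X i j) =
    \int[nu]_(w in simplex) im (@complexificationRi R) (karcher_mean w X i j).
  by rewrite mxE.
have := @horn_integral R R[i] (@complexificationRi R) n d r nu X.
move=> /(_ (fun w => karcher_mean w X) (geodesic_mean nu X) I K).
move=> /(_ hnu hr pX bG).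
move=> /(_ SR SI hI hK hL).
exact.
Qed.
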